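(* Let $Z$ be a standard Borel space and let $D$ be an $(S_{\mathbb N}\times S_{\mathbb N})$-invariant and ergodic Borel probability measure on the space of infinite matrices $Z^{\mathbb N\times\mathbb N}$. Then the following are equivalent: (i) there exist standard probability spaces $(X,\mu)$, $(Y,\nu)$ and a pure measurable function $f:(X,\mu)\times(Y,\nu)\to Z$ with trivial congruence group $K_f$ such that $D=D_f$ is the matrix distribution of $f$; (ii) $D$ is a simple measure.
   Context: A standard probability space is a standard Borel space with a Borel probability measure (atoms are allowed). $S_{\mathbb N}=\bigcup_{n\ge 1}S_{\{1,\dots,n\}}$ is the group of all finite permutations of $\mathbb N$. The group $S_{\mathbb N}\times S_{\mathbb N}$ acts on $Z^{\mathbb N\times\mathbb N}$ by separately permuting rows and columns: $g\cdot(r_{i,j})=(r_{g_1^{-1}(i),g_2^{-1}(j)})_{i,j}$ for $g=(g_1,g_2)$. Matrix distribution: for measurable $f:(X,\mu)\times(Y,\nu)\to Z$, $D_f=(\mu^{\mathbb N}\times\nu^{\mathbb N})\circ F_f^{-1}$, where $F_f:X^{\mathbb N}\times Y^{\mathbb N}\to Z^{\mathbb N\times\mathbb N}$, $F_f((x_i),(y_j))=(f(x_i,y_j))_{i,j}$. Factors and purity: a measurable function $f':(X',\mu')\times(Y',\nu')\to Z$ on a product of standard probability spaces is a factor of $f$ if there are measure-preserving maps $S:X\to X'$, $T:Y\to Y'$ (not necessarily invertible) with $f'(S(x),T(y))=f(x,y)$ for $\mu\times\nu$-a.e. $(x,y)$; $f$ and $f'$ are isomorphic if $S$ and $T$ can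 be chosen to be isomorphisms (mod $0$) of measure spaces. $f$ is pure if every factor of $f$ is isomorphic to $f$; equivalently, the maps $x\mapsto [f(x,\cdot)]_\nu$ and $y\mapsto[f(\cdot,y)]_\mu$ (into the spaces of a.e.-equivalence classes of measurable $Z$-valued functions on $Y$ and $X$, respectively) are each one-to-one on a set of full measure. Congruence group: $\mathrm{Aut}_0(X,\mu)$ denotes the group of measure-preserving automorphisms of $(X,\mu)$, identified modulo null sets, and $$K_f=\{(S,T)\in\mathrm{Aut}_0(X,\mu)\times\mathrm{Aut}_0(Y,\nu): f(S(x),T(y))=f(x,y)\ \text{for } \mu\times\nu\text{-a.e. }(x,y)\}.$$ It is trivial if it consists only of the identity. Simple measures: let $\mathfrak B$ be the Borel $\sigma$-algebra of $Z^{\mathbb N\times\mathbb N}$ and, for a subgroup $G\le S_{\mathbb N}\times S_{\mathbb N}$, let $\mathfrak B^{G}$ be the $\sigma$-algebra of $G$-invariant sets in $\mathfrak B$. An $(S_{\mathbb N}\times S_{\mathbb N})$-invariant ergodic probability measure $D$ is simple if $\mathfrak B^{S_{\mathbb N}\times\{1\}}\vee\mathfrak B^{\{1\}\times S_{\mathbb N}}=\mathfrak B$ (mod $D$), i.e. the $\sigma$-algebra generated by the two invariant $\sigma$-algebras coincides with $\mathfrak B$ up to $D$-null sets. *)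

(* Defs.v *)
From HB Require Import structures.
From mathcomp Require Import all_boot all_order all_algebra.
From mathcomp Require Import all_classical all_reals all_analysis.

Set Implicit Arguments.
Unset Strict Implicit.
Unset Printing Implicit Defensive.

Import Order.TTheory GRing.Theory Num.Theory.
Import numFieldNormedType.Exports.

Local Open Scope classical_set_scope.
Local Open Scope ring_scope.

(* A measurable space isomorphic to the Borel space of a Polish space, i.e. of
   a separated, second countable, complete (pseudo)metric space. All real types
   being isomorphic, the choice of [R] is immaterial. *)
Definition standard_borel (R : realType) d (T : measurableType d) : Prop :=
  exists P : completePseudoMetricType R,
    [/\ hausdorff_space P, @second_countable P &
      exists (phi : T -> g_sigma_algebraType (@open P))
             (psi : g_sigma_algebraType (@open P) -> T),
        [/\ measurable_fun setT phi, measurable_fun setT psi,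
            cancel phi psi & cancel psi phi]].

(* [power I T] is T^I with the product sigma-algebra, generated by the
   coordinate maps. If I is countable and T is standard Borel, it is the Borel
   sigma-algebra of T^I. *)
Definition coordinate_sets (I : Type) d (T : measurableType d) :
    set (set (I -> T)) :=
  [set C | exists i : I, exists2 A : set T, measurable A &
    C = (fun x => x i) @^-1` A].

Definition power (I : Type) d (T : measurableType d) :=
  g_sigma_algebraType (@coordinate_sets I d T).

HB.instance Definition _ (I : Type) d (T : measurableType d) :=
  Measurable.on (power I T).

Notation matrices Z := (power (nat * nat) Z).

(* [P] is the infinite product measure mu^N. This determines [P], the finite
   cylinders being a pi-system that generates the product sigma-algebra. *)
Definition is_power_measure (R : realType) d (X : measurableType d)
    (mu : probability X R) (P : probability (power nat X) R) : Prop :=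
  forall (n : nat) (A : nat -> set X), (forall i, measurable (A i)) ->
    P [set x | forall i, (i < n)%N -> A i (x i)] =
      (\prod_(i < n) mu (A i))%E.

Section functions_of_two_variables.
Context (R : realType) (dZ : measure_display) (Z : measurableType dZ).

Definition matrix_map (X Y : Type) (f : X * Y -> Z)
    (xy : (nat -> X) * (nat -> Y)) : matrices Z :=
  fun ij => f (xy.1 ij.1, xy.2 ij.2).

(* D = D_f; a measure is a function on all sets, hence the restriction to
   measurable ones. *)
Definition is_matrix_distribution dX (X : measurableType dX)
    dY (Y : measurableType dY) (mu : probability X R) (nu : probability Y R)
    (f : X * Y -> Z) (D : probability (matrices Z) R) : Prop :=
  exists (P : probability (power nat X) R) (Q : probability (power nat Y) R),
    [/\ is_power_measure mu P, is_power_measure nu Q &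
      forall B : set (matrices Z), measurable B ->
        D B = pushforward (P \x Q)%E (matrix_map f) B].

Definition measure_preserving d (T : measurableType d)
    d' (T' : measurableType d') (mu : probability T R) (mu' : probability T' R)
    (S : T -> T') : Prop :=
  measurable_fun setT S /\
  forall A : set T', measurable A -> mu (S @^-1` A) = mu' A.

Definition isomorphism_mod0 d (T : measurableType d)
    d' (T' : measurableType d') (mu : probability T R) (mu' : probability T' R)
    (S : T -> T') : Prop :=
  measure_preserving mu mu' S /\
  exists S' : T' -> T,
    [/\ measure_preserving mu' mu S',
        {ae mu, forall x, S' (S x) = x} & {ae mu', forall x, S (S' x) = x}].

(* f'(S(x), T(y)) = f(x, y) almost everywhere *)
Definition intertwines dX (X : measurableType dX) dY (Y : measurableType dY)
    (X' Y' : Type) (mu : probability X R) (nu : probability Y R)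
    (f : X * Y -> Z) (f' : X' * Y' -> Z) (S : X -> X') (T : Y -> Y') : Prop :=
  {ae (mu \x nu)%E, forall p, f' (S p.1, T p.2) = f p}.

Definition is_factor dX (X : measurableType dX) dY (Y : measurableType dY)
    dX' (X' : measurableType dX') dY' (Y' : measurableType dY')
    (mu : probability X R) (nu : probability Y R) (f : X * Y -> Z)
    (mu' : probability X' R) (nu' : probability Y' R) (f' : X' * Y' -> Z) :
    Prop :=
  exists (S : X -> X') (T : Y -> Y'),
    [/\ measure_preserving mu mu' S, measure_preserving nu nu' T &
        intertwines mu nu f f' S T].

Definition isomorphic dX (X : measurableType dX) dY (Y : measurableType dY)
    dX' (X' : measurableType dX') dY' (Y' : measurableType dY')
    (mu : probability X R) (nu : probability Y R) (f : X * Y -> Z)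
    (mu' : probability X' R) (nu' : probability Y' R) (f' : X' * Y' -> Z) :
    Prop :=
  exists (S : X -> X') (T : Y -> Y'),
    [/\ isomorphism_mod0 mu mu' S, isomorphism_mod0 nu nu' T &
        intertwines mu nu f f' S T].

Definition pure dX (X : measurableType dX) dY (Y : measurableType dY)
    (mu : probability X R) (nu : probability Y R) (f : X * Y -> Z) : Prop :=
  forall dX' (X' : measurableType dX') dY' (Y' : measurableType dY')
    (mu' : probability X' R) (nu' : probability Y' R) (f' : X' * Y' -> Z),
    standard_borel R X' -> standard_borel R Y' -> measurable_fun setT f' ->
    is_factor mu nu f mu' nu' f' -> isomorphic mu nu f mu' nu' f'.

(* Representatives of the elements of K_f; they are identified modulo null
   sets only in [trivial_congruence_group]. *)
Definition congruence_group dX (X : measurableType dX)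
    dY (Y : measurableType dY) (mu : probability X R) (nu : probability Y R)
    (f : X * Y -> Z) : set ((X -> X) * (Y -> Y)) :=
  [set g | [/\ isomorphism_mod0 mu mu g.1, isomorphism_mod0 nu nu g.2 &
               intertwines mu nu f f g.1 g.2]].

Definition trivial_congruence_group dX (X : measurableType dX)
    dY (Y : measurableType dY) (mu : probability X R) (nu : probability Y R)
    (f : X * Y -> Z) : Prop :=
  forall g, congruence_group mu nu f g ->
    {ae mu, forall x, g.1 x = x} /\ {ae nu, forall y, g.2 y = y}.

End functions_of_two_variables.

Record finperm := FinPerm {
  fperm :> nat -> nat;
  fperm_inv : nat -> nat;
  fpermK : cancel fperm fperm_inv;
  fperm_invK : cancel fperm_inv fperm;
  fperm_finite : exists n, forall i, (n <= i)%N -> fperm i = i }.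

(* Subgroups of S_N x S_N: the full group is [setT]. *)
Definition row_perms : set (finperm * finperm) := [set g : finperm * finperm | g.2 =1 id].
Definition col_perms : set (finperm * finperm) := [set g : finperm * finperm | g.1 =1 id].

Section invariant_measures.
Context (R : realType) (dZ : measure_display) (Z : measurableType dZ).
Implicit Types (D : probability (matrices Z) R) (G : set (finperm * finperm)).

Definition act (g : finperm * finperm) (r : matrices Z) : matrices Z :=
  fun ij => r (fperm_inv g.1 ij.1, fperm_inv g.2 ij.2).

Definition invariant_sets G : set (set (matrices Z)) :=
  [set B | measurable B /\ forall g, G g -> act g @^-1` B = B].

Definition invariant_measure D : Prop :=
  forall g (B : set (matrices Z)), measurable B -> D (act g @^-1` B) = D B.

Definition ergodic_measure D : Prop :=
  forall B, invariant_sets setT B -> D B = 0%E \/ D B = 1%E.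

Definition simple_measure D : Prop :=
  forall B : set (matrices Z), measurable B ->
    exists2 C, <<s invariant_sets row_perms `|` invariant_sets col_perms >> C &
      D ((B `\` C) `|` (C `\` B)) = 0%E.

End invariant_measures.

(* Main.v *)
Require Import Defs.
From HB Require Import structures.
From mathcomp Require Import all_boot all_order all_algebra.
From mathcomp Require Import all_classical all_reals all_analysis.
From mathcomp Require Import measurable_realfun.
From mathcomp Require Import ring lra.

(** Call [f] recoverable if the first sample points can be read off the sampled
    matrix: there are measurable [xi] and [eta] with

      [x_0 = xi (F_f (x, y))] and [y_0 = eta (F_f (x, y))] almost everywhere.

    Both sides of the equivalence are compared with this property.

    A recoverable function has all the required properties. If [(S, T)] is a
    factor map onto [f'], then [x_0 = xi (F_f' (S x, T y))]; fixing all the sample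
    points but [x_0] turns this into a formula for [x_0] in terms of [S x_0], so
    that [S] is an isomorphism and [f] is pure ([recovery_pure]). If [(S, T)]
    belongs to [K_f], then [(x, y)] and [(S x, T y)] have the same matrix, hence
    [S x_0 = x_0] ([recovery_trivial_congruence]). Finally [x_i], being recovered
    from the matrix with the rows [0] and [i] exchanged, is invariant under the
    permutations of the columns, [y_j] is invariant under those of the rows, and
    the entries of the matrix are the [f (x_i, y_j)]: the matrix distribution is
    simple ([recovery_simple]).

    A simple measure is the matrix distribution of a recoverable function
    ([simple_realized]). Simplicity writes the corner entry as [Psi (a, b)], with
    [a] invariant under the column permutations and [b] under the row
    permutations; by ergodicity [a] and [b] are independent
    ([row_col_independent]). Replacing [a] and [b] by their images [xi] and [eta]
    in the canonical factor of [Psi] ([canonical_factor]), where a point is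
    determined by its row, resp. column, of values, makes [xi] invariant under
    the row permutations that fix the row [0], because [Psi (., b)] at a typical
    [b] takes the same values before and after the permutation. Moving the row
    [0] to the row [i] gives a sequence [x_i] which is exchangeable, hence
    independent and identically distributed by ergodicity ([exchangeable_iid]),
    and similarly for [eta]. By construction the matrix is [(f (x_i, y_j))], and
    [xi] and [eta] recover [x_0] and [y_0].

    A pure function with trivial congruence group is recoverable
    ([pure_rigid_recovery]). Purity makes [f] isomorphic to its canonical factor,
    in which a point is determined by countably many integrals; the law of large
    numbers computes them, so that [x] is a function of [(y_l)] and
    [(f (x, y_l))] for almost every sample [(y_l)] ([pure_recover_point]). Draw
    two samples [(x, y)] and [(x', y')] independently given that their matrices
    are equal ([relative_coupling]), and let [v] consist of the points of odd
    index in both. Equality of the matrices gives [x'_0 = S_v x_0] and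
    [y'_0 = T_v y_0], where [S_v x] is the point of [X] whose values at the
    points [y'_l] of odd index are those of [x] at the [y_l]. As [(x_0, y_0)] is
    independent of [v] ([independent_of_odds]), as is [(x'_0, y'_0)], almost
    every [(S_v, T_v)] belongs to [K_f]. Thus [x'_0 = x_0] and [y'_0 = y_0]
    ([coupled_samples_agree]): two samples that are independent given their
    common matrix agree, so [x_0] and [y_0] are functions of the matrix. *)

Set Implicit Arguments.
Unset Strict Implicit.
Unset Printing Implicit Defensive.

Import Order.TTheory GRing.Theory Num.Theory.
Import numFieldNormedType.Exports.

Local Open Scope classical_set_scope.
Local Open Scope ring_scope.

(** * Probability laws and measure-preserving maps *)

Section power.
Context (I : Type) d (T : measurableType d).

Lemma measurable_coord i : measurable_fun setT (fun x : power I T => x i).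
Proof.
move=> _ A mA; rewrite setTI; apply: sub_sigma_algebra.
by exists i, A.
Qed.

Lemma measurable_fun_power d' (S : measurableType d') (f : S -> power I T) :
  (forall i, measurable_fun setT (fun s => f s i)) -> measurable_fun setT f.
Proof.
move=> mf; apply: (@measurability _ _ _ _ setT f (@coordinate_sets I d T)) => //.
move=> _ [_ [i [A mA ->]] <-].
exact: (mf i).
Qed.

End power.

Lemma measurable_precomp (I J : Type) d (T : measurableType d) (s : J -> I) :
  measurable_fun setT (fun x : power I T => (x \o s) : power J T).
Proof. by apply: measurable_fun_power => j; exact: measurable_coord. Qed.

Lemma measurable_postcomp (I : Type) d (T : measurableType d) d'
    (T' : measurableType d') (h : T -> T') : measurable_fun setT h ->
  measurable_fun setT (fun x : power I T => (h \o x) : power I T').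
Proof.
move=> mh; apply: measurable_fun_power => i.
exact: (measurableT_comp mh (measurable_coord i)).
Qed.

Section laws.
Context (R : realType).

Section probability.
Context d (T : measurableType d) (P : probability T R).
Local Open Scope ereal_scope.

Lemma pr_le A B : measurable A -> measurable B -> A `<=` B -> P A <= P B.
Proof. by move=> mA mB AB; rewrite le_measure ?inE. Qed.

Lemma pr_ge0 A : 0 <= P A. Proof. exact: measure_ge0. Qed.

Lemma pr_le0 A : P A <= 0 -> P A = 0.
Proof. by move=> A0; apply/eqP; rewrite eq_le A0 pr_ge0. Qed.

Lemma prU A B : measurable A -> measurable B -> P (A `|` B) <= P A + P B.
Proof. by move=> mA mB; exact: measureU2. Qed.

Lemma pr_fin A : measurable A -> P A \is a fin_num.
Proof. by move=> mA; exact: fin_num_measure. Qed.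

Lemma prT : P setT = 1.
Proof. exact: probability_setT. Qed.

Lemma prU_null A B : measurable A -> measurable B -> P B = 0 ->
  P (A `|` B) <= P A.
Proof. by move=> mA mB B0; rewrite (le_trans (prU mA mB))// B0 adde0. Qed.

End probability.

Lemma preimT d (T : measurableType d) d' (T' : measurableType d') (f : T -> T')
  A : measurable_fun setT f -> measurable A -> measurable (f @^-1` A).
Proof. by move=> mf mA; rewrite -[X in measurable X]setTI; exact: mf. Qed.

Lemma probability_eq d (T : measurableType d) (G : set (set T))
    (P Q : probability T R) :
  setI_closed G -> @measurable d T = <<s G >> -> (forall A, G A -> P A = Q A) ->
  forall A, measurable A -> P A = Q A.
Proof.
move=> GI mG PQ A mA.
have HE : [set X | G X /\ X `<=` setT] = G.
  by apply/seteqP; split=> X; [by case | by move=> GX; split].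
apply: (@g_sigma_algebra_measure_unique_trace _ _ _ G setT) => //; rewrite ?HE //.
- by rewrite mG; exact: sub_sigma_algebra.
- exact: etrans (probability_setT P) (esym (probability_setT Q)).
- have P1 : (P setT < +oo)%E by rewrite probability_setT ltry.
  exact: P1.
- by rewrite -mG.
Qed.

Section law.
Context d (T : measurableType d) d' (T' : measurableType d').
Variables (P : probability T R) (f : T -> T') (mf : measurable_fun setT f).

(** [mf] is an argument only to let the probability structure be inferred. *)
Definition law : set T' -> \bar R := let _ := mf in pushforward P f.

Let law0 : law set0 = 0%E. Proof. by rewrite /law /pushforward preimage_set0 measure0. Qed.
Let law_ge0 A : (0 <= law A)%E. Proof. exact: measure_ge0. Qed.
Let law_sigma : semi_sigma_additive law.
Proof.
move=> F mF tF mUF; rewrite /law /pushforward preimage_bigcup.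
apply: measure_semi_sigma_additive.
- by move=> n; exact: preimT.
- by move=> i j _ _ [x [/= ? ?]]; apply: tF => //; exists (f x).
- by rewrite -preimage_bigcup; exact: preimT.
Qed.
HB.instance Definition _ := isMeasure.Build _ _ _ law law0 law_ge0 law_sigma.
Let law1 : law setT = 1%E.
Proof. by rewrite /law /pushforward preimage_setT probability_setT. Qed.
HB.instance Definition _ := Measure_isProbability.Build _ _ _ law law1.
End law.

Section mp.
Context d (T : measurableType d) d' (T' : measurableType d')
  d'' (T'' : measurableType d'').

Lemma mp_law (P : probability T R) (f : T -> T') (mf : measurable_fun setT f) :
  measure_preserving P (law P mf) f.
Proof. by split. Qed.

Lemma mp_comp (P : probability T R) (Q : probability T' R) (S : probability T'' R)
    (f : T -> T') (g : T' -> T'') :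
  measure_preserving P Q f -> measure_preserving Q S g ->
  measure_preserving P S (g \o f).
Proof.
move=> [mf Pf] [mg Qg]; split; first exact: measurableT_comp.
by move=> A mA; rewrite comp_preimage Pf ?Qg//; exact: preimT.
Qed.

Lemma mp_ae (P : probability T R) (Q : probability T' R) (f : T -> T')
    (H : T' -> Prop) :
  measure_preserving P Q f -> {ae Q, forall x, H x} -> {ae P, forall x, H (f x)}.
Proof.
move=> [mf Pf] [N [mN N0 sN]]; exists (f @^-1` N); split.
- exact: preimT.
- by rewrite Pf.
- by move=> x; exact: sN.
Qed.

(** Unlike the preceding direction, this one needs [H] to be measurable, the
    image of a null set being arbitrary. *)
Lemma mp_aeP (P : probability T R) (Q : probability T' R) (f : T -> T')
    (H : set T') : measurable H ->
  measure_preserving P Q f -> {ae P, forall x, H (f x)} -> {ae Q, forall x, H x}.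
Proof.
move=> mH [mf Pf] [N [mN N0 sN]]; exists (~` H); split => //.
- exact: measurableC.
- rewrite -Pf; last exact: measurableC.
  by apply: pr_le0; rewrite -N0; apply: pr_le => //; apply: preimT => //; exact: measurableC.
Qed.

Lemma mp_id (P : probability T R) : measure_preserving P P id.
Proof. by split => //; exact: measurable_id. Qed.

Lemma prob_ae_eq (P : probability T R) (A B : set T) :
  measurable A -> measurable B -> {ae P, forall x, A x <-> B x} -> P A = P B.
Proof.
suff H (A' B' : set T) : measurable A' -> measurable B' ->
    {ae P, forall x, A' x <-> B' x} -> (P A' <= P B')%E.
  move=> mA mB AB; apply/eqP; rewrite eq_le !H//.
  by apply: filterS AB => x [? ?]; split.
move=> mA mB [N [mN N0 sN]].
apply: (@le_trans _ _ (P (B' `|` N))).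
  apply: le_measure; rewrite ?inE//; first exact: measurableU.
  move=> x hx; have [Nx|Nx] := pselect (N x); [by right|left].
  by apply: contrapT => Bx; apply: Nx; apply: sN => -[AB _]; apply: Bx; exact: AB.
exact: prU_null.
Qed.

Lemma prob0_ae (P : probability T R) (A : set T) :
  measurable A -> P A = 0%E -> {ae P, forall x, ~ A x}.
Proof. by move=> mA A0; exists A; split => // x /= /contrapT. Qed.

Lemma ae_prob0 (P : probability T R) (A : set T) :
  measurable A -> {ae P, forall x, ~ A x} -> P A = 0%E.
Proof.
move=> mA [N [mN N0 sN]]; apply: pr_le0; rewrite -N0; apply: pr_le => // x Ax.
by apply: sN.
Qed.

Lemma ae_ex (P : probability T R) (H : T -> Prop) :
  {ae P, forall x, H x} -> exists x, H x.
Proof.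
move=> [N [mN N0 sN]]; apply: contrapT => nH.
have : P setT = 0%E.
  apply: pr_le0; rewrite -N0; apply: pr_le => // x _.
  by apply: sN => Hx; apply: nH; exists x.
by rewrite probability_setT => /eqP; rewrite onee_eq0.
Qed.

End mp.

Section product.
Context d (T : measurableType d) d' (T' : measurableType d').
Implicit Types (mu : probability T R) (nu : probability T' R).

Lemma prod_probability_eq (P Q : probability (T * T')%type R) :
  (forall A B, measurable A -> measurable B -> P (A `*` B) = Q (A `*` B)) ->
  forall X, measurable X -> P X = Q X.
Proof.
move=> PQ.
apply: (@probability_eq _ _ [set A `*` B | A in measurable & B in measurable]).
- move=> _ _ [A1 mA1 [B1 mB1 <-]] [A2 mA2 [B2 mB2 <-]].
  exists (A1 `&` A2); first exact: measurableI.
  by exists (B1 `&` B2); [exact: measurableI | rewrite setXI].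
- exact: measurable_prod_measurableType.
- by move=> _ [A mA [B mB <-]]; exact: PQ.
Qed.

Lemma prodE mu nu A B : measurable A -> measurable B ->
  ((mu \x nu) (A `*` B) = mu A * nu B)%E.
Proof. by move=> mA mB; rewrite product_measure1E. Qed.

Lemma mp_pair d0 (S : measurableType d0) (P : probability S R) mu nu f g :
  measurable_fun setT f -> measurable_fun setT g ->
  (forall A B, measurable A -> measurable B ->
    P (f @^-1` A `&` g @^-1` B) = (mu A * nu B)%E) ->
  measure_preserving P (mu \x nu)%E (fun s => (f s, g s)).
Proof.
move=> mf mg fg; have mfg := measurable_fun_pair mf mg; split => // X mX.
rewrite -[LHS]/(law P mfg X).
apply: prod_probability_eq => // A B mA mB.
by transitivity (mu A * nu B)%E; [exact: fg | rewrite [RHS]prodE].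
Qed.

Lemma mp_fst mu nu : measure_preserving (mu \x nu)%E mu fst.
Proof.
split => [|A mA]; first exact: measurable_fst.
rewrite (_ : fst @^-1` A = A `*` setT); last by apply/seteqP; split => -[] //= ? ? [].
rewrite [LHS]prodE//.
by rewrite prT mule1.
Qed.

Lemma mp_snd mu nu : measure_preserving (mu \x nu)%E nu snd.
Proof.
split => [|A mA]; first exact: measurable_snd.
rewrite (_ : snd @^-1` A = setT `*` A); last by apply/seteqP; split => -[] //= ? ? [].
rewrite [LHS]prodE//.
by rewrite prT mul1e.
Qed.

Lemma measurable_section (C : set (T * T')) x : measurable C -> measurable [set y | C (x, y)].
Proof.
move=> mC; rewrite (_ : [set y | _] = xsection C x); first exact: measurable_xsection.
by apply/seteqP; split => y; rewrite /xsection /= inE.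
Qed.

Lemma measurable_section_measure nu (C : set (T * T')) :
  measurable C -> measurable_fun setT (fun x => nu [set y | C (x, y)]).
Proof.
move=> mC; apply: eq_measurable_fun (measurable_fun_xsection nu mC) => x _ /=; congr (nu _).
by apply/seteqP; split => y; rewrite /xsection /= inE.
Qed.

Lemma prod_fubini mu nu (X : set (T * T')) : measurable X ->
  ((mu \x nu) X = \int[mu]_x nu [set y | X (x, y)])%E.
Proof.
move=> mX; rewrite /product_measure1 /=.
apply: eq_integral => x _ /=; congr (nu _).
by apply/seteqP; split => y; rewrite /xsection /= inE.
Qed.

Lemma ae_prodE mu nu (H : T * T' -> Prop) :
  {ae (mu \x nu)%E, forall p, H p} ->
  {ae mu, forall x, {ae nu, forall y, H (x, y)}}.
Proof.
move=> [N [mN N0 sN]].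
rewrite prod_fubini// in N0.
have : (\int[mu]_x `| nu [set y | N (x, y)] | = 0)%E.
  rewrite -[RHS]N0; apply: eq_integral => x _.
  by rewrite gee0_abs// (pr_ge0 nu).
move/(ae_eq_integral_abs mu measurableT (measurable_section_measure nu mN)).
apply: filterS => x /(_ I) N0x; exists [set y | N (x, y)]; split => //.
  exact: measurable_section.
by move=> y; exact: sN.
Qed.

Lemma ae_prodI mu nu (H : set (T * T')) : measurable H ->
  {ae mu, forall x, {ae nu, forall y, H (x, y)}} ->
  {ae (mu \x nu)%E, forall p, H p}.
Proof.
move=> mH Hae; exists (~` H); split => //; first exact: measurableC.
rewrite prod_fubini; last exact: measurableC.
have mx' := measurable_section_measure nu (measurableC mH).
rewrite (@ae_eq_integral _ _ _ mu setT (cst 0%E)) ?integral0//.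
apply: filterS Hae => x Hx _ /=.
  apply: ae_prob0; first exact: (measurable_section x (measurableC mH)).
  by apply: filterS Hx => y Hy /=; exact.
Qed.

End product.
End laws.

(** * Codes of points by bit sequences *)

Definition bitseqs := power nat bool.
HB.instance Definition _ := Measurable.on bitseqs.

Definition bits (T : Type) (E : nat -> set T) (x : T) : bitseqs :=
  fun n => `[< E n x >].

Lemma measurable_bits d (T : measurableType d) (E : nat -> set T) :
  (forall n, measurable (E n)) -> measurable_fun setT (bits E).
Proof.
move=> mE; apply: measurable_fun_power => n.
apply: (@measurable_fun_bool _ _ _ _ true); rewrite setTI.
rewrite (_ : _ @^-1` _ = E n)//; apply/seteqP; split => x; rewrite /preimage /= /bits.
  by move=> /asboolP.
by move=> Enx; apply/asboolP.
Qed.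

Lemma measurable_bit n : measurable [set b : bitseqs | b n].
Proof.
rewrite (_ : [set b | _] = (fun b : bitseqs => b n) @^-1` [set true])//.
by apply: preimT; [exact: measurable_coord | ].
Qed.

Lemma mem_set_bool T (p : T -> bool) x : (x \in [set y | p y]) = p x.
Proof. by apply/idP/idP; rewrite inE. Qed.

Section ternary.
Context (R : realType).
Implicit Types (b : bitseqs) (x : R).

Definition shift b : bitseqs := fun n => b n.+1.

Fixpoint ternary_sum n b : R :=
  if n is m.+1 then (2 * (b 0%N)%:R + ternary_sum m (shift b)) / 3 else 0.

Lemma ternary_sum_bounds n b : 0 <= ternary_sum n b <= 1.
Proof.
elim: n b => [|n IH] b /=; first by rewrite lexx ler01.
have /andP[h0 h1] := IH (shift b).
by apply/andP; split; case: (b 0%N) => /=; lra.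
Qed.

Lemma ternary_sum_le n b : ternary_sum n b <= ternary_sum n.+1 b.
Proof.
elim: n b => [|n IH] b; first by have /andP[] := ternary_sum_bounds 1 b.
rewrite -[X in X <= _]/((2 * (b 0%N)%:R + ternary_sum n (shift b)) / 3).
rewrite -[X in _ <= X]/((2 * (b 0%N)%:R + ternary_sum n.+1 (shift b)) / 3).
by have := IH (shift b); lra.
Qed.

Lemma ternary_cvg b : cvgn (ternary_sum ^~ b).
Proof.
apply: nondecreasing_is_cvgn.
  by apply/nondecreasing_seqP => n; exact: ternary_sum_le.
by exists 1 => _ [n _ <-]; have /andP[] := ternary_sum_bounds n b.
Qed.

(** The identification of bit sequences with the points of the Cantor set,
    through which laws on bit sequences become laws on the real line. *)
Definition ternary_encode b : R := limn (ternary_sum ^~ b).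

Lemma encodeE b : ternary_encode b = (2 * (b 0%N)%:R + ternary_encode (shift b)) / 3.
Proof.
apply/cvg_lim => //.
rewrite -(cvg_shiftS (ternary_sum ^~ b)) /=.
apply: cvgM; last exact: cvg_cst.
apply: cvgD; first exact: cvg_cst.
exact: ternary_cvg.
Qed.

Lemma encode_bounds b : 0 <= ternary_encode b <= 1.
Proof.
apply/andP; split.
  apply: limr_ge; first exact: ternary_cvg.
  by apply: nearW => n; have /andP[] := ternary_sum_bounds n b.
apply: limr_le; first exact: ternary_cvg.
by apply: nearW => n; have /andP[] := ternary_sum_bounds n b.
Qed.

Lemma measurable_encode : measurable_fun setT ternary_encode.
Proof.
have mt n : measurable_fun setT (ternary_sum n).
  elim: n => [|n IH] /=; first exact: measurable_cst.
  apply: measurable_funM; last exact: measurable_cst.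
  apply: measurable_funD.
    apply: measurable_funM; first exact: measurable_cst.
    rewrite (_ : (fun b => _) = \1_[set b : bitseqs | b 0%N]).
      by apply: measurable_indic; exact: (measurable_bit 0).
    by apply/funext => b; rewrite indicE mem_set_bool.
  apply: (measurableT_comp IH).
  exact: (@measurable_precomp _ _ _ _ S).
apply: (measurable_fun_cvg mt) => b _.
exact: ternary_cvg.
Qed.

Definition ternary_step x : R := if 1/2 <= x then 3 * x - 2 else 3 * x.

Definition ternary_decode x : bitseqs := fun n => 1/2 <= iter n ternary_step x.

Lemma encodeK : cancel ternary_encode ternary_decode.
Proof.
have half b : (1/2 <= ternary_encode b) = b 0%N.
  rewrite encodeE; have /andP[h0 h1] := encode_bounds (shift b).
  by case: (b 0%N) => /=; [apply/idP; lra | apply/negbTE; rewrite -ltNge; lra].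
have step b : ternary_step (ternary_encode b) = ternary_encode (shift b).
  rewrite /ternary_step half {1 2}[ternary_encode b]encodeE.
  by case: (b 0%N) => /=; field.
move=> b; apply/funext => n; rewrite /ternary_decode.
suff -> : iter n ternary_step (ternary_encode b) = ternary_encode (fun k => b (k + n)%N).
  by rewrite half.
elim: n => [|n IH] /=; first by congr ternary_encode; apply/funext => k; rewrite addn0.
rewrite IH step; congr ternary_encode; apply/funext => k.
by rewrite /shift addnS.
Qed.

Lemma measurable_decode : measurable_fun setT ternary_decode.
Proof.
have mle : measurable_fun setT (fun x : R => 1/2 <= x).
  apply: measurable_fun_ler; [exact: measurable_cst | exact: measurable_id].
have m3 : measurable_fun setT (fun x : R => 3 * x).
  by apply: measurable_funM; [exact: measurable_cst | exact: measurable_id].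
have mstep : measurable_fun setT ternary_step.
  apply: measurable_fun_ifT.
  - exact: mle.
  - by apply: measurable_funB; [exact: m3 | exact: measurable_cst].
  - exact: m3.
apply: measurable_fun_power => n.
apply: (measurableT_comp mle).
elim: n => [|n IH]; first exact: measurable_id.
exact: (measurableT_comp mstep IH).
Qed.

End ternary.

(** A measurable retract of the space of bit sequences. This keeps from a
    standard Borel space what the arguments use: a measurable diagonal and a
    countable family of sets that determines probabilities; and it passes to
    products by a mere rearrangement of bits. *)
Definition coded d (X : measurableType d) :=
  exists (c : X -> bitseqs) (r : bitseqs -> X),
    [/\ measurable_fun setT c, measurable_fun setT r & cancel c r].

Lemma coded_bitseqs : coded bitseqs.
Proof. by exists id, id; split => //; exact: measurable_id. Qed.

Section polish.
Context (R : realType) (P : completePseudoMetricType R).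
Hypothesis (hP : hausdorff_space P) (U : nat -> set P).
Hypothesis (oU : forall n, open (U n)).
Hypothesis (bU : forall x N, nbhs x N -> exists2 n, U n x & U n `<=` N).

Definition small k n := forall x y, U n x -> U n y -> ball x k.+1%:R^-1 y.

(** The bit sequences [b] for which the sets [U n] with [b n] are the base
    of a Cauchy filter, contain with each of them the closure of another,
    and are closed under passing to larger sets of the base. Each condition
    involves countably many bits. *)
Definition point_codes : set bitseqs :=
  (\bigcap_k \bigcup_(n in small k) [set b | b n]) `&`
  (\bigcap_m \bigcap_n (~` [set b | b m] `|` ~` [set b | b n] `|`
      \bigcup_(l in [set l | U l `<=` U m `&` U n /\ U l !=set0]) [set b | b l])) `&`
  (\bigcap_n (~` [set b | b n] `|`
      \bigcup_(m in [set m | closure (U m) `<=` U n]) [set b | b m])) `&`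
  (\bigcap_m \bigcap_(n in [set n | U m `<=` U n])
      (~` [set b | b m] `|` [set b | b n])).

Lemma measurable_point_codes : measurable point_codes.
Proof.
apply: measurableI; [apply: measurableI; [apply: measurableI|]|].
- apply: bigcapT_measurable => k; apply: bigcup_measurable => n _.
  exact: measurable_bit.
- apply: bigcapT_measurable => m; apply: bigcapT_measurable => n.
  apply: measurableU; [apply: measurableU; apply: measurableC; exact: measurable_bit|].
  apply: bigcup_measurable => l _; exact: measurable_bit.
- apply: bigcapT_measurable => n; apply: measurableU.
    by apply: measurableC; exact: measurable_bit.
  apply: bigcup_measurable => l _; exact: measurable_bit.
- apply: bigcapT_measurable => m; apply: bigcap_measurableType => n _.
  by apply: measurableU; [apply: measurableC|]; exact: measurable_bit.
Qed.

Lemma bits_point_codes z : point_codes (bits U z).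
Proof.
have bE n : bits U z n <-> U n z by split => [/asboolP|? ]//; exact/asboolP.
split; [split; [split|]|].
- move=> k _; have k0 : 0 < (k.+1%:R^-1 / 2 : R) by rewrite divr_gt0// invr_gt0.
  have [n Unz Un] := bU (nbhsx_ballx z _ k0).
  exists n; last exact/bE.
  move=> x y Ux Uy; have : ball z (k.+1%:R^-1 / 2) x by exact: Un.
  move/ball_sym => xz; have zy : ball z (k.+1%:R^-1 / 2) y by exact: Un.
  by rewrite [X in ball _ X](splitr k.+1%:R^-1); exact: ball_triangle xz zy.
- move=> m _ n _.
  have [Um|Um] := pselect (U m z); last by left; left => /bE.
  have [Un|Un] := pselect (U n z); last by left; right => /bE.
  right; have : nbhs z (U m `&` U n).
    by apply: filterI; apply: open_nbhs_nbhs; split.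
  by move=> /bU [l Ul sl]; exists l; [split => //; exists z | exact/bE].
- move=> n _; have [Un|Un] := pselect (U n z); last by left => /bE.
  right; have : nbhs z (U n) by apply: open_nbhs_nbhs.
  move=> /(@uniform_regular P z) [N Nz cN].
  have [m Um mN] := bU Nz; exists m; last exact/bE.
  by apply: subset_trans cN; exact: closureS.
- move=> m _ n /= mn; have [Um|Um] := pselect (U m z); last by left => /bE.
  by right; apply/bE; exact: mn.
Qed.

(** Completeness provides the limit [z] of the filter; the condition on
    closures puts [z] inside the sets [U n] with [b n], and the last
    condition shows that these are all the [U n] that contain [z]. *)
Lemma point_codesP b : point_codes b -> exists z, bits U z = b.
Proof.
move=> [[[b1 b2] b3] b4].
have b2' m n : b m -> b n ->
    exists l, [/\ b l, U l `<=` U m `&` U n & U l !=set0].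
  move=> bm bn; have [[//|//]|] := b2 m I n I.
  by move=> [l [? ?] ?]; exists l.
pose F := filter_from [set n | b n] U.
have FF : ProperFilter F.
  apply: filter_from_proper; last first.
    by move=> m bm; have [l [_ lm [x xl]]] := b2' m m bm bm; exists x; have [] := lm _ xl.
  apply: filter_from_filter.
    by have [n _ bn] := b1 0%N I; exists n.
  by move=> m n bm bn; have [l [? ? _]] := b2' m n bm bn; exists l.
have : cauchy F.
  apply/cauchy_ballP => e e0.
  have [k ke] : exists k, k.+1%:R^-1 < e :> R.
    have := near_infty_natSinv_lt (PosNum e0).
    by case=> k _ /(_ k (leqnn k)) /= ?; exists k.
  have [n sn bn] := b1 k I.
  exists (U n, U n) => /=; first by split; exists n.
  move=> [x y] /= [Ux Uy]; apply: (@le_ball _ _ x k.+1%:R^-1); first exact: ltW.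
  exact: sn.
move=> /cauchy_cvg /cvg_ex [z Fz]; exists z.
apply/funext => n; rewrite /bits; apply/asboolP/idP.
  move=> Unz; have [m bm mn] : F (U n).
    by apply: Fz; apply: open_nbhs_nbhs; split.
  by have [] := b4 m I n mn.
move=> bn; have [//|[m cm bm]] := b3 n I.
apply: cm => A zA.
have [l bl lA] : F A by exact: Fz.
have [k [bk km [x xk]]] := b2' m l bm bl.
by exists x; have [xm xl] := km _ xk; split => //; exact: lA.
Qed.

End polish.

(** Membership in the sets of a countable base codes a point of a Polish
    space, and the codes that occur form a measurable set; the other bit
    sequences are decoded to a default point. *)
Lemma standard_borel_coded (R : realType) d (X : measurableType d) :
  standard_borel R X -> coded X.
Proof.
move=> [P [hP [B cB [oB bB]] [phi [psi [mphi mpsi phiK psiK]]]]].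
have [f fB] : exists f : set P -> nat, {in B &, injective f}.
  by move/countable_injP : cB => [f fB]; exists f.
pose U n : set P := [set x | exists V, [/\ B V, f V = n & V x]].
have UE V : B V -> U (f V) = V.
  move=> BV; apply/seteqP; split => x.
    by move=> [W [BW fWV Wx]]; rewrite -(fB W V) ?inE.
  by move=> Vx; exists V.
have oU n : open (U n).
  have [[V [BV fV]]|nV] := pselect (exists V, B V /\ f V = n).
    by rewrite -fV UE//; exact: oB.
  rewrite (_ : U n = set0); first exact: open0.
  by apply/seteqP; split => x // [V [BV fV _]]; apply: nV; exists V.
have bU x N : nbhs x N -> exists2 n, U n x & U n `<=` N.
  by move=> /(bB x) [V [BV Vx] VN]; exists (f V); rewrite UE.
pose E n := phi @^-1` U n.
have EU x : bits E x = bits U (phi x) by [].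
have mE n : measurable (E n).
  by apply: (preimT mphi); apply: sub_sigma_algebra; exact: oU.
pose r b := xget point [set x | bits E x = b].
have rP b : point_codes U b -> bits E (r b) = b.
  move=> /(point_codesP oU) [z zb]; rewrite /r.
  by case: xgetP => [x _ //|/(_ (psi z))]; rewrite /= EU psiK.
have injU x y : bits U x = bits U y -> x = y.
  move=> xy; apply: hP => A C Ax Cy.
  have [n Un nA] := bU _ _ Ax; have [m Um mC] := bU _ _ Cy.
  have Uny : U n y by apply/asboolP; rewrite -/(bits U y n) -xy; exact/asboolP.
  by exists y; split; [exact: nA | exact: mC].
exists (bits E), r; split; first exact: measurable_bits; last first.
  move=> x; apply: (can_inj phiK); apply: injU; rewrite -!EU rP//.
  by rewrite EU; exact: bits_point_codes.
suff mr : measurable_fun setT (phi \o r).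
  rewrite (_ : r = psi \o (phi \o r)); first exact: measurableT_comp.
  by apply/funext => b /=; rewrite phiK.
apply: (@measurability _ _ _ _ setT (phi \o r) (@open P)) => //.
move=> _ [V oV <-]; rewrite setTI.
have mR := measurable_point_codes U.
rewrite (_ : _ @^-1` V = (point_codes U `&`
     \bigcup_(n in [set n | U n `<=` V]) [set b | b n]) `|`
     (~` point_codes U `&` (phi \o r) @^-1` V)); last first.
  apply/seteqP; split => b.
    move=> Ob; have [Rb|Rb] := pselect (point_codes U b); [left|by right].
    split => //; have : nbhs (phi (r b)) V by apply: open_nbhs_nbhs.
    move=> /bU [n Un nO]; exists n => //=.
    rewrite -(rP _ Rb); exact/asboolP.
  move=> [[Rb [n nO bn]]|[]//]; apply: nO => /=.
  have : bits E (r b) n by rewrite rP.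
  by move=> /asboolP.
apply: measurableU.
  apply: measurableI => //; apply: bigcup_measurable => n _; exact: measurable_bit.
have [Op|nOp] := pselect (V (phi point)).
  rewrite (_ : _ `&` _ = ~` point_codes U); first exact: measurableC.
  apply/seteqP; split => b; first by case.
  move=> nb; split => //=; rewrite /r.
  case: xgetP => [x _ /= xb|//]; exfalso; apply: nb.
  by rewrite -xb EU; exact: bits_point_codes.
rewrite (_ : _ `&` _ = set0)//.
apply/seteqP; split => b // [nb] /=; rewrite /r.
case: xgetP => [x _ /= xb|//]; exfalso; apply: nb.
by rewrite -xb EU; exact: bits_point_codes.
Qed.

Lemma standard_borel_real (R : realType) : standard_borel R (measurableTypeR R).
Proof.
exists R; split; [exact: Rhausdorff | | ].
  exists [set `](ratr q.1), (ratr q.2)[%classic | q in [set: rat * rat]].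
    by apply: (sub_countable (card_image_le _ _)); exact: countableP.
  split; first by move=> _ [q _ <-]; exact: interval_open.
  move=> x N /nbhs_ballP[e /= e0 eN].
  have xe : x - e < x by rewrite ltrBlDr ltrDl.
  have ex : x < x + e by rewrite ltrDl.
  have [p /[!in_itv]/= /andP[p1 p2]] := rat_in_itvoo xe.
  have [q /[!in_itv]/= /andP[q1 q2]] := rat_in_itvoo ex.
  exists `](ratr p), (ratr q)[%classic.
    by split; [exists (p, q) | rewrite /= in_itv /= p2 q1].
  move=> y /=; rewrite in_itv /= => /andP[y1 y2]; apply: eN.
  rewrite /ball /= ltr_norml; lra.
exists id, id; split => //.
  apply: (@measurability _ _ (measurableTypeR R) (g_sigma_algebraType (@open R))
    setT id (@open R)) => //.
  move=> _ [V oV <-]; rewrite setTI; exact: open_measurable.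
apply: (@measurability _ _ (g_sigma_algebraType (@open R)) (measurableTypeR R) setT id _ (RGenOpens.measurableE R)).
move=> _ [_ [x [y ->]] <-]; rewrite setTI.
apply: sub_sigma_algebra; exact: interval_open.
Qed.

Lemma coded_power (I : countType) d (X : measurableType d) :
  coded X -> coded (power I X).
Proof.
move=> [c [r [mc mr cr]]].
exists (fun x n => if @unpickle (I * nat)%type n is Some ij
  then c (x ij.1) ij.2 else false).
exists (fun b i => r (fun j => b (pickle (i, j)))).
split.
- apply: measurable_fun_power => n; case: unpickle => [[i j]|] /=; last first.
    exact: measurable_cst.
  have mj : measurable_fun setT (fun b : bitseqs => b j) by exact: measurable_coord.
  exact: (measurableT_comp mj (measurableT_comp mc (measurable_coord i))).
- apply: measurable_fun_power => i; apply: (measurableT_comp mr).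
  exact: (measurable_precomp (fun j => pickle (i, j))).
- move=> x; apply/funext => i; rewrite -[RHS]cr; congr r.
  by apply/funext => j; rewrite pickleK.
Qed.

Lemma coded_pair d (X : measurableType d) d' (Y : measurableType d') :
  coded X -> coded Y -> coded (X * Y)%type.
Proof.
move=> [c [r [mc mr cr]]] [c' [r' [mc' mr' cr']]].
exists (fun x n => if @unpickle (bool * nat)%type n is Some bj
  then (if bj.1 then c x.1 bj.2 else c' x.2 bj.2) else false).
exists (fun b => (r (fun j => b (pickle (true, j))), r' (fun j => b (pickle (false, j))))).
split.
- apply: measurable_fun_power => n; case: unpickle => [[a j]|] /=.
    have mj : measurable_fun setT (fun b : bitseqs => b j) by exact: measurable_coord.
    case: a.
      exact: (measurableT_comp mj (measurableT_comp mc measurable_fst)).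
    exact: (measurableT_comp mj (measurableT_comp mc' measurable_snd)).
  exact: measurable_cst.
- apply: measurable_fun_pair.
    apply: (measurableT_comp mr).
    exact: (measurable_precomp (fun j => pickle (true, j))).
  apply: (measurableT_comp mr').
  exact: (measurable_precomp (fun j => pickle (false, j))).
- move=> [x y] /=; congr pair.
    by rewrite -[RHS]cr; congr r; apply/funext => j; rewrite pickleK.
  by rewrite -[RHS]cr'; congr r'; apply/funext => j; rewrite pickleK.
Qed.

(** Equality means equality of all the bits. *)
Lemma measurable_eq d (X : measurableType d) d' (T : measurableType d')
    (f g : T -> X) : coded X ->
  measurable_fun setT f -> measurable_fun setT g -> measurable [set t | f t = g t].
Proof.
move=> [c [r [mc mr cr]]] mf mg.
rewrite (_ : [set t | _] = \bigcap_n [set t | c (f t) n == c (g t) n]).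
  apply: bigcapT_measurable => n.
  have mcf h : measurable_fun setT h -> measurable [set t : T | c (h t) n].
    move=> mh; apply: (@preimT _ _ _ _ (c \o h) [set b | b n]).
      exact: measurableT_comp.
    exact: measurable_bit.
  rewrite (_ : [set t | _] = ([set t | c (f t) n] `&` [set t | c (g t) n]) `|`
      (~` [set t | c (f t) n] `&` ~` [set t | c (g t) n])).
    apply: measurableU; apply: measurableI; try apply: measurableC; exact: mcf.
  apply/seteqP; split => t /=; first by case: (c (f t) n); case: (c (g t) n) => //= _; [left|right].
  by case: (c (f t) n); case: (c (g t) n) => //= -[[]|[]].
apply/seteqP; split => t /=; first by move=> fg n _ /=; rewrite fg.
move=> h; apply: (can_inj cr); apply/funext => n.
by have /eqP := h n I.
Qed.

(** * Products and infinite powers of probabilities *)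

Section product_maps.
Context (R : realType).

Lemma mp_prod d1 (S : measurableType d1) d2 (T : measurableType d2)
    d3 (S' : measurableType d3) d4 (T' : measurableType d4)
    (P : probability S R) (Q : probability T R)
    (P' : probability S' R) (Q' : probability T' R) f g :
  measure_preserving P P' f -> measure_preserving Q Q' g ->
  measure_preserving (P \x Q)%E (P' \x Q')%E (fun z => (f z.1, g z.2)).
Proof.
move=> [mf Pf] [mg Qg]; apply: mp_pair.
- exact: (measurableT_comp mf measurable_fst).
- exact: (measurableT_comp mg measurable_snd).
- move=> A B mA mB; rewrite -Pf// -Qg// -prodE//; exact: preimT.
Qed.

Lemma mp_swap d1 (S : measurableType d1) d2 (T : measurableType d2)
    (P : probability S R) (Q : probability T R) :
  measure_preserving (P \x Q)%E (Q \x P)%E (fun z => (z.2, z.1)).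
Proof.
apply: mp_pair; [exact: measurable_snd | exact: measurable_fst |].
move=> A B mA mB; rewrite muleC -prodE//; congr (_ _).
by apply/seteqP; split => -[x y] [].
Qed.

Lemma integral_prod d1 (S : measurableType d1) d2 (T : measurableType d2)
    (P : probability S R) (Q : probability T R) (f : S -> \bar R) (g : T -> \bar R) :
  measurable_fun setT f -> measurable_fun setT g ->
  (forall x, 0 <= f x)%E -> (forall x, 0 <= g x)%E ->
  (\int[P \x Q]_z (f z.1 * g z.2) = (\int[P]_x f x) * (\int[Q]_y g y))%E.
Proof.
move=> mf mg f0 g0.
have mfg : measurable_fun setT (fun z : S * T => (f z.1 * g z.2)%E).
  apply: emeasurable_funM.
    exact: (measurableT_comp mf measurable_fst).
  exact: (measurableT_comp mg measurable_snd).
rewrite fubini_tonelli1//; last by move=> z; exact: mule_ge0.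
rewrite /fubini_F.
transitivity (\int[P]_x (f x * \int[Q]_y g y))%E.
  by apply: eq_integral => x _ /=; rewrite ge0_integralZl.
by rewrite ge0_integralZr// integral_ge0.
Qed.

(** On rectangles both sides are integrals over pairs, by Fubini, of
    products of measures of sections. *)
Lemma mp_interchange d1 (S : measurableType d1) d2 (T : measurableType d2)
    d3 (S' : measurableType d3) d4 (T' : measurableType d4)
    (P : probability S R) (Q : probability T R)
    (P' : probability S' R) (Q' : probability T' R) :
  measure_preserving ((P \x P') \x (Q \x Q'))%E ((P \x Q) \x (P' \x Q'))%E
    (fun z => ((z.1.1, z.2.1), (z.1.2, z.2.2))).
Proof.
have m1 := @measurable_fst _ _ S S'; have m2 := @measurable_snd _ _ S S'.
have m3 := @measurable_fst _ _ T T'; have m4 := @measurable_snd _ _ T T'.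
have m5 := @measurable_fst _ _ (S * S')%type (T * T')%type.
have m6 := @measurable_snd _ _ (S * S')%type (T * T')%type.
have mf : measurable_fun setT (fun z : (S * S') * (T * T') => (z.1.1, z.2.1)).
  by apply: measurable_fun_pair; [exact: (measurableT_comp m1 m5)|exact: (measurableT_comp m3 m6)].
have mg : measurable_fun setT (fun z : (S * S') * (T * T') => (z.1.2, z.2.2)).
  by apply: measurable_fun_pair; [exact: (measurableT_comp m2 m5)|exact: (measurableT_comp m4 m6)].
apply: mp_pair => // A B mA mB.
have mAB : measurable ((fun z : (S * S') * (T * T') => (z.1.1, z.2.1)) @^-1` A `&`
   (fun z : (S * S') * (T * T') => (z.1.2, z.2.2)) @^-1` B).
  by apply: measurableI; exact: preimT.
rewrite [LHS]prod_fubini// [X in _ = (X * _)%E]prod_fubini// [X in _ = (_ * X)%E]prod_fubini//.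
rewrite -integral_prod; try by [exact: measurable_section_measure | move=> ?; exact: pr_ge0].
apply: eq_integral => -[x x'] _ /=.
by rewrite -[RHS]prodE; [congr (_ _) | exact: measurable_section | exact: measurable_section].
Qed.

End product_maps.

Lemma ae_swap (R : realType) d (X : measurableType d) d' (Y : measurableType d')
    (mu : probability X R) (nu : probability Y R) (H : X * Y -> Prop) :
  {ae (mu \x nu)%E, forall p, H p} -> {ae (nu \x mu)%E, forall p, H (p.2, p.1)}.
Proof. exact: (mp_ae (mp_swap nu mu)). Qed.

Section power_measure.
Context (R : realType) d (X : measurableType d).
Implicit Types (mu : probability X R) (P : probability (power nat X) R).

Definition cylinder n (A : nat -> set X) : set (power nat X) :=
  [set x | forall i, (i < n)%N -> A i (x i)].

Lemma cylinderS n A : cylinder n.+1 A = cylinder n A `&` (fun x : power nat X => x n) @^-1` A n.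
Proof.
apply/seteqP; split => x.
  by move=> h; split; [move=> i il; apply: h; exact: ltnW | exact: h].
move=> [h hn] i; rewrite ltnS leq_eqVlt => /predU1P[->//|]; exact: h.
Qed.

Lemma measurable_cylinder n A : (forall i, measurable (A i)) -> measurable (cylinder n A).
Proof.
move=> mA; elim: n => [|n IH].
  by rewrite (_ : cylinder 0 A = setT)//; apply/seteqP; split.
by rewrite cylinderS; apply: measurableI => //; exact: (preimT (measurable_coord n)).
Qed.

Lemma is_power_measure_unique mu P P' : is_power_measure mu P ->
  is_power_measure mu P' -> forall A, measurable A -> P A = P' A.
Proof.
move=> hP hP'.
pose G := [set C | exists n A, (forall i, measurable (A i)) /\ C = cylinder n A].
apply: (@probability_eq _ _ _ G).
- move=> _ _ [n [A [mA ->]]] [m [B [mB ->]]].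
  exists (maxn n m), (fun i => (if (i < n)%N then A i else setT) `&`
    (if (i < m)%N then B i else setT)); split.
    by move=> i; apply: measurableI; case: ifP.
  apply/seteqP; split => x.
    move=> [hA hB] i im; split; case: ifP => // ?; [exact: hA | exact: hB].
  move=> h; split=> i il; have := h i; rewrite leq_max il ?orbT => /(_ isT) [] //.
- apply/seteqP; split; apply: smallest_sub; try exact: smallest_sigma_algebra.
    move=> _ [i [A mA ->]]; apply: sub_sigma_algebra.
    exists i.+1, (fun j => if j == i then A else setT); split; first by move=> j; case: ifP.
    apply/seteqP; split => x; first by move=> Ax j ji; case: eqP => // ->.
    by move=> /(_ i (ltnSn i)); rewrite eqxx.
  by move=> _ [n [A [mA ->]]]; exact: measurable_cylinder.
- by move=> _ [n [A [mA ->]]]; rewrite [LHS]hP// [RHS]hP'.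
Qed.

Lemma is_power_measure_mp mu P d' (T : measurableType d') (Q : probability T R)
    (f : T -> power nat X) : is_power_measure mu P -> measurable_fun setT f ->
  (forall n A, (forall i, measurable (A i)) ->
     Q [set t | forall i, (i < n)%N -> A i (f t i)] = (\prod_(i < n) mu (A i))%E) ->
  measure_preserving Q P f.
Proof.
move=> hP mf h; split => // A mA.
have hl : is_power_measure mu (law Q mf) by move=> n B mB; exact: h.
exact: (is_power_measure_unique hl hP mA).
Qed.

Lemma power_measure_seq mu P (s : seq nat) A : is_power_measure mu P -> uniq s ->
  (forall i, measurable (A i)) ->
  P [set x | forall i, i \in s -> A i (x i)] = (\prod_(i <- s) mu (A i))%E.
Proof.
move=> hP us mA; pose n := (\max_(i <- s) i).+1.
have sn i : i \in s -> (i < n)%N by move=> si; rewrite ltnS; exact: leq_bigmax_seq.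
pose B i := if i \in s then A i else setT.
transitivity (P (cylinder n B)).
  congr (_ _); apply/seteqP; split => x.
    by move=> h i _; rewrite /B; case: ifP => //; exact: h.
  by move=> h i si; have := h i (sn _ si); rewrite /B si.
rewrite [LHS]hP; last by move=> i; rewrite /B; case: ifP.
rewrite -(big_mkord xpredT (fun i => mu (B i))) (bigID (fun i => i \in s)) /=.
rewrite [X in (_ * X)%E]big1 ?mule1; last first.
  by move=> i /negbTE is_; rewrite /B is_ prT.
rewrite (eq_bigr (fun i => mu (A i))); last by move=> i si; rewrite /B si.
rewrite -big_filter; apply: perm_big; apply: uniq_perm => //.
  by rewrite filter_uniq// iota_uniq.
move=> i; rewrite mem_filter mem_index_iota /=.
by case: (boolP (i \in s)) => // /sn ->.
Qed.

Lemma mp_reindex mu P (s : nat -> nat) : is_power_measure mu P -> injective s ->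
  measure_preserving P P (fun x : power nat X => (x \o s : power nat X)).
Proof.
move=> hP si; apply: (is_power_measure_mp hP); first exact: measurable_precomp.
move=> n A mA.
pose r k := index k (map s (iota 0 n)).
have rs i : (i < n)%N -> r (s i) = i.
  move=> il; rewrite /r index_map//.
  by rewrite -[X in index X _](@nth_iota 0%N 0 n i)// index_uniq ?size_iota ?iota_uniq.
have un : uniq (map s (iota 0 n)) by rewrite map_inj_uniq ?iota_uniq.
transitivity (P [set x | forall k, k \in map s (iota 0 n) -> A (r k) (x k)]).
  congr (_ _); apply/seteqP; split => x h.
    move=> k /mapP[i]; rewrite mem_iota add0n => /= il ->.
    by rewrite rs//; exact: h.
  move=> i il /=; have := h (s i); rewrite rs//; apply.
  by apply: map_f; rewrite mem_iota add0n.
rewrite [LHS](power_measure_seq (A := fun k => A (r k)) hP)// big_map -(big_mkord xpredT (fun i => mu (A i))).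
rewrite /index_iota subn0 !big_seq; apply: eq_bigr => i; rewrite mem_iota add0n => /= il.
by rewrite rs.
Qed.

Lemma mp_coord mu P k : is_power_measure mu P ->
  measure_preserving P mu (fun x : power nat X => x k).
Proof.
move=> hP; split; first exact: measurable_coord.
move=> A mA; transitivity (P [set x | forall i, i \in [:: k] -> A (x i)]).
  congr (_ _); apply/seteqP; split => x.
    by move=> Ax i; rewrite inE => /eqP ->.
  by apply; rewrite inE.
by rewrite [LHS](power_measure_seq (A := fun=> A) hP)// big_seq1.
Qed.

Lemma mp_coord2 mu P k l : is_power_measure mu P -> k != l ->
  measure_preserving P (mu \x mu)%E (fun x : power nat X => (x k, x l)).
Proof.
move=> hP kl; apply: mp_pair; [exact: measurable_coord | exact: measurable_coord |] => A B mA mB.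
have := power_measure_seq (s := [:: k; l]) (A := fun i => if i == k then A else B) hP.
rewrite big_cons big_seq1 eqxx eq_sym (negbTE kl) => <-; last 2 first.
- by rewrite /= inE kl.
- by move=> i; case: ifP.
congr (_ _); apply/seteqP; split => y.
  move=> [Ay By] i; rewrite !inE => /orP[]/eqP->; first by rewrite eqxx.
  by rewrite eq_sym (negbTE kl).
move=> h; split.
  by have := h k; rewrite !inE eqxx => /(_ isT).
by have := h l; rewrite !inE eqxx orbT eq_sym (negbTE kl) => /(_ isT).
Qed.

Definition cons_point (z : X * power nat X) : power nat X :=
  fun i => if i is j.+1 then z.2 j else z.1.

Lemma measurable_cons_point : measurable_fun setT cons_point.
Proof.
apply: measurable_fun_power => -[|i]; first exact: measurable_fst.
exact: (measurableT_comp (measurable_coord i) measurable_snd).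
Qed.

Lemma mp_cons mu P : is_power_measure mu P ->
  measure_preserving (mu \x P)%E P cons_point.
Proof.
move=> hP; apply: (is_power_measure_mp hP); first exact: measurable_cons_point.
move=> [|n] A mA.
  rewrite big_ord0 (_ : [set t | _] = setT)//; last by apply/seteqP; split.
  exact: prT.
rewrite big_ord_recl -[X in (_ * X)%E](hP n (fun i => A i.+1))// -prodE//; last first.
  exact: (@measurable_cylinder n (fun i => A i.+1)).
congr (_ _); apply/seteqP; split => -[x y] /=.
  by move=> h; split; [exact: (h 0%N)| move=> i il; exact: (h i.+1)].
by move=> [h0 h] [|i] //; exact: h.
Qed.

End power_measure.

Lemma mp_postcomp (R : realType) d (X : measurableType d) d' (X' : measurableType d')
    (mu : probability X R) (mu' : probability X' R) (P : probability (power nat X) R)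
    (P' : probability (power nat X') R) h :
  is_power_measure mu P -> is_power_measure mu' P' -> measure_preserving mu mu' h ->
  measure_preserving P P' (fun x : power nat X => (h \o x : power nat X')).
Proof.
move=> hP hP' [mh muh]; apply: (is_power_measure_mp hP').
  exact: measurable_postcomp.
move=> n B mB.
rewrite (_ : [set t | _] = cylinder n (fun i => h @^-1` B i)); last by [].
by rewrite [LHS]hP; [apply: eq_bigr => i _; rewrite muh | move=> i; exact: preimT].
Qed.

(** * Expectations of bounded functions *)

Section bounded_measurable.
Context (R : realType) d (T : measurableType d).
Implicit Types f g : T -> R.

Definition bdm f := measurable_fun setT f /\ exists M, forall x, `|f x| <= M.

Lemma bdm_cst c : bdm (fun=> c).
Proof. by split; [exact: measurable_cst | exists `|c|]. Qed.

Lemma bdmD f g : bdm f -> bdm g -> bdm (fun x => f x + g x).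
Proof.
move=> [mf [M fM]] [mg [N gN]]; split; first exact: measurable_funD.
by exists (M + N) => x; rewrite (le_trans (ler_normD _ _))// lerD.
Qed.

Lemma bdmM f g : bdm f -> bdm g -> bdm (fun x => f x * g x).
Proof.
move=> [mf [M fM]] [mg [N gN]]; split; first exact: measurable_funM.
by exists (M * N) => x; rewrite normrM ler_pM.
Qed.

Lemma bdmZ c f : bdm f -> bdm (fun x => c * f x).
Proof. by move=> bf; apply: bdmM => //; exact: bdm_cst. Qed.

Lemma bdmB f g : bdm f -> bdm g -> bdm (fun x => f x - g x).
Proof.
move=> bf bg; have := bdmD bf (bdmZ (-1) bg).
by congr bdm; apply/funext => x; rewrite mulN1r.
Qed.

Lemma bdmX f n : bdm f -> bdm (fun x => f x ^+ n).
Proof.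
move=> bf; elim: n => [|n IH]; first exact: bdm_cst.
by have := bdmM bf IH; congr bdm; apply/funext => x; rewrite exprS.
Qed.

Lemma bdm_sum I (s : seq I) (f : I -> T -> R) : (forall i, bdm (f i)) ->
  bdm (fun x => \sum_(i <- s) f i x).
Proof.
move=> bf; elim: s => [|i s IH].
  have := bdm_cst (0 : R); congr bdm; apply/funext => x; by rewrite big_nil.
by have := bdmD (bf i) IH; congr bdm; apply/funext => x; rewrite big_cons.
Qed.

Lemma bdm_indic A : measurable A -> bdm (\1_A).
Proof.
move=> mA; split; first exact: measurable_indic.
by exists 1 => x; rewrite indicE; case: (x \in A); rewrite ?normr1 ?normr0.
Qed.

Lemma bdm01 f : measurable_fun setT f -> (forall x, 0 <= f x <= 1) -> bdm f.
Proof.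
move=> mf f01; split => //; exists 1 => x.
by have /andP[? ?] := f01 x; rewrite ger0_norm.
Qed.

End bounded_measurable.

Lemma bdm_comp (R : realType) d (T : measurableType d) d' (S : measurableType d')
    (h : S -> T) (f : T -> R) :
  measurable_fun setT h -> bdm f -> bdm (f \o h).
Proof. by move=> mh [mf [M fM]]; split; [exact: measurableT_comp | exists M => x; exact: fM]. Qed.

Section unit_interval.
Context (R : realType).

Lemma indic01 T (A : set T) (x : T) : 0 <= (\1_A x : R) <= 1.
Proof. by rewrite indicE; case: (_ \in _); rewrite ?lexx ?ler01. Qed.

Lemma mul01 (x y : R) : 0 <= x <= 1 -> 0 <= y <= 1 -> 0 <= x * y <= 1.
Proof. by move=> /andP[? ?] /andP[? ?]; rewrite mulr_ge0//= mulr_ile1. Qed.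

End unit_interval.

Section expectation.
Context (R : realType) d (T : measurableType d) (P : probability T R).
Implicit Types f g : T -> R.

Definition mean f : R := (\int[P]_x f x)%R.

Lemma bdm_integrable f : bdm f -> P.-integrable setT (EFin \o f).
Proof.
move=> [mf [M fM]]; apply: measurable_bounded_integrable => //.
  by rewrite ltey_eq fin_num_measure.
exists M; split; first exact: num_real.
by move=> x Mx t _ /=; rewrite (le_trans (fM t))// ltW.
Qed.

Lemma meanE f : bdm f -> (\int[P]_x (f x)%:E = (mean f)%:E)%E.
Proof.
by move=> bf; rewrite /mean /Rintegral fineK//; exact: integrable_fin_num (bdm_integrable bf).
Qed.

Lemma meanD f g : bdm f -> bdm g -> mean (fun x => f x + g x) = mean f + mean g.
Proof. by move=> bf bg; rewrite /mean RintegralD//; exact: bdm_integrable. Qed.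

Lemma meanB f g : bdm f -> bdm g -> mean (fun x => f x - g x) = mean f - mean g.
Proof. by move=> bf bg; rewrite /mean RintegralB//; exact: bdm_integrable. Qed.

Lemma meanZ c f : bdm f -> mean (fun x => c * f x) = c * mean f.
Proof. by move=> bf; rewrite /mean RintegralZl//; exact: bdm_integrable. Qed.

Lemma mean_cst c : mean (fun=> c) = c.
Proof.
rewrite /mean /Rintegral (integral_cst P measurableT c%:E).
by rewrite [X in (_ * X)%E]prT mule1.
Qed.

Lemma mean_sum I (s : seq I) (f : I -> T -> R) : (forall i, bdm (f i)) ->
  mean (fun x => \sum_(i <- s) f i x) = \sum_(i <- s) mean (f i).
Proof.
move=> bf; elim: s => [|i s IH].
  rewrite big_nil -[RHS](mean_cst 0); congr mean; apply/funext => x.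
  by rewrite big_nil.
rewrite big_cons -IH -meanD//; last exact: bdm_sum.
by congr mean; apply/funext => x; rewrite big_cons.
Qed.

Lemma mean_le f g : bdm f -> bdm g -> (forall x, f x <= g x) -> mean f <= mean g.
Proof. by move=> bf bg fg; apply: le_Rintegral => //; exact: bdm_integrable. Qed.

Lemma mean01 f : bdm f -> (forall x, 0 <= f x <= 1) -> 0 <= mean f <= 1.
Proof.
move=> bf f01; rewrite -{1}(mean_cst 0) -(mean_cst 1).
by apply/andP; split; apply: mean_le => //; try exact: bdm_cst; move=> x; have /andP[] := f01 x.
Qed.

Lemma meanZr f c : bdm f -> mean (fun x => f x * c) = mean f * c.
Proof. by move=> bf; rewrite mulrC -meanZ//; congr mean; apply/funext => x; rewrite mulrC. Qed.

Lemma mean_indic A : measurable A -> mean \1_A = fine (P A).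
Proof. by move=> mA; rewrite /mean /Rintegral integral_indic// setIT. Qed.

Lemma mean_indicM A f : measurable A -> bdm f ->
  (\int[P]_(x in A) (f x)%:E = (mean (fun x => f x * \1_A x))%:E)%E.
Proof.
move=> mA bf; rewrite -meanE; last exact: bdmM bf (bdm_indic _ mA).
rewrite integral_mkcond; apply: eq_integral => x _; rewrite patchE indicE.
by case: (x \in A); rewrite ?mulr1 ?mulr0.
Qed.

Lemma mean_sqr f : bdm f -> mean f ^+ 2 <= mean (fun x => f x ^+ 2).
Proof.
move=> bf; set m := mean f.
have : 0 <= mean (fun x => (f x - m) ^+ 2).
  rewrite -(mean_cst 0); apply: mean_le; first exact: bdm_cst.
    by apply: bdmX; apply: bdmB => //; exact: bdm_cst.
  by move=> x; exact: sqr_ge0.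
rewrite (_ : mean _ = mean (fun x => f x ^+ 2) - m ^+ 2) ?subr_ge0//.
transitivity (mean (fun x => (f x ^+ 2 - (2 * m) * f x) + m ^+ 2)).
  by congr mean; apply/funext => x; ring.
rewrite meanD ?meanB ?meanZ ?mean_cst//; try exact: bdm_cst.
- by rewrite -/m; ring.
- exact: bdmX.
- exact: bdmZ.
- by apply: bdmB; [exact: bdmX | exact: bdmZ].
Qed.

Lemma mean_mp d' (S : measurableType d') (Q : probability S R) (h : T -> S) (f : S -> R) :
  measure_preserving P Q h -> bdm f -> mean (f \o h) = (\int[Q]_x f x)%R.
Proof.
move=> [mh Ph] bf; rewrite /mean /Rintegral; congr fine.
rewrite [RHS](@eq_measure_integral _ _ _ setT (pushforward P h)); last first.
  by move=> A mA _; rewrite -[LHS]Ph.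
rewrite integral_pushforward//.
- by apply/measurable_EFinP; exact: bf.1.
- apply: (@bdm_integrable (f \o h)); exact: bdm_comp.
Qed.

End expectation.

Section mean_tools.
Context (R : realType).

Lemma mean_ae_eq d (T : measurableType d) (P : probability T R) (f g : T -> R) :
  bdm f -> bdm g -> {ae P, forall x, f x = g x} -> mean P f = mean P g.
Proof.
move=> bf bg fg; apply: EFin_inj; rewrite -!meanE//; apply: ae_eq_integral => //.
- by apply/measurable_EFinP; exact: bf.1.
- by apply/measurable_EFinP; exact: bg.1.
- by apply: filterS fg => x e _; rewrite e.
Qed.

Lemma measurable_mean_section d (X : measurableType d) d' (Y : measurableType d')
    (nu : probability Y R) (g : X * Y -> R) :
  measurable_fun setT g -> (forall p, 0 <= g p) ->
  measurable_fun setT (fun x => mean nu (fun y => g (x, y))).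
Proof.
move=> mg g0.
have mE : measurable_fun setT (fun p => (g p)%:E) by apply/measurable_EFinP.
have := @measurable_fun_fubini_tonelli_F _ _ X Y R nu _ mE (fun p => g0 p).
move=> h; exact: (measurableT_comp (fine_measurable measurableT) h).
Qed.

Lemma mean_fubini d (X : measurableType d) d' (Y : measurableType d')
    (mu : probability X R) (nu : probability Y R) (g : X * Y -> R) :
  measurable_fun setT g -> (forall p, 0 <= g p <= 1) ->
  mean (mu \x nu)%E g = mean mu (fun x => mean nu (fun y => g (x, y))).
Proof.
move=> mg g01; have g0 p : 0 <= g p by have /andP[] := g01 p.
have bg := bdm01 mg g01.
have bgx x : bdm (fun y => g (x, y)).
  apply: bdm01 => //.
  exact: (measurableT_comp mg (measurable_fun_pair (measurable_cst x) (@measurable_id _ _ _))).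
have b2 : bdm (fun x => mean nu (fun y => g (x, y))).
  apply: bdm01; first exact: measurable_mean_section.
  by move=> x; apply: mean01 => // y; exact: g01.
apply: EFin_inj; rewrite -!meanE// fubini_tonelli1//; last first.
  by apply/measurable_EFinP.
by rewrite /fubini_F; apply: eq_integral => x _; rewrite -meanE.
Qed.

End mean_tools.

Section averages.
Context (R : realType) d (T : measurableType d) (P : probability T R).

(** Constant correlations make the second moment of a combination depend
    only on the sum of the weights and on the sum of their squares. *)
Lemma mean_quadratic (h : nat -> T -> R) a b (c : nat -> R) n :
  (forall k, bdm (h k)) ->
  (forall k l, k != l -> mean P (fun x => h k x * h l x) = a) ->
  (forall k, mean P (fun x => h k x * h k x) = b) ->
  mean P (fun x => (\sum_(0 <= k < n) c k * h k x) ^+ 2) =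
    a * (\sum_(0 <= k < n) c k) ^+ 2 + (b - a) * \sum_(0 <= k < n) c k ^+ 2.
Proof.
move=> bh ha hb.
have bkl k l : bdm (fun x => (c k * c l) * (h k x * h l x)).
  by apply: bdmZ; exact: bdmM.
transitivity (mean P (fun x => \sum_(0 <= k < n) \sum_(0 <= l < n)
    (c k * c l) * (h k x * h l x))).
  congr mean; apply/funext => x; rewrite expr2 big_distrlr /=.
  by apply: eq_bigr => k _; apply: eq_bigr => l _; ring.
rewrite mean_sum; last by move=> k; exact: bdm_sum.
rewrite expr2 big_distrlr /= !mulr_sumr -big_split /=.
apply: eq_big_nat => k kn.
rewrite mean_sum//.
transitivity (\sum_(0 <= l < n) (a * (c k * c l) +
    (if l == k then (b - a) * (c k * c l) else 0))).
  apply: eq_bigr => l _; rewrite meanZ; last exact: bdmM.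
  case: eqP => [->|/eqP lk]; first by rewrite hb; ring.
  by rewrite ha 1?eq_sym//; ring.
rewrite big_split /= -mulr_sumr; congr (_ + _).
rewrite -big_mkcond /= big_nat1_eq kn /= expr2; ring.
Qed.

(** The averages of the indicators of the [U k] converge to [p] in mean
    square, their variance being of the order of the inverse of the number
    of terms. Each of these averages has correlation [c] with [V], whence
    the value of [c]. *)
Lemma independent_of_constant_correlation (U : nat -> set T) V p c :
  (forall k, measurable (U k)) -> measurable V ->
  (forall k, P (U k) = p%:E) ->
  (forall k l, k != l -> P (U k `&` U l) = (p * p)%:E) ->
  (forall k, P (U k `&` V) = c%:E) -> c = p * fine (P V).
Proof.
move=> mU mV hp hpp hc.
pose h k x : R := \1_(U k) x - p.
have bh k : bdm (h k) by apply: bdmB; [exact: bdm_indic | exact: bdm_cst].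
have b1 A : measurable A -> bdm (\1_A : T -> R) by exact: bdm_indic.
have mII A B : measurable A -> measurable B ->
    mean P (fun x => \1_A x * \1_B x) = fine (P (A `&` B)).
  move=> mA mB; rewrite -mean_indic; last exact: measurableI.
  by congr mean; apply/funext => x; rewrite indicI.
have hh k l : mean P (fun x => h k x * h l x) = fine (P (U k `&` U l)) - p * p.
  transitivity (mean P (fun x => \1_(U k) x * \1_(U l) x -
     (p * (\1_(U k) x + \1_(U l) x) - p * p))).
    by congr mean; apply/funext => x; rewrite /h; ring.
  have bs : bdm (fun x => \1_(U k) x + \1_(U l) x : R) by apply: bdmD; exact: b1.
  rewrite !meanB ?meanZ ?meanD ?mean_cst ?mII ?mean_indic ?hp//=; try exact: bdm_cst; try exact: b1.
  - by ring.
  - exact: bdmZ.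
  - by apply: bdmM; exact: b1.
  - by apply: bdmB; [exact: bdmZ | exact: bdm_cst].
have q0 k l : k != l -> mean P (fun x => h k x * h l x) = 0.
  by move=> kl; rewrite hh hpp//= subrr.
have qb k : mean P (fun x => h k x * h k x) = p - p * p.
  by rewrite hh setIid hp.
set e := c - p * fine (P V).
have he k : mean P (fun x => h k x * \1_V x) = e.
  transitivity (mean P (fun x => \1_(U k) x * \1_V x - p * \1_V x)).
    by congr mean; apply/funext => x; rewrite /h; ring.
  rewrite meanB ?meanZ ?mII ?mean_indic ?hc//; try exact: b1.
  - by apply: bdmM; exact: b1.
  - by apply: bdmZ; exact: b1.
have pp : p - p * p <= 1.
  have p0 : 0 <= p by rewrite -lee_fin -(hp 0%N); exact: pr_ge0.
  have p1 : p <= 1 by rewrite -lee_fin -(hp 0%N); exact: probability_le1.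
  nra.
have bnd n : n.+1%:R * e ^+ 2 <= 1.
  pose av x := \sum_(0 <= k < n.+1) n.+1%:R^-1 * h k x.
  have bav : bdm av by apply: bdm_sum => k; exact: bdmZ.
  have n0 : 0 < n.+1%:R :> R by [].
  have Eav : mean P (fun x => av x * \1_V x) = e.
    transitivity (mean P (fun x => \sum_(0 <= k < n.+1) n.+1%:R^-1 * (h k x * \1_V x))).
      by congr mean; apply/funext => x; rewrite /av mulr_suml; apply: eq_bigr => k _; ring.
    rewrite mean_sum; last by move=> k; apply: bdmZ; apply: bdmM => //; exact: b1.
    rewrite (eq_bigr (fun=> n.+1%:R^-1 * e)); last first.
      by move=> k _; rewrite meanZ ?he//; apply: bdmM => //; exact: b1.
    by rewrite sumr_const_nat subn0 -[LHS]mulr_natl mulrA mulfV ?mul1r// lt0r_neq0.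
  have : e ^+ 2 <= n.+1%:R^-1 * (p - p * p).
    rewrite -Eav; apply: (le_trans (mean_sqr _ _)).
      by apply: bdmM => //; exact: b1.
    rewrite (_ : _ * (p - _) = mean P (fun x => av x ^+ 2)).
      apply: mean_le; [by apply: bdmX; apply: bdmM => //; exact: b1|exact: bdmX|].
      move=> x; rewrite indicE; case: (x \in V); rewrite ?mulr1// mulr0 expr0n/=; exact: sqr_ge0.
    rewrite /av (mean_quadratic (a := 0) (b := p - p * p))// mul0r add0r subr0.
    rewrite sumr_const_nat subn0 -[(_ ^+ 2) *+ _]mulr_natl expr2 [n.+1%:R * _]mulrA mulfV ?mul1r ?lt0r_neq0//.
    exact: mulrC.
  rewrite ler_pdivlMl// => h1; exact: (le_trans h1).
have e20 : e ^+ 2 = 0.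
  apply/eqP; rewrite eq_le sqr_ge0 andbT leNgt; apply/negP => e2.
  have := bnd (Num.truncn (e ^+ 2)^-1).
  apply/negP; rewrite -ltNge -ltr_pdivrMr// div1r; exact: truncnS_gt.
by apply/eqP; rewrite -subr_eq0 -/e -[_ == 0](expf_eq0 e 2) e20.
Qed.

End averages.

(** * Averages and conditional probabilities *)

Lemma geometric_steps_cvg (R : realType) (b : nat -> R) K :
  (forall k, `|b k.+1 - b k| <= K * 2^-1 ^+ k) -> cvgn b.
Proof.
move=> hb.
have -> : b = fun n => b 0%N + series (telescope b) n.
  by apply/funext => n; exact: eq_sum_telescope.
apply: is_cvgD; first exact: is_cvg_cst.
apply: normed_cvg.
apply: (@series_le_cvg _ _ (geometric K 2^-1)) => [n|n|n|].
- exact: normr_ge0.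
- exact: le_trans (normr_ge0 _) (hb n).
- exact: hb.
- by apply: is_cvg_geometric_series; rewrite ger0_norm; lra.
Qed.

Lemma geometric_bound_cvg (R : realType) (b : nat -> R) p K :
  (forall k, `|b k - p| <= K * 2^-1 ^+ k) -> b @ \oo --> p.
Proof.
move=> hb; apply/subr_cvg0.
have g0 : geometric K (2^-1 : R) @ \oo --> (0 : R).
  by apply: cvg_geometric; rewrite ger0_norm; lra.
apply: norm_cvg0; apply: (squeeze_cvgr _ (cvg_cst 0) g0).
by apply: nearW => k; rewrite normr_ge0 hb.
Qed.

Lemma sum_nat_cst (R : realType) n (c : R) : \sum_(0 <= i < n) c = n%:R * c.
Proof. by rewrite sumr_const_nat subn0 mulr_natl. Qed.

Section almost_everywhere.
Context (R : realType) d (T : measurableType d) (P : probability T R).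

(** The series of the [4 ^+ k * g k x ^+ 2] is integrable, hence converges
    almost everywhere. *)
Lemma ae_geometric_bound (g : nat -> T -> R) C : (forall k, bdm (g k)) ->
  (forall k, mean P (fun x => g k x ^+ 2) <= C * 16^-1 ^+ k) ->
  {ae P, forall x, exists K, forall k, `|g k x| <= K * 2^-1 ^+ k}.
Proof.
move=> bg hg.
pose F k x := ((4 ^+ k * g k x ^+ 2)%:E : \bar R).
have bF k : bdm (fun x => 4 ^+ k * g k x ^+ 2) by apply: bdmZ; exact: bdmX.
have F0 k x : (0 <= F k x)%E by rewrite lee_fin mulr_ge0 ?sqr_ge0 ?exprn_ge0.
have mF k : measurable_fun setT (F k) by apply/measurable_EFinP; exact: (bF k).1.
pose f x := (\sum_(k <oo) F k x)%E.
have f0 x : (0 <= f x)%E by apply: nneseries_ge0.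
have C0 : 0 <= C.
  have := hg 0%N; rewrite expr0 mulr1; apply: le_trans.
  rewrite -(mean_cst P 0); apply: mean_le; [exact: bdm_cst|exact: bdmX|].
  by move=> x; exact: sqr_ge0.
have mf : measurable_fun setT f.
  apply: (@emeasurable_fun_cvg _ _ _ _ (fun n x => (\sum_(0 <= k < n) F k x)%E)).
    by move=> n; apply: emeasurable_sum.
  by move=> x _; apply: is_cvg_nneseries => k _ _; exact: F0.
have intf : (\int[P]_x f x < +oo)%E.
  rewrite integral_nneseries//.
  apply: (@le_lt_trans _ _ ((2 * C)%:E)); last exact: ltry.
  apply: lime_le; first by apply: is_cvg_nneseries => k _ _; exact: integral_ge0.
  apply: nearW => n.
  apply: (@le_trans _ _ (\sum_(0 <= k < n) (C * 4^-1 ^+ k)%:E)%E).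
    apply: lee_sum => k _.
    rewrite /F meanE// lee_fin meanZ; last exact: bdmX.
    have -> : C * 4^-1 ^+ k = 4 ^+ k * (C * 16^-1 ^+ k).
      rewrite mulrCA; congr (C * _); rewrite -exprMn; congr (_ ^+ k); lra.
    by rewrite ler_wpM2l// exprn_ge0.
  rewrite sumEFin lee_fin -mulr_sumr [leRHS]mulrC ler_wpM2l//.
  suff : \sum_(0 <= k < n) 4^-1 ^+ k <= 2 * (1 - 4^-1 ^+ n) :> R.
    move/le_trans; apply; have : 0 <= 4^-1 ^+ n :> R by rewrite exprn_ge0// invr_ge0.
    lra.
  elim: n => [|n IH]; first by rewrite big_geq// expr0 subrr mulr0.
  rewrite big_nat_recr//= exprS.
  have : 0 <= 4^-1 ^+ n :> R by rewrite exprn_ge0// invr_ge0.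
  move: IH; lra.
have fi : P.-integrable setT f.
  apply/integrableP; split => //.
  by under eq_integral do rewrite gee0_abs//.
have := integrable_ae measurableT fi.
apply: filterS => x /(_ I) fx.
pose A := fine (f x).
have A0 : 0 <= A by exact: fine_ge0.
have FA k : 4 ^+ k * g k x ^+ 2 <= A.
  rewrite -lee_fin fineK// -/(F k x).
  have := @nneseries_lim_ge R (F ^~ x) xpredT 0 k.+1 (fun n _ _ => F0 n x).
  apply: le_trans; rewrite big_nat_recr//= leeDr//.
  by apply: sume_ge0 => i _; exact: F0.
exists (1 + A) => k.
have k2 : 0 < 2^-1 ^+ k :> R by rewrite exprn_gt0// invr_gt0.
have /eqP e1 : 2 ^+ k * 2^-1 ^+ k == 1 :> R by rewrite -exprMn mulfV ?expr1n.
have k2' : 0 < 2 ^+ k :> R by rewrite exprn_gt0.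
suff h : 2 ^+ k * `|g k x| <= 1 + A.
  have -> : `|g k x| = (2 ^+ k * `|g k x|) * 2^-1 ^+ k by rewrite mulrAC e1 mul1r.
  by rewrite ler_wpM2r// ltW.
rewrite -ler_sqr; last 2 first.
- by rewrite nnegrE mulr_ge0// ltW.
- by rewrite nnegrE addr_ge0.
apply: (@le_trans _ _ A); last by nra.
by rewrite exprMn -exprM mulnC exprM -normrX ger0_norm ?sqr_ge0// -[2 ^+ 2]/(2*2) -natrM FA.
Qed.

(** Averaging along the powers of 16 makes the second moments of the
    increments summable even after multiplication by [4 ^+ k], so that
    pointwise convergence follows without a maximal inequality. *)
Definition avg (h : nat -> T -> R) k x : R :=
  (16 ^+ k)^-1 * \sum_(0 <= i < (16 ^ k)%N) h i x.

Lemma avg01 (h : nat -> T -> R) k x :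
  (forall l, 0 <= h l x <= 1) -> 0 <= avg h k x <= 1.
Proof.
move=> h01; have q0 : 0 < (16 ^+ k : R) by rewrite exprn_gt0.
rewrite /avg ler_pdivlMl// mulr0 ler_pdivrMl// mulr1; apply/andP; split.
  by apply: sumr_ge0 => l _; have /andP[] := h01 l.
rewrite -natrX -[leRHS]mulr1 -sum_nat_cst; apply: ler_sum => l _.
by have /andP[] := h01 l.
Qed.

Section exchangeable.
Variables (h : nat -> T -> R) (a b : R).
Hypothesis bh : forall k, bdm (h k).
Hypothesis ha : forall k l, k != l -> mean P (fun x => h k x * h l x) = a.
Hypothesis hb : forall k, mean P (fun x => h k x * h k x) = b.

Lemma bdm_avg k : bdm (avg h k).
Proof. by apply: bdmZ; exact: bdm_sum. Qed.

Lemma mean_avg_sqr k : mean P (fun x => avg h k x ^+ 2) = a + (b - a) * (16 ^+ k)^-1.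
Proof.
have N0 : (16 ^+ k : R) != 0 by rewrite expf_neq0.
have E : ((16 ^ k)%N)%:R = 16 ^+ k :> R by rewrite natrX.
pose c (i : nat) : R := (16 ^+ k)^-1.
transitivity (mean P (fun x => (\sum_(0 <= i < (16 ^ k)%N) c i * h i x) ^+ 2)).
  by congr mean; apply/funext => x; rewrite /avg mulr_sumr.
rewrite (mean_quadratic (a := a) (b := b))// /c !sum_nat_cst E mulfV// expr1n mulr1.
by congr (_ + _ * _); rewrite expr2 mulrA mulfV// mul1r.
Qed.

(** The increment has weights of sum [0], and squares of weights of sum at
    most [(16 ^+ k)^-1]. *)
Lemma mean_avg_step k : mean P (fun x => (avg h k.+1 x - avg h k x) ^+ 2) <=
  `|b - a| * 16^-1 ^+ k.
Proof.
set q : R := (16 ^+ k)^-1.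
have q0 : 0 < q by rewrite invr_gt0 exprn_gt0.
have E j : ((16 ^ j)%N)%:R = 16 ^+ j :> R by rewrite natrX.
have N0 j : (16 ^+ j : R) != 0 by rewrite expf_neq0.
have le16 : (16 ^ k <= 16 ^ k.+1)%N by rewrite leq_exp2l.
pose c (i : nat) : R := q / 16 - (if (i < 16 ^ k)%N then q else 0).
have sumif (F : nat -> R) : \sum_(0 <= i < (16 ^ k.+1)%N) (if (i < 16 ^ k)%N then F i else 0) =
    \sum_(0 <= i < (16 ^ k)%N) F i.
  by rewrite -big_mkcond /= [RHS](big_nat_widen _ _ _ _ _ le16).
have qk : (16 ^+ k.+1)^-1 = q / 16 by rewrite exprSr invfM mulrC.
have -> : mean P (fun x => (avg h k.+1 x - avg h k x) ^+ 2) =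
    mean P (fun x => (\sum_(0 <= i < (16 ^ k.+1)%N) c i * h i x) ^+ 2).
  congr mean; apply/funext => x; congr (_ ^+ 2).
  rewrite /avg qk -/q mulr_sumr -[in X in _ - X](sumif (h ^~ x)) mulr_sumr -sumrB.
  by apply: eq_bigr => i _; rewrite /c; case: ifP => _; ring.
rewrite (mean_quadratic (a := a) (b := b))//.
have -> : \sum_(0 <= i < (16 ^ k.+1)%N) c i = 0.
  rewrite sumrB sumif !sum_nat_cst !E.
  by rewrite exprSr /q; field.
have -> : \sum_(0 <= i < (16 ^ k.+1)%N) c i ^+ 2 = q - q / 16.
  transitivity (\sum_(0 <= i < (16 ^ k.+1)%N) ((q / 16) ^+ 2 +
     (if (i < 16 ^ k)%N then q ^+ 2 - 2 * q * (q / 16) else 0))).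
    by apply: eq_bigr => i _; rewrite /c; case: ifP => _; ring.
  rewrite big_split /= sumif !sum_nat_cst !E.
  by rewrite exprSr /q; field.
rewrite expr0n /= mulr0 add0r exprVn -/q.
apply: (@le_trans _ _ (`|b - a| * (q - q / 16))).
  by rewrite ler_wpM2r ?ler_norm//; nra.
by rewrite ler_wpM2l//; nra.
Qed.

Lemma ae_cvg_avg : {ae P, forall x, cvgn (avg h ^~ x)}.
Proof.
have := @ae_geometric_bound (fun k x => avg h k.+1 x - avg h k x) `|b - a|.
have bs k : bdm (fun x => avg h k.+1 x - avg h k x) by apply: bdmB; exact: bdm_avg.
move=> /(_ bs mean_avg_step); apply: filterS => x [K hK].
exact: geometric_steps_cvg hK.
Qed.

End exchangeable.

Lemma measurable_limsup_avg (h : nat -> T -> R) :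
  (forall l, measurable_fun setT (h l)) -> (forall l x, 0 <= h l x <= 1) ->
  measurable_fun setT (fun x => limn_sup (avg h ^~ x)).
Proof.
move=> mh h01; apply: (@measurable_fun_limn_sup _ _ _ setT (avg h)) => //.
- by move=> x _; exists 1 => _ [k _ <-]; have /andP[] := avg01 k (h01 ^~ x).
- by move=> x _; exists 0 => _ [k _ <-]; have /andP[] := avg01 k (h01 ^~ x).
- by move=> k; apply: (bdm_avg _ k).1 => l; exact: bdm01.
Qed.

Lemma ae_avg_lim (h : nat -> T -> R) p b :
  (forall k, bdm (h k)) -> (forall k, mean P (h k) = p) ->
  (forall k l, k != l -> mean P (fun x => h k x * h l x) = p * p) ->
  (forall k, mean P (fun x => h k x * h k x) = b) ->
  {ae P, forall x, avg h ^~ x @ \oo --> p}.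
Proof.
move=> bh hp hpp hb.
pose h' k x := h k x - p.
have bh' k : bdm (h' k) by apply: bdmB => //; exact: bdm_cst.
have hh k l : mean P (fun x => h' k x * h' l x) =
    mean P (fun x => h k x * h l x) - p * p.
  transitivity (mean P (fun x => h k x * h l x - (p * (h k x + h l x) - p * p))).
    by congr mean; apply/funext => x; rewrite /h'; ring.
  rewrite !meanB ?meanZ ?meanD ?mean_cst ?hp//=; try exact: bdm_cst.
  - by ring.
  - by apply: bdmD.
  - by apply: bdmZ; exact: bdmD.
  - by apply: bdmM.
  - by apply: bdmB; [apply: bdmZ; exact: bdmD | exact: bdm_cst].
have h'0 k l : k != l -> mean P (fun x => h' k x * h' l x) = 0.
  by move=> kl; rewrite hh hpp// subrr.
have h'b k : mean P (fun x => h' k x * h' k x) = b - p * p by rewrite hh hb.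
have := @ae_geometric_bound (avg h') (b - p * p) (bdm_avg bh').
have hbd k : mean P (fun x => avg h' k x ^+ 2) <= (b - p * p) * 16^-1 ^+ k.
  by rewrite (mean_avg_sqr bh' h'0 h'b) subr0 add0r exprVn.
move=> /(_ hbd); apply: filterS => x [K hK].
apply: (@geometric_bound_cvg _ _ _ K) => k.
rewrite (_ : avg h k x - p = avg h' k x)//.
rewrite /avg /h' sumrB mulrBr sum_nat_cst; congr (_ - _).
by rewrite natrX mulrA mulVf ?mul1r// expf_neq0.
Qed.

Lemma bounded_cvg_mean (f : nat -> T -> R) (c M : R) : (forall k, bdm (f k)) ->
  (forall k x, `|f k x| <= M) -> {ae P, forall x, f ^~ x @ \oo --> c} ->
  (fun k => mean P (f k)) @ \oo --> c.
Proof.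
move=> bf fM fc.
have h1 : {ae P, forall x, setT x -> (fun k => (f k x)%:E) @ \oo --> c%:E}.
  by apply: filterS fc => x fx _; apply: cvg_EFin => //; exact: nearW.
have h2 : P.-integrable setT (fun=> M%:E) by exact: (bdm_integrable P (bdm_cst _ M)).
have h3 : {ae P, forall x k, setT x -> (`|(f k x)%:E| <= M%:E)%E}.
  by apply: aeW => x k _; rewrite lee_fin.
have h0 k : measurable_fun setT (fun x => (f k x)%:E).
  by apply/measurable_EFinP; exact: (bf k).1.
have [_ _] := @dominated_convergence _ _ _ P setT measurableT
  (fun k x => (f k x)%:E) (fun=> c%:E) (fun=> M%:E) h0 (measurable_cst _) h1 h2 h3.
rewrite (integral_cst P measurableT c%:E) [X in (_ * X)%E]prT mule1.
rewrite (_ : [sequence _]_n = (fun k => (mean P (f k))%:E)).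
  by move/fine_cvg.
by apply/funext => k; rewrite /= meanE.
Qed.

(** The second moments of the averages tend to [a] by [mean_avg_sqr], and to
    the square of the mean because the limit of the averages is constant. *)
Lemma exchangeable_uncorrelated (h : nat -> T -> R) (p a b c : R) :
  (forall k, bdm (h k)) -> (forall k x, 0 <= h k x <= 1) ->
  (forall k, mean P (h k) = p) ->
  (forall k l, k != l -> mean P (fun x => h k x * h l x) = a) ->
  (forall k, mean P (fun x => h k x * h k x) = b) ->
  {ae P, forall x, avg h ^~ x @ \oo --> c} -> a = p * p.
Proof.
move=> bh h01 hp ha hb hc.
have N0 k : (16 ^+ k : R) != 0 by rewrite expf_neq0.
have norm01 k x : `|avg h k x| <= 1 by have /andP[? ?] := avg01 k (h01 ^~ x); rewrite ger0_norm.
have c1 := bounded_cvg_mean (bdm_avg bh) norm01 hc.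
have c2 : (fun k => mean P (fun x => avg h k x ^+ 2)) @ \oo --> c ^+ 2.
  apply: (@bounded_cvg_mean (fun k x => avg h k x ^+ 2) _ 1).
  - by move=> k; apply: bdmX; exact: bdm_avg.
  - by move=> k x; rewrite normrX expr_le1.
  - apply: filterS hc => x hx.
    rewrite expr2; under eq_fun do rewrite expr2.
    exact: cvgM.
have pc : p = c.
  apply: (cvg_unique _ _ c1) => //.
  rewrite (_ : (fun k => _) = (fun=> p)); first exact: cvg_cst.
  apply/funext => k; rewrite /avg meanZ; last exact: bdm_sum.
  rewrite mean_sum// (eq_bigr (fun=> p)); last by move=> i _; exact: hp.
  by rewrite sum_nat_cst natrX mulrA mulVf ?mul1r.
have c3 : (fun k => mean P (fun x => avg h k x ^+ 2)) @ \oo --> a.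
  rewrite (_ : (fun k => _) = (fun k => a + geometric (b - a) 16^-1 k)); last first.
    by apply/funext => k; rewrite (mean_avg_sqr bh ha hb) /= exprVn.
  have g0 : geometric (b - a) (16^-1 : R) @ \oo --> (0 : R).
    by apply: cvg_geometric; rewrite ger0_norm; lra.
  by have := cvgD (cvg_cst a) g0; rewrite addr0; apply.
by rewrite (cvg_unique _ c3 c2)// pc expr2.
Qed.

Lemma ae_eq0_mean (f : T -> R) : bdm f -> {ae P, forall x, 0 <= f x} ->
  mean P f = 0 -> {ae P, forall x, f x = 0}.
Proof.
move=> bf f0 m0.
have mf : measurable_fun setT (fun x => (f x)%:E) by apply/measurable_EFinP; exact: bf.1.
have : (\int[P]_x `|(f x)%:E| = 0)%E.
  transitivity (\int[P]_x (f x)%:E)%E; last by rewrite meanE// m0.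
  apply: ae_eq_integral => //; first exact: measurableT_comp.
  by apply: filterS f0 => x fx _ /=; rewrite ger0_norm.
move/(ae_eq_integral_abs P measurableT mf); apply: filterS => x /(_ I) /=.
by case.
Qed.

(** Whether the set where [f] exceeds its mean is null or full, the
    difference of [f] and its mean has a constant sign, and its integral
    vanishes. *)
Lemma ae_eq_mean_01 (f : T -> R) : bdm f ->
  P [set x | mean P f < f x] = 0%E \/ P [set x | mean P f < f x] = 1%E ->
  {ae P, forall x, f x = mean P f}.
Proof.
move=> bf; set c := mean P f; set A := [set x | _].
have mA : measurable A.
  rewrite /A (_ : [set x | _] = f @^-1` `]c, +oo[); first by apply: (preimT bf.1).
  by apply/seteqP; split => x /=; rewrite in_itv/= andbT.
have bfc : bdm (fun x => f x - c) by apply: bdmB => //; exact: bdm_cst.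
have bcf : bdm (fun x => c - f x) by apply: bdmB => //; exact: bdm_cst.
case=> PA.
  have fc : {ae P, forall x, 0 <= c - f x}.
    by apply: filterS (prob0_ae mA PA) => x /negP; rewrite -leNgt subr_ge0.
  have m0 : mean P (fun x => c - f x) = 0.
    by rewrite meanB ?mean_cst ?subrr//; exact: bdm_cst.
  apply: filterS (ae_eq0_mean bcf fc m0) => x /eqP.
  by rewrite subr_eq0 => /eqP.
have fc : {ae P, forall x, c < f x}.
  exists (~` A); split => //; first exact: measurableC.
  by rewrite probability_setC// PA subee.
have fc' : {ae P, forall x, 0 <= f x - c}.
  by apply: filterS fc => x; rewrite subr_ge0 => /ltW.
have m0 : mean P (fun x => f x - c) = 0.
  by rewrite meanB ?mean_cst ?subrr//; exact: bdm_cst.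
by apply: filterS (ae_eq0_mean bfc fc' m0) => x /eqP; rewrite subr_eq0 => /eqP.
Qed.

Lemma ae_eq_of_integrals (f g : T -> R) : bdm f -> bdm g ->
  (forall A, measurable A -> mean P (fun x => f x * \1_A x) = mean P (fun x => g x * \1_A x)) ->
  {ae P, forall x, f x = g x}.
Proof.
move=> bf bg fg.
have : ae_eq P setT (fun x => (f x)%:E) (fun x => (g x)%:E).
  apply: integral_ae_eq => //.
  - exact: bdm_integrable.
  - by apply/measurable_EFinP; exact: bg.1.
  - by move=> A _ mA; rewrite !mean_indicM// fg.
by apply: filterS => x /(_ I) [].
Qed.

End almost_everywhere.

Section trace_law.
Context (R : realType) d (T : measurableType d) d' (T' : measurableType d').
Variables (P : probability T R) (f : T -> T') (mf : measurable_fun setT f).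
Variables (E : set T) (mE : measurable E).

(** The law of [f] on the event [E], whose density is a conditional
    probability. *)
Definition trace_law (A : set T') : \bar R :=
  let _ := mf in let _ := mE in P (E `&` f @^-1` A).

Let trace_law0 : trace_law set0 = 0%E.
Proof. by rewrite /trace_law preimage_set0 setI0 measure0. Qed.
Let trace_law_ge0 A : (0 <= trace_law A)%E. Proof. exact: measure_ge0. Qed.
Let trace_law_sigma : semi_sigma_additive trace_law.
Proof.
move=> F mF tF mUF; rewrite /trace_law preimage_bigcup setI_bigcupr.
apply: measure_semi_sigma_additive.
- by move=> n; apply: measurableI => //; exact: preimT.
- by move=> i j _ _ [x [/= [_ ?] [_ ?]]]; apply: tF => //; exists (f x).
- by rewrite -setI_bigcupr -preimage_bigcup; apply: measurableI => //; exact: preimT.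
Qed.
HB.instance Definition _ :=
  isMeasure.Build _ _ _ trace_law trace_law0 trace_law_ge0 trace_law_sigma.
Let trace_law1 : (trace_law setT <= 1)%E.
Proof. by rewrite /trace_law preimage_setT setIT; exact: probability_le1. Qed.
HB.instance Definition _ := Measure_isSubProbability.Build _ _ _ trace_law trace_law1.

End trace_law.

Section conditional_probability.
Context (R : realType) d (T : measurableType d) d' (T' : measurableType d').
Variables (P : probability T R) (Q : probability T' R) (f : T -> T').
Hypothesis PQ : measure_preserving P Q f.

(** The density is at most [1] almost everywhere because [trace_law] is
    bounded by [Q]; truncation makes this true everywhere. *)
Lemma conditional_probability (E : set T) : measurable E ->
  exists g : T' -> R, [/\ measurable_fun setT g, forall x, 0 <= g x <= 1 &
    forall A, measurable A ->
      P (E `&` f @^-1` A) = (mean Q (fun x => g x * \1_A x))%:E].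
Proof.
move=> mE; have [mf Pf] := PQ.
pose nu := trace_law P mf mE.
have nuQ A : measurable A -> (nu A <= Q A)%E.
  move=> mA; rewrite -Pf//; apply: pr_le; [|exact: preimT|exact: subIsetr].
  by apply: measurableI => //; exact: preimT.
have ac : nu `<< Q.
  apply/null_content_dominatesP => A mA QA; apply/eqP; rewrite eq_le measure_ge0 andbT.
  by rewrite -QA; exact: nuQ.
have [g0 [g00 g0fin g0i g0E]] := radon_nikodym_sigma_finite ac.
have mg0 : measurable_fun setT g0 by exact: measurable_int g0i.
have mgt : measurable [set x | (1 < g0 x)%E].
  rewrite -[X in measurable X]setTI; exact: emeasurable_fun_o_infty.
have Qgt : Q [set x | (1 < g0 x)%E] = 0%E.
  set B := [set x | _]; apply/eqP; rewrite eq_le measure_ge0 andbT leNgt; apply/negP => QB.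
  have ie1 : (\int[Q]_(x in B) (g0 x - 1) = nu B - Q B)%E.
    rewrite integralB//; last 2 first.
    - exact: integrableS g0i.
    - by apply: finite_measure_integrable_cst.
    congr (_ - _)%E; first exact: esym (g0E _ mgt).
    by rewrite (integral_cst Q mgt 1%E) mul1e.
  have B0 : (\int[Q]_(x in B) `|g0 x - 1| = 0)%E.
    apply/eqP; rewrite eq_le integral_ge0// andbT.
    rewrite (@eq_integral _ _ _ Q _ (fun x => g0 x - 1)%E); last first.
      by move=> x; rewrite inE => Bx; rewrite gee0_abs// sube_ge0// ltW.
    by rewrite ie1 sube_le0; exact: nuQ.
  have mg1 : measurable_fun B (fun x => g0 x - 1)%E.
    apply: emeasurable_funB; [exact: measurable_funTS|exact: measurable_cst].
  have /(ae_eq_integral_abs Q mgt mg1) := B0.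
  move=> [N [mN N0 sN]]; have : (Q B <= Q N)%E.
    apply: pr_le => // x Bx; apply: sN => /(_ Bx) /eqP.
    by rewrite sube_eq ?adde0 ?fin_num_adde_defl// add0e => /eqP e; move: Bx; rewrite /B /= e ltxx.
  by rewrite N0 leNgt QB.
pose g x := Order.min (fine (g0 x)) 1.
exists g; split.
- apply: measurable_minr; last exact: measurable_cst.
  exact: (measurableT_comp (fine_measurable measurableT)).
- by move=> x; rewrite /g ge_min lexx orbT andbT le_min ler01 andbT fine_ge0.
move=> A mA; rewrite (_ : P _ = \int[Q]_(x in A) g0 x)%E; last exact: g0E.
have bg : bdm g.
  apply: bdm01.
    apply: measurable_minr; last exact: measurable_cst.
    exact: (measurableT_comp (fine_measurable measurableT)).
  by move=> x; rewrite /g ge_min lexx orbT andbT le_min ler01 andbT fine_ge0.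
rewrite -mean_indicM//; apply: ae_eq_integral => //.
- exact: measurable_funTS.
- by apply/measurable_EFinP; apply: measurable_funTS; exact: bg.1.
- exists [set x | (1 < g0 x)%E]; split => // x /= h; rewrite ltNge; apply/negP => gx1.
  apply: h => _; rewrite /g min_l ?fineK//.
  by rewrite -lee_fin fineK.
Qed.

End conditional_probability.

Section law_of_large_numbers.
Context (R : realType).

(** Distinct coordinates are pairwise independent, which is all that
    [ae_avg_lim] asks for. *)
Lemma law_of_large_numbers d (Y : measurableType d) (nu : probability Y R)
    (Q : probability (power nat Y) R) (g : Y -> R) : is_power_measure nu Q ->
  measurable_fun setT g -> (forall y, 0 <= g y <= 1) ->
  {ae Q, forall y : power nat Y, avg (fun l (y : power nat Y) => g (y l)) ^~ y @ \oo --> mean nu g}.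
Proof.
move=> hQ mg g01; have bg := bdm01 mg g01.
have bgl l : bdm (fun y : power nat Y => g (y l)) by exact: (bdm_comp (measurable_coord l) bg).
apply: (ae_avg_lim (b := mean nu (fun y => g y * g y))) => // k.
- exact: (mean_mp (mp_coord k hQ) bg).
- move=> l kl; have bgg : bdm (fun p : Y * Y => g p.1 * g p.2).
    by apply: bdmM; [exact: bdm_comp measurable_fst bg | exact: bdm_comp measurable_snd bg].
  rewrite [LHS](mean_mp (mp_coord2 hQ kl) bgg) -[LHS]/(mean _ _) mean_fubini; last 2 first.
  - exact: bgg.1.
  - by move=> p; exact: mul01.
  by rewrite -meanZr//; congr mean; apply/funext => y /=; rewrite meanZ.
- exact: (mean_mp (mp_coord k hQ) (bdmM bg bg)).
Qed.

End law_of_large_numbers.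

(** * The canonical factor *)

Section symmetric_difference.
Context (R : realType) d (T : measurableType d) (P : probability T R).
Local Open Scope ereal_scope.

Definition symdiff (A B : set T) := (A `\` B) `|` (B `\` A).

Lemma measurable_symdiff A B : measurable A -> measurable B -> measurable (symdiff A B).
Proof. by move=> mA mB; apply: measurableU; exact: measurableD. Qed.

Lemma symdiff_triangle A B C : measurable A -> measurable B -> measurable C ->
  P (symdiff A C) <= P (symdiff A B) + P (symdiff B C).
Proof.
move=> mA mB mC; have mAB := measurable_symdiff mA mB; have mBC := measurable_symdiff mB mC.
apply: le_trans (prU _ _ _) => //; apply: pr_le.
- exact: measurable_symdiff.
- exact: measurableU.
move=> x; rewrite /symdiff /=; have [Bx|Bx] := pselect (B x); tauto.
Qed.

Lemma symdiff_ae A B : measurable A -> measurable B -> P (symdiff A B) = 0 <->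
  {ae P, forall x, A x <-> B x}.
Proof.
move=> mA mB; split.
  move/(prob0_ae (measurable_symdiff mA mB)); apply: filterS => x.
  rewrite /symdiff /=; have [|] := pselect (A x); have [|] := pselect (B x); tauto.
move=> h; apply: ae_prob0; first exact: measurable_symdiff.
by apply: filterS h => x; rewrite /symdiff /=; tauto.
Qed.

(** The sets that can be approximated form a sigma-algebra. *)
Lemma algebra_approx (F : set (set T)) : F `<=` measurable -> F set0 ->
  (forall A, F A -> F (~` A)) -> (forall A B, F A -> F B -> F (A `|` B)) ->
  forall B, <<s F >> B -> forall e : R, (0 < e)%R ->
  exists2 A, F A & P (symdiff B A) <= e%:E.
Proof.
move=> Fm F0 FC FU.
pose G := [set B | measurable B /\ forall e : R, (0 < e)%R ->
  exists2 A, F A & P (symdiff B A) <= e%:E].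
suff GF : <<s F >> `<=` G by move=> B /GF [].
have GU A B : G A -> G B -> G (A `|` B).
  move=> [mA hA] [mB hB]; split; first exact: measurableU.
  move=> e e0; have e2 : (0 < e / 2)%R by rewrite divr_gt0.
  have [A' FA' PA] := hA _ e2; have [B' FB' PB] := hB _ e2.
  exists (A' `|` B'); first exact: FU.
  have mA' := Fm _ FA'; have mB' := Fm _ FB'.
  apply: (@le_trans _ _ (P (symdiff A A' `|` symdiff B B'))).
    apply: pr_le.
    - by apply: measurable_symdiff; exact: measurableU.
    - by apply: measurableU; exact: measurable_symdiff.
    by move=> x; rewrite /symdiff /=; tauto.
  apply: (le_trans (prU _ _ _)); try exact: measurable_symdiff.
  by rewrite [e]splitr EFinD; exact: leeD.
apply: smallest_sub; last first.
  move=> A FA; split; first exact: Fm.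
  move=> e e0; exists A => //.
  rewrite (_ : symdiff A A = set0) ?measure0 ?lee_fin ?ltW//.
  by apply/seteqP; split => x //; rewrite /symdiff /=; tauto.
split.
- split; first exact: measurable0.
  move=> e e0; exists set0 => //.
  rewrite (_ : symdiff _ _ = set0) ?measure0 ?lee_fin ?ltW//.
  by apply/seteqP; split => x //; rewrite /symdiff /=; tauto.
- move=> A [mA hA]; rewrite setTD; split; first exact: measurableC.
  move=> e e0; have [A' FA' PA] := hA _ e0; exists (~` A'); first exact: FC.
  rewrite (_ : symdiff _ _ = symdiff A A')//.
  rewrite /symdiff !setDE !setCK.
  by apply/seteqP; split => x /=; tauto.
- move=> A GA; pose B n := \big[setU/set0]_(i < n) A i.
  have mA n : measurable (A n) by have [] := GA n.
  have mU : measurable (\bigcup_i A i) by exact: bigcupT_measurable.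
  have mB n : measurable (B n) by exact: bigsetU_measurable.
  have GB n : G (B n).
    elim: n => [|n IH].
      rewrite /B big_ord0; split => // e e0; exists set0 => //.
      rewrite (_ : symdiff _ _ = set0) ?measure0 ?lee_fin ?ltW//.
      by apply/seteqP; split => x //; rewrite /symdiff /=; tauto.
    by rewrite /B big_ord_recr; exact: GU.
  split => // e e0; have e2 : (0 < e / 2)%R by rewrite divr_gt0.
  have BE : \bigcup_n B n = \bigcup_i A i.
    rewrite -[RHS]bigcup_bigsetU_bigcup; apply/seteqP; split => x [n _ Bx].
      by exists n => //=; rewrite big_ord_recr /=; left.
    by exists n.+1.
  have cB : P \o B @ \oo --> P (\bigcup_i A i).
    rewrite -BE; apply: nondecreasing_cvg_mu => //; first by rewrite BE.
    apply/nondecreasing_seqP => n; apply/subsetPset.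
    by rewrite /B big_ord_recr; exact: subsetUl.
  have [n hn] : exists n, P (\bigcup_i A i) - (e / 2)%:E <= P (B n).
    apply: contrapT => /forallNP h.
    have : P (\bigcup_i A i) <= P (\bigcup_i A i) - (e / 2)%:E.
      rewrite -[leLHS](cvg_lim _ cB)//; apply: lime_le.
        by apply/cvg_ex; eexists; exact: cB.
      by apply: nearW => n; apply: ltW; rewrite ltNge; apply/negP; exact: h.
    by rewrite leNgt lteBlDr ?pr_fin// lteDl ?pr_fin// lte_fin e2.
  have [A' FA' PA] := (GB n).2 _ e2; exists A' => //.
  apply: (le_trans (symdiff_triangle mU (mB n) (Fm _ FA'))).
  rewrite [e in leRHS]splitr EFinD; apply: leeD => //.
  have BU : B n `<=` \bigcup_i A i by rewrite -BE; exact: bigcup_sup.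
  rewrite (_ : symdiff _ _ = (\bigcup_i A i) `\` B n); last first.
    rewrite /symdiff (_ : B n `\` _ = set0) ?setU0//.
    by apply/seteqP; split => // x [/BU].
  rewrite measureD//; last by rewrite ltey_eq fin_num_measure.
  rewrite setIidr//.
  by move: hn; rewrite !leeBlDr ?pr_fin// addeC.
Qed.

(** By the Borel-Cantelli lemma, almost every point lies in finitely many of
    the symmetric differences. *)
Lemma ae_lim_sup_set (K : set T) (G : nat -> set T) :
  measurable K -> (forall n, measurable (G n)) ->
  (forall n, P (symdiff K (G n)) <= (2^-1 ^+ n)%:E) ->
  {ae P, forall x, K x <-> lim_sup_set G x}.
Proof.
move=> mK mG hG; pose F n := symdiff K (G n).
have mF n : measurable (F n) by exact: measurable_symdiff.
have F0 : P (lim_sup_set F) = 0.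
  apply: lim_sup_set_cvg0 => //.
  apply: (@le_lt_trans _ _ 2%:E); last exact: ltry.
  apply: lime_le; first by apply: is_cvg_nneseries => k _ _; exact: measure_ge0.
  apply: nearW => n; apply: (@le_trans _ _ (\sum_(0 <= k < n) (2^-1 ^+ k)%:E)).
    by apply: lee_sum => k _; exact: hG.
  rewrite sumEFin lee_fin.
  suff : (\sum_(0 <= k < n) 2^-1 ^+ k <= 2 * (1 - 2^-1 ^+ n) :> R)%R.
    move/le_trans; apply; have : (0 <= 2^-1 ^+ n :> R)%R by rewrite exprn_ge0// invr_ge0.
    lra.
  elim: n => [|n IH]; first by rewrite big_geq// expr0 subrr mulr0.
  by rewrite big_nat_recr//= exprS; move: IH; lra.
have mlF : measurable (lim_sup_set F).
  by apply: bigcapT_measurable => k; apply: bigcup_measurable => j _.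
apply: filterS (prob0_ae mlF F0) => x; rewrite /lim_sup_set => nF.
have [n hn] : exists n, forall j, (n <= j)%N -> (K x <-> G j x).
  apply: contrapT => /forallNP h; apply: nF => n _.
  have /existsNP[j /not_implyP[nj hj]] := h n; exists j => //.
  rewrite /F /symdiff /=; apply: contrapT => h'; apply: hj.
  have [|] := pselect (K x); have [|] := pselect (G j x); tauto.
split.
  move=> Kx m _; exists (maxn m n); first by rewrite /= leq_maxl.
  by apply/hn; rewrite ?leq_maxr.
by move=> /(_ n I) [j /= nj Gj]; apply/(hn _ nj).
Qed.

End symmetric_difference.

Section votes.
Context (R : realType) d (X : measurableType d) d' (Y : measurableType d')
  dZ (Z : measurableType dZ).
Variables (nu : probability Y R) (f : X * Y -> Z).

(** Majority votes extract countably much information from the section [f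
    (x, .)], in a way that is measurable in [x] and insensitive to null sets
    of [y]. *)
Definition votes (C : nat -> set Y) (B : nat -> set Z) : X -> bitseqs :=
  bits (fun i => [set x | (nu (C i) < 2%:E * nu [set y | C i y /\ B i (f (x, y))])%E]).

Hypothesis mf : measurable_fun setT f.

Lemma measurable_vote (C : set Y) (B : set Z) : measurable C -> measurable B ->
  measurable [set x | (nu C < 2%:E * nu [set y | C y /\ B (f (x, y))])%E].
Proof.
move=> mC mB.
have mK : measurable [set p : X * Y | C p.2 /\ B (f p)].
  apply: (@measurableI _ _ (snd @^-1` C) (f @^-1` B)); last exact: preimT.
  by apply: preimT => //; exact: measurable_snd.
have mg : measurable_fun setT (fun x => 2%:E * nu [set y | C y /\ B (f (x, y))])%E.
  apply: (@emeasurable_funM _ _ _ _ (fun=> 2%:E)); first exact: measurable_cst.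
  exact: (measurable_section_measure nu mK).
by rewrite -[X in measurable X]setTI; exact: (emeasurable_fun_o_infty measurableT mg).
Qed.

Lemma measurable_votes (C : nat -> set Y) (B : nat -> set Z) :
  (forall i, measurable (C i)) -> (forall i, measurable (B i)) ->
  measurable_fun setT (votes C B).
Proof. by move=> mC mB; apply: measurable_bits => i; exact: measurable_vote. Qed.

End votes.

Section majority.
Context (R : realType) d (Y : measurableType d) (nu : probability Y R).
Variable c : Y -> bitseqs.
Hypothesis mc : measurable_fun setT c.

Definition prefix n y : seq bool := mkseq (c y) n.
(** The cells of prefixes of length [n] form a finite partition, and these
    partitions refine each other as [n] grows. *)
Definition cell (s : seq bool) : set Y := [set y | prefix (size s) y = s].

Lemma size_prefix n y : size (prefix n y) = n. Proof. by rewrite size_mkseq. Qed.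

Lemma cell_prefix n y : cell (prefix n y) y.
Proof. by rewrite /cell /= size_prefix. Qed.

Lemma prefix_le m n y y' : (m <= n)%N -> prefix n y = prefix n y' -> prefix m y = prefix m y'.
Proof.
move=> mn e; apply: (@eq_from_nth _ false); first by rewrite !size_prefix.
move=> i; rewrite size_prefix => im; rewrite !nth_mkseq//.
have in_ : (i < n)%N by exact: leq_trans mn.
by have := congr1 (fun s => nth false s i) e; rewrite /prefix !nth_mkseq.
Qed.

Lemma measurable_cell s : measurable (cell s).
Proof.
rewrite (_ : cell s = \bigcap_(i in [set i | (i < size s)%N])
    [set y | c y i = nth false s i]); last first.
  apply/seteqP; split => y.
    by move=> /= e i /= il; rewrite -[in RHS]e /prefix nth_mkseq.
  move=> h; apply: (@eq_from_nth _ false); first by rewrite size_prefix.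
  by move=> i; rewrite size_prefix => il; rewrite nth_mkseq//; exact: h.
apply: bigcap_measurableType => i _.
have mi : measurable_fun setT (fun b : bitseqs => b i) by exact: measurable_coord.
by apply: (preimT (measurableT_comp mi mc) (_ : measurable [set nth false s i])).
Qed.

Definition majority n (V : set Y) : set Y :=
  [set y | (nu (cell (prefix n y)) < 2%:E * nu [set z | cell (prefix n y) z /\ V z])%E].

(** On each cell the choice is between the whole cell and nothing, at the
    cost of the part of the cell outside [V], resp. inside [V]; the majority
    picks the cheaper. *)
Lemma majority_best n (V U : set Y) : measurable V -> measurable U ->
  (forall y y', prefix n y = prefix n y' -> U y -> U y') ->
  measurable (majority n V) ->
  (nu (symdiff V (majority n V)) <= nu (symdiff V U))%E.
Proof.
move=> mV mU lU mM.
pose D (i : nat) : set Y := [set y | pickle (prefix n y) = i].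
have DE y : D (pickle (prefix n y)) = cell (prefix n y).
  apply/seteqP; split => z; rewrite /D /cell /= size_prefix.
    by move/(pcan_inj pickleK).
  by move=> ->.
have mD i : measurable (D i).
  have [[y Dy]|nD] := pselect (exists y, D i y).
    by rewrite -Dy DE; exact: measurable_cell.
  rewrite (_ : D i = set0)//; apply/seteqP; split => // y Dy; apply: nD; by exists y.
have tD : trivIset setT D by move=> i j _ _ [y [<- <-]].
have sumD A : measurable A -> nu A = (\sum_(i <oo) nu (A `&` D i))%E.
  move=> mA; transitivity (nu (\bigcup_i (A `&` D i))).
    congr (nu _); rewrite -setI_bigcupr (_ : \bigcup_i D i = setT) ?setIT//.
    by apply/seteqP; split => // y _; exists (pickle (prefix n y)).
  rewrite [LHS]measure_bigcup//=.
  - by apply: eq_eseriesl => i; rewrite in_setT.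
  - by move=> i _; exact: measurableI.
  - exact: trivIset_setIl.
have mVM : measurable (symdiff V (majority n V)) by exact: measurable_symdiff.
have mVU : measurable (symdiff V U) by exact: measurable_symdiff.
rewrite (sumD _ mVM) (sumD _ mVU); apply: lee_nneseries => // i _.
have [[y Dy]|nD] := pselect (exists y, D i y); last first.
  rewrite (_ : D i = set0); first by rewrite !setI0.
  by apply/seteqP; split => // y Dy; apply: nD; exists y.
have DiE : D i = cell (prefix n y) by rewrite -Dy DE.
have pD z : D i z -> prefix n z = prefix n y.
  by rewrite DiE /cell /= size_prefix.
set a := nu (D i `&` V); set b := nu (D i `\` V).
have ab : nu (D i) = (a + b)%E.
  rewrite /a /b -measureU//.
  - by rewrite setUIDK.
  - exact: measurableI.
  - exact: measurableD.
  - by apply/seteqP; split => // z [[_ ?] []].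
have afin : a \is a fin_num by apply: pr_fin; exact: measurableI.
have bfin : b \is a fin_num by apply: pr_fin; exact: measurableD.
have majD z : D i z -> majority n V z <-> (b < a)%E.
  move=> Dz; rewrite /majority /= (pD _ Dz) -DiE.
  rewrite (_ : [set w | _] = D i `&` V)// -/a ab.
  by rewrite -(fineK afin) -(fineK bfin) -EFinD -EFinM !lte_fin; split; lra.
have UD : (D i `<=` U) \/ (D i `&` U = set0).
  have [Uy|Uy] := pselect (U y); [left|right].
    by move=> z /pD e; exact: (lU y).
  by apply/seteqP; split => // z [/pD e /(lU _ _ e)].
have eqV A : D i `&` A = set0 -> symdiff V A `&` D i = D i `&` V.
  move=> A0; apply/seteqP; split => z.
    move=> [[[]//|[Az _]] Dz]; have : (D i `&` A) z by [].
    by rewrite A0.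
  move=> [Dz Vz]; split => //; left; split => // Az; have : (D i `&` A) z by [].
  by rewrite A0.
have eqD A : D i `<=` A -> symdiff V A `&` D i = D i `\` V.
  move=> DA; apply/seteqP; split => z.
    by move=> [[[Vz nA]|[Az nV]] Dz]; split => //; have := DA _ Dz.
  by move=> [Dz nV]; split => //; right; split => //; exact: DA.
case: (ltP b a) => ba.
  have -> : symdiff V (majority n V) `&` D i = D i `\` V.
    by apply: eqD => z Dz; apply/majD.
  case: UD => [/eqD ->//|/eqV ->]; exact: ltW.
have -> : symdiff V (majority n V) `&` D i = D i `&` V.
  apply: eqV; apply/seteqP; split => // z [Dz /(majD _ Dz)].
  by rewrite ltNge ba.
by case: UD => [/eqD ->//|/eqV ->].
Qed.

End majority.

Section half_factor.
Context (R : realType) d (X : measurableType d) d' (Y : measurableType d')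
  dZ (Z : measurableType dZ).
Variables (mu : probability X R) (nu : probability Y R) (f : X * Y -> Z).
Hypothesis mf : measurable_fun setT f.

Section level_approximation.
Variables (c : Y -> bitseqs) (r : bitseqs -> Y).
Hypotheses (mc : measurable_fun setT c) (mr : measurable_fun setT r) (cr : cancel c r).

(** The sets whose sections in [Y] are unions of cells of level [n]. *)
Definition level_set n (U : set (X * Y)) := measurable U /\
  forall x y y', prefix c n y = prefix c n y' -> U (x, y) -> U (x, y').

Let F := [set U | exists n, level_set n U].

Lemma level_set_le m n U : (m <= n)%N -> level_set m U -> level_set n U.
Proof. by move=> mn [mU lU]; split => // x y y' /(prefix_le mn); exact: lU. Qed.

Lemma level_sets_generate : measurable `<=` <<s F >>.
Proof.
have mF : measurable_fun setT
    ((fun p : X * Y => c p.2) : g_sigma_algebraType F -> bitseqs).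
  apply: measurable_fun_power => i _ A mA; rewrite setTI.
  apply: sub_sigma_algebra; exists i.+1; split.
    have mi : measurable_fun setT (fun b : bitseqs => b i) by exact: measurable_coord.
    exact: (preimT (measurableT_comp (measurableT_comp mi mc) measurable_snd) mA).
  move=> x y y' e; rewrite /preimage /=.
  have := congr1 (fun s => nth false s i) e.
  by rewrite /prefix !nth_mkseq// => ->.
rewrite measurable_prod_measurableType; apply: smallest_sub.
  exact: smallest_sigma_algebra.
move=> _ [A mA [B mB <-]].
have -> : A `*` B = (A `*` setT) `&` ((fun p : X * Y => c p.2) @^-1` (r @^-1` B)).
  apply/seteqP; split => -[x y] /=; first by move=> [? ?]; rewrite /preimage /= cr.
  by rewrite /preimage /= cr => -[[]].
suff : (@measurable _ (g_sigma_algebraType F)) ((A `*` setT) `&`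
  ((fun p : X * Y => c p.2) @^-1` (r @^-1` B))) by [].
apply: measurableI; last by apply: (preimT mF); exact: preimT.
apply: sub_sigma_algebra; exists 0%N; split; first exact: measurableX.
by move=> x y y' _ [].
Qed.

Lemma level_approx K : measurable K -> forall e : R, 0 < e ->
  exists n U, level_set n U /\ ((mu \x nu) (symdiff K U) <= e%:E)%E.
Proof.
move=> mK e e0.
have FC A : F A -> F (~` A).
  move=> [n [mA lA]]; exists n; split; first exact: measurableC.
  by move=> x y y' yy' nA Ay'; apply: nA; exact: (lA _ y').
have FU A B : F A -> F B -> F (A `|` B).
  move=> [n lA] [m lB]; exists (maxn n m).
  have [mA lA'] := level_set_le (leq_maxl n m) lA.
  have [mB lB'] := level_set_le (leq_maxr n m) lB.
  split; first exact: measurableU.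
  by move=> x y y' yy' [/(lA' _ _ _ yy')|/(lB' _ _ _ yy')]; [left|right].
have Fm : F `<=` measurable by move=> U [n []].
have F0 : F set0 by exists 0%N; split.
have [A [n lA] PA] := @algebra_approx _ _ _ (mu \x nu)%E _ Fm F0 FC FU _ (level_sets_generate mK) _ e0.
by exists n, A.
Qed.

Variable K : set (X * Y).
Hypothesis mK : measurable K.

Definition majority_set n : set (X * Y) :=
  [set p | majority nu c n [set y | K (p.1, y)] p.2].

Lemma measurable_majority_set n : measurable (majority_set n).
Proof.
pose V s : set X := [set x | (nu (cell c s) < 2%:E * nu [set y | cell c s y /\ K (x, y)])%E].
have mV s : measurable (V s).
  have mcell := measurable_cell mc s.
  have mK' : measurable [set p : X * Y | cell c s p.2 /\ K p].
    by apply: (@measurableI _ _ (snd @^-1` cell c s) K) => //; apply: preimT.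
  have mg : measurable_fun setT (fun x => 2%:E * nu [set y | cell c s y /\ K (x, y)])%E.
    apply: (@emeasurable_funM _ _ _ _ (fun=> 2%:E)); first exact: measurable_cst.
    exact: (measurable_section_measure nu mK').
  by rewrite -[X in measurable X]setTI; exact: (emeasurable_fun_o_infty measurableT mg).
rewrite (_ : majority_set n = \bigcup_i (if unpickle i is Some s
    then (if size s == n then V s `*` cell c s else set0) else set0)); last first.
  apply/seteqP; split => -[x y].
    move=> h; exists (pickle (prefix c n y)) => //.
    rewrite pickleK size_prefix eqxx; split => //=; exact: cell_prefix.
  move=> [i _]; case: unpickle => // s; case: eqP => // sn [/= Vx].
  by rewrite /cell /= sn /majority_set /majority /= => ->.
have mP s : measurable (if size s == n then V s `*` cell c s else set0).
  by case: eqP => // _; apply: measurableX => //; exact: measurable_cell.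
by apply: bigcupT_measurable => i; case: (@unpickle (seq bool) i) => [s|//]; exact: mP.
Qed.

Lemma majority_set_best n U : level_set n U ->
  ((mu \x nu) (symdiff K (majority_set n)) <= (mu \x nu) (symdiff K U))%E.
Proof.
move=> [mU lU]; have mM := measurable_majority_set n.
have m1 := measurable_symdiff mK mM; have m2 := measurable_symdiff mK mU.
rewrite !prod_fubini//; apply: ge0_le_integral => //.
- exact: (measurable_section_measure nu m1).
- exact: (measurable_section_measure nu m2).
move=> x _; apply: (@majority_best _ _ _ nu _ mc n [set y | K (x, y)] [set y | U (x, y)]).
- exact: measurable_section.
- exact: measurable_section.
- by move=> y y'; exact: lU.
- exact: (measurable_section x mM).
Qed.

Lemma majority_set_approx (j : nat) :
  exists n, ((mu \x nu) (symdiff K (majority_set n)) <= (2^-1 ^+ j)%:E)%E.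
Proof.
have j0 : 0 < 2^-1 ^+ j :> R by rewrite exprn_gt0// invr_gt0.
have [n [U [lU hU]]] := level_approx mK j0.
by exists n; apply: le_trans hU; exact: majority_set_best.
Qed.

End level_approximation.

Hypotheses (cY : coded Y) (cZ : coded Z).

(** The sets [f @^-1` BZ m] determine [f]. Each is almost everywhere an
    upper limit of majority sets, by [majority_set_approx], and whether [(x,
    y)] belongs to a majority set is told by the votes at [x] and the cell
    of [y]. *)
Lemma half_factor : exists (C : nat -> set Y) (B : nat -> set Z) (f1 : bitseqs * Y -> Z),
  [/\ forall i, measurable (C i), forall i, measurable (B i), measurable_fun setT f1 &
      {ae (mu \x nu)%E, forall p, f1 (votes nu f C B p.1, p.2) = f p}].
Proof.
have [c [r [mc mr cr]]] := cY; have [cz [rz [mcz mrz czr]]] := cZ.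
pose BZ m : set Z := [set z | cz z m].
have mBZ m : measurable (BZ m) by exact: (preimT mcz (measurable_bit m)).
pose K m : set (X * Y) := f @^-1` (BZ m).
have mK m : measurable (K m) by exact: preimT.
have /choice[N hN] : forall mj : nat * nat, exists n, ((mu \x nu)
    (symdiff (K mj.1) (majority_set c (K mj.1) n)) <= (2^-1 ^+ mj.2)%:E)%E.
  by move=> [m j]; exact: (majority_set_approx mc mr cr (mK m)).
pose C i : set Y := if @unpickle (seq bool * nat)%type i is Some sm then cell c sm.1 else set0.
pose B i : set Z := if @unpickle (seq bool * nat)%type i is Some sm then BZ sm.2 else set0.
have mC i : measurable (C i) by rewrite /C; case: unpickle => // -[s m]; exact: measurable_cell.
have mB i : measurable (B i) by rewrite /B; case: unpickle => // -[s m].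
pose G (m n : nat) : set (bitseqs * Y) := [set p : bitseqs * Y | p.1 (pickle (prefix c n p.2, m))].
have mG m n : measurable (G m n).
  rewrite (_ : G m n = \bigcup_i (if unpickle i is Some s then
      (if size s == n then [set b : bitseqs | b (pickle (s, m))] `*` cell c s else set0)
      else set0)); last first.
    apply/seteqP; split => -[b y].
      move=> h; exists (pickle (prefix c n y)) => //.
      by rewrite pickleK size_prefix eqxx; split => //=; exact: cell_prefix.
    move=> [i _]; case: unpickle => // s; case: eqP => // sn [/= bs].
    by rewrite /cell /= sn /G /= => ->.
  have mP s : measurable (if size s == n then
      [set b : bitseqs | b (pickle (s, m))] `*` cell c s else set0).
    case: eqP => // _; apply: measurableX; [exact: measurable_bit | exact: measurable_cell].
  by apply: bigcupT_measurable => i; case: (@unpickle (seq bool) i) => [s|//]; exact: mP.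
pose E m := lim_sup_set (fun j => G m (N (m, j))).
have mE m : measurable (E m).
  apply: bigcapT_measurable => k; apply: bigcup_measurable => j _; exact: mG.
exists C, B, (rz \o bits E); split => //.
  by apply: measurableT_comp => //; exact: measurable_bits.
have GE m n p : G m n (votes nu f C B p.1, p.2) <-> majority_set c (K m) n p.
  rewrite /G /= /votes /bits /C /B pickleK /=; split => [/asboolP //|h]; exact/asboolP.
have /ae_foralln : forall m, {ae (mu \x nu)%E, forall p, K m p <->
    lim_sup_set (fun j => majority_set c (K m) (N (m, j))) p}.
  move=> m; apply: (@ae_lim_sup_set _ _ _ (mu \x nu)%E) => //.
    by move=> j; exact: measurable_majority_set.
  by move=> j; exact: (hN (m, j)).
apply: filterS => p hp; rewrite -[RHS]czr /=; congr rz.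
apply/funext => m; rewrite /bits.
apply/asboolP/idP => [h|h].
  by apply/(hp m) => k _; have [j kj Gj] := h k I; exists j => //; exact/GE.
by move=> k _; have [j kj Mj] := (hp m).1 h k I; exists j => //; exact/GE.
Qed.

End half_factor.

Definition transpose (T U V : Type) (h : T * U -> V) : U * T -> V := fun p => h (p.2, p.1).

Lemma measurable_transpose d (X : measurableType d) d' (Y : measurableType d')
    dZ (Z : measurableType dZ) (f : X * Y -> Z) :
  measurable_fun setT f -> measurable_fun setT (transpose f).
Proof.
move=> mf; apply: (measurableT_comp mf).
by apply: measurable_fun_pair; [exact: measurable_snd | exact: measurable_fst].
Qed.

Section canonical_factor.
Context (R : realType) d (X : measurableType d) d' (Y : measurableType d')
  dZ (Z : measurableType dZ).
Variables (mu : probability X R) (nu : probability Y R) (f : X * Y -> Z).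
Hypothesis mf : measurable_fun setT f.
Hypotheses (cY : coded Y) (cZ : coded Z).

(** [half_factor] is applied to [f], giving [S] and [f1] with [f (x, y) = f1
    (S x, y)], then to the transpose of [f1]. The votes of the second step
    are taken over sets [A' i] of codes; pulling these back by [S] turns
    them into votes for [f]. *)
Lemma canonical_factor :
  exists (C : nat -> set Y) (A : nat -> set X) (B B' : nat -> set Z) (f2 : bitseqs * bitseqs -> Z),
  [/\ forall i, measurable (C i), forall i, measurable (A i),
      (forall i, measurable (B i)) /\ (forall i, measurable (B' i)), measurable_fun setT f2 &
      {ae (mu \x nu)%E, forall p,
        f2 (votes nu f C B p.1, votes mu (transpose f) A B' p.2) = f p}].
Proof.
have [C [B [f1 [mC mB mf1 hf1]]]] := half_factor mu nu mf cY cZ.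
set S := votes nu f C B in hf1.
have mS : measurable_fun setT S by exact: measurable_votes.
pose mu' := law mu mS.
have mg := measurable_transpose mf1.
have [A' [B' [f2 [mA' mB' mf2 hf2]]]] := half_factor nu mu' mg coded_bitseqs cZ.
pose A i := S @^-1` A' i.
have mA i : measurable (A i) by exact: preimT.
exists C, A, B, B', (transpose f2); split => //.
  exact: measurable_transpose.
have hT : {ae nu, forall y, votes mu' (transpose f1) A' B' y = votes mu (transpose f) A B' y}.
  have : {ae (nu \x mu)%E, forall p, f1 (S p.2, p.1) = f (p.2, p.1)}.
    have := mp_ae (mp_swap nu mu) hf1; exact.
  move/ae_prodE; apply: filterS => y hy; apply/funext => i; rewrite /votes /bits /=.
  congr (`[< (_ < _ * _)%E >]).
  rewrite -[LHS]/(mu [set x | A i x /\ B' i (f1 (S x, y))]).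
  have mI (h : X -> Z) : measurable_fun setT h -> measurable [set x | A i x /\ B' i (h x)].
    by move=> mh; apply: measurableI => //; exact: (preimT mh).
  apply: prob_ae_eq.
  - apply: (mI (fun x => f1 (S x, y))).
    exact: (measurableT_comp mf1 (measurable_fun_pair mS (measurable_cst _))).
  - apply: (mI (fun x => f (x, y))).
    exact: (measurableT_comp mf (measurable_fun_pair (@measurable_id _ _ _) (measurable_cst _))).
  - by apply: filterS hy => x e /=; rewrite e.
have m1 : measure_preserving (mu \x nu)%E (nu \x mu')%E (fun p => (p.2, S p.1)).
  by have := mp_comp (mp_prod (mp_law mu mS) (mp_id nu)) (mp_swap mu' nu); exact.
have h1 := mp_ae m1 hf2.
have h2 := mp_ae (mp_snd mu nu) hT.
apply: filterS3 h1 h2 hf1 => p /= e1 e2 e3.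
by rewrite /transpose /= -e2 e1 /transpose /= e3.
Qed.

End canonical_factor.

(** * Finite permutations of the rows and columns *)

Section finperm_group.

Lemma finperm_inv_finite (p : finperm) : exists n, forall i, (n <= i)%N -> fperm_inv p i = i.
Proof. by have [n hn] := fperm_finite p; exists n => i /hn e; rewrite -{1}e fpermK. Qed.

Definition finperm_one : finperm.
Proof. by exists id id => //; exists 0%N. Defined.

Definition finperm_inverse (p : finperm) : finperm.
Proof.
exists (fperm_inv p) p; [exact: fperm_invK | exact: fpermK | exact: finperm_inv_finite].
Defined.

Definition finperm_mul (p q : finperm) : finperm.
Proof.
exists (p \o q) (fperm_inv q \o fperm_inv p).
- by move=> i /=; rewrite !fpermK.
- by move=> i /=; rewrite !fperm_invK.
- have [n hn] := fperm_finite p; have [m hm] := fperm_finite q.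
  by exists (maxn n m) => i; rewrite geq_max => /andP[ni mi] /=; rewrite hm// hn.
Defined.

Definition swap_nat (i j k : nat) : nat := if k == i then j else if k == j then i else k.

Lemma swap_natK i j : involutive (swap_nat i j).
Proof. by move=> k; rewrite /swap_nat; do ![case: eqP => //=]; move=> *; subst; congruence. Qed.

Definition finperm_swap (i j : nat) : finperm.
Proof.
exists (swap_nat i j) (swap_nat i j); [exact: swap_natK | exact: swap_natK |].
exists (maxn i j).+1 => k; rewrite gtn_max => /andP[ik jk].
by rewrite /swap_nat !gtn_eqF.
Defined.

Definition perm2 := (finperm * finperm)%type.
Definition perm2_one : perm2 := (finperm_one, finperm_one).
Definition perm2_mul (g h : perm2) : perm2 := (finperm_mul g.1 h.1, finperm_mul g.2 h.2).
Definition perm2_inv (g : perm2) : perm2 := (finperm_inverse g.1, finperm_inverse g.2).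

Definition on_rows (p : finperm) : perm2 := (p, finperm_one).
Definition on_cols (p : finperm) : perm2 := (finperm_one, p).

Definition perm_subgroup (G : set perm2) :=
  [/\ G perm2_one, forall g h, G g -> G h -> G (perm2_mul g h) & forall g, G g -> G (perm2_inv g)].

Lemma row_subgroup : perm_subgroup row_perms.
Proof.
split => // [g h hg hh i|g hg i] /=; first by rewrite hh hg.
by rewrite -{1}[i]hg fpermK.
Qed.

Lemma col_subgroup : perm_subgroup col_perms.
Proof.
split => // [g h hg hh i|g hg i] /=; first by rewrite hh hg.
by rewrite -{1}[i]hg fpermK.
Qed.

Lemma full_subgroup : perm_subgroup setT.
Proof. by []. Qed.

End finperm_group.

Section action.
Context (R : realType) dZ (Z : measurableType dZ).
Implicit Types (g h : perm2) (r : matrices Z).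

Lemma measurable_act g : measurable_fun setT (@act _ Z g).
Proof. exact: measurable_precomp. Qed.

Lemma act_mul g h r : act (perm2_mul g h) r = act g (act h r).
Proof. by []. Qed.

Lemma act_one r : act perm2_one r = r.
Proof. by apply/funext => -[]. Qed.

Lemma act_invK g r : act (perm2_inv g) (act g r) = r.
Proof. by apply/funext => -[i j]; rewrite /act /= !fpermK. Qed.

Lemma act_split g r : act g r = act (on_rows g.1) (act (on_cols g.2) r).
Proof. by []. Qed.

Lemma act_col g r : col_perms g -> act g r = act (on_cols g.2) r.
Proof.
by move=> hg; apply/funext => -[i j]; rewrite /act /= -[in fperm_inv g.1 i](hg i) fpermK.
Qed.

Lemma act_row g r : row_perms g -> act g r = act (on_rows g.1) r.
Proof.
by move=> hg; apply/funext => -[i j]; rewrite /act /= -[in fperm_inv g.2 j](hg j) fpermK.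
Qed.

Lemma act_row_col g p r : row_perms g ->
  act g (act (on_cols p) r) = act (on_cols p) (act g r).
Proof. by move=> hg; rewrite (act_row r hg) (act_row (act _ r) hg). Qed.

(** A permutation is coded by the list of its first values, the default
    value of [nth] being that of the identity; thus [S_N x S_N] acts through
    countably many maps. *)
Definition act_code (k : nat) (r : matrices Z) : matrices Z :=
  if @unpickle (seq nat * seq nat)%type k is Some st
  then fun ij => r (nth ij.1 st.1 ij.1, nth ij.2 st.2 ij.2) else r.

Lemma act_codeP g : exists k, @act _ Z g = act_code k.
Proof.
have code (p : finperm) : exists s, forall i, fperm_inv p i = nth i s i.
  have [n hn] := finperm_inv_finite p; exists (mkseq (fperm_inv p) n) => i.
  case: (ltnP i n) => ni; first by rewrite nth_mkseq.
  by rewrite nth_default ?size_mkseq// hn.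
have [s hs] := code g.1; have [t ht] := code g.2.
exists (pickle (s, t)); apply/funext => r; apply/funext => -[i j].
by rewrite /act_code pickleK /act /= hs ht.
Qed.

(** Countably many null sets suffice, by [act_codeP]. *)
Lemma ae_forall_perm (D : probability (matrices Z) R) (G : set perm2)
    (H : (matrices Z -> matrices Z) -> matrices Z -> Prop) :
  (forall g, G g -> {ae D, forall r, H (act g) r}) ->
  {ae D, forall r, forall g, G g -> H (act g) r}.
Proof.
move=> hH.
have : {ae D, forall r, forall k g, G g -> act g = act_code k -> H (act g) r}.
  apply/ae_foralln => k.
  have [[g [Gg gk]]|nG] := pselect (exists g, G g /\ @act _ Z g = act_code k).
    by apply: filterS (hH g Gg) => r Hr h Gh hk; rewrite hk -gk.
  by apply: aeW => r g Gg gk; exfalso; apply: nG; exists g.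
by apply: filterS => r h g Gg; have [k gk] := act_codeP g; exact: (h k).
Qed.

Lemma measurable_bigcap_perm (G : set perm2) (B : set (matrices Z)) :
  measurable B -> measurable (\bigcap_(g in G) (act g @^-1` B)).
Proof.
move=> mB.
rewrite (_ : \bigcap_(g in G) _ = \bigcap_k
   [set r | forall g, G g -> act g = act_code k -> B (act g r)]); last first.
  apply/seteqP; split => r h; first by move=> k _ g Gg _; exact: h.
  by move=> g Gg; have [k gk] := act_codeP g; exact: (h k I).
apply: bigcapT_measurable => k.
have [[g [Gg gk]]|nG] := pselect (exists g, G g /\ @act _ Z g = act_code k).
  rewrite (_ : [set r | _] = act g @^-1` B); first exact: (preimT (@measurable_act g)).
  apply/seteqP; split => r; first by apply.
  by move=> Br h Gh hk; rewrite hk -gk.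
rewrite (_ : [set r | _] = setT)//; apply/seteqP; split => // r _ g Gg gk.
by exfalso; apply: nG; exists g.
Qed.

Variable D : probability (matrices Z) R.
Hypothesis hinv : invariant_measure D.

Lemma mp_act g : measure_preserving D D (act g).
Proof. by split; [exact: measurable_act | move=> A mA; exact: hinv]. Qed.

(** Intersecting the translates of an almost invariant set makes it invariant,
    since only countably many of them are distinct. *)
Lemma strictly_invariant (G : set perm2) (B : set (matrices Z)) :
  perm_subgroup G -> measurable B ->
  (forall g, G g -> {ae D, forall r, B (act g r) <-> B r}) ->
  exists2 B', invariant_sets G B' & {ae D, forall r, B r <-> B' r}.
Proof.
move=> [G1 GM GV] mB hB.
exists (\bigcap_(g in G) (act g @^-1` B)).
  split; first exact: measurable_bigcap_perm.
  move=> h Gh; apply/seteqP; split => r hr g Gg.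
    have := hr (perm2_mul g (perm2_inv h)) (GM _ _ Gg (GV _ Gh)).
    by rewrite /preimage /= act_mul act_invK.
  by have := hr (perm2_mul g h) (GM _ _ Gg Gh).
have := @ae_forall_perm D G (fun a r => B (a r) <-> B r) hB.
apply: filterS => r h; split => [Br g Gg|/(_ _ G1)].
  by apply/h.
by rewrite /preimage /= act_one.
Qed.

Hypothesis herg : ergodic_measure D.

Lemma ae_invariant_01 (B : set (matrices Z)) : measurable B ->
  (forall p, {ae D, forall r, B (act (on_rows p) r) <-> B r}) ->
  (forall p, {ae D, forall r, B (act (on_cols p) r) <-> B r}) ->
  D B = 0%E \/ D B = 1%E.
Proof.
move=> mB hr hc.
have hB g : setT g -> {ae D, forall r, B (act g r) <-> B r}.
  move=> _; have h1 := mp_ae (mp_act (on_cols g.2)) (hr g.1).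
  apply: filterS2 h1 (hc g.2) => r e1 e2.
  by rewrite act_split; exact: iff_trans e1 e2.
have [B' iB' BB'] := strictly_invariant full_subgroup mB hB.
have -> : D B = D B' by apply: prob_ae_eq => //; exact: iB'.1.
exact: herg.
Qed.

Lemma ae_invariant_const (f : matrices Z -> R) : bdm f ->
  (forall p, {ae D, forall r, f (act (on_rows p) r) = f r}) ->
  (forall p, {ae D, forall r, f (act (on_cols p) r) = f r}) ->
  {ae D, forall r, f r = mean D f}.
Proof.
move=> bf hr hc; apply: ae_eq_mean_01 => //; apply: ae_invariant_01.
- rewrite (_ : [set x | _] = f @^-1` `]mean D f, +oo[); first by apply: (preimT bf.1).
  by apply/seteqP; split => x /=; rewrite in_itv/= andbT.
- by move=> p; apply: filterS (hr p) => r /= ->.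
- by move=> p; apply: filterS (hc p) => r /= ->.
Qed.

Lemma sigma_invariant_sets G : <<s @invariant_sets _ Z G >> = invariant_sets G.
Proof.
apply: sigma_algebra_id; split.
- by split; [exact: measurable0 | move=> g _; rewrite preimage_set0].
- move=> A [mA hA]; rewrite setTD; split; first exact: measurableC.
  by move=> g Gg; exact: (congr1 (@setC _) (hA g Gg)).
- move=> F hF; split; first by apply: bigcupT_measurable => i; have [] := hF i.
  move=> g Gg; rewrite preimage_bigcup; apply: eq_bigcupr => i _.
  exact: (hF i).2.
Qed.

(** Matrices with the sigma-algebra of invariant sets only, so that a
    measurable function on it is an invariant function. *)
Definition invariant_space G := g_sigma_algebraType (@invariant_sets _ Z G).

Lemma measurable_invariant_space G (A : set (invariant_space G)) :
  measurable A <-> invariant_sets G A.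
Proof.
have -> : invariant_sets G A = <<s @invariant_sets _ Z G >> A by rewrite sigma_invariant_sets.
by [].
Qed.

Lemma invariant_fun G d (T : measurableType d) (a : matrices Z -> T) g r :
  measurable_fun setT (a : invariant_space G -> T) ->
  (forall t : T, measurable [set t]) -> G g -> a (act g r) = a r.
Proof.
move=> ma m1 Gg; have := preimT ma (m1 (a r)).
move=> /measurable_invariant_space -[_ /(_ _ Gg)] /seteqP[_ /(_ r)].
by rewrite /preimage /=; apply.
Qed.

Lemma measurable_of_invariant G d (T : measurableType d) (a : matrices Z -> T) :
  measurable_fun setT (a : invariant_space G -> T) -> measurable_fun setT a.
Proof.
move=> ma _ A mA; rewrite setTI; have := preimT ma mA.
by move=> /measurable_invariant_space -[].
Qed.

(** The conditional probability [g] of [E] given the row-invariant sets is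
    row-invariant by definition, and almost column-invariant because [E] is
    column-invariant while column permutations preserve [D] and the
    row-invariant sets. By ergodicity it is the constant [D E]. *)
Lemma row_col_independent (E F : set (matrices Z)) :
  invariant_sets col_perms E -> invariant_sets row_perms F ->
  D (E `&` F) = (D E * D F)%E.
Proof.
move=> [mE iE] iF.
pose Tr := invariant_space row_perms.
have mTr (A : set Tr) : measurable A <-> invariant_sets row_perms A.
  exact: measurable_invariant_space.
have mid : measurable_fun setT (id : matrices Z -> Tr).
  by move=> _ A /mTr[mA _]; rewrite setTI.
pose Q := law D mid.
have DQ : measure_preserving D Q id by exact: mp_law.
have [g [mg g01 gE]] := conditional_probability DQ mE.
have bg : bdm g by exact: bdm01.
have mg' : measurable_fun setT (g : matrices Z -> R) by exact: measurable_of_invariant mg.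
have bg' : @bdm R _ (matrices Z) g by exact: bdm01.
have grow p : {ae D, forall r, g (act (on_rows p) r) = g r}.
  by apply: aeW => r; exact: (invariant_fun r mg).
have gcol p : {ae D, forall r, g (act (on_cols p) r) = g r}.
  set h := on_cols p.
  have mh : measurable_fun setT (act h : Tr -> Tr).
    move=> _ A /mTr[mA iA]; rewrite setTI; apply/mTr; split.
      exact: (preimT (measurable_act h)).
    move=> k rk; rewrite -[in RHS](iA k rk).
    by apply/funext => r; rewrite /preimage /= (act_row_col p r rk).
  have Qh : measure_preserving Q Q (act h).
    by split => // A mA; have [mA' _] := (mTr A).1 mA; exact: (hinv h mA').
  have bgh := bdm_comp mh bg.
  suff : {ae Q, forall r, (g \o act h) r = g r} by exact: (mp_ae DQ).
  apply: ae_eq_of_integrals => // A mA.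
  pose A' := act (perm2_inv h) @^-1` A.
  have mA' : measurable (A' : set Tr).
    move/mTr: mA => [mA iA]; apply/mTr; split; first exact: (preimT (measurable_act _)).
    move=> k rk; rewrite /A' -[in RHS](iA k rk).
    by apply/funext => r; rewrite /preimage /= (act_row_col (finperm_inverse p) r rk).
  transitivity (mean Q ((fun r => g r * \1_A' r) \o act h)).
    congr mean; apply/funext => r /=; congr (_ * _); rewrite !indicE.
    have -> : (act h r \in A') = (r \in A) by apply/idP/idP; rewrite !inE /A' /preimage /= act_invK.
    by [].
  rewrite (mean_mp Qh); last by apply: bdmM => //; exact: bdm_indic.
  have e1 := gE _ mA'; have e2 := gE _ mA.
  apply: EFin_inj; rewrite -[LHS]e1 -[RHS]e2.
  rewrite -(hinv h); last by apply: measurableI => //; have /mTr[] := mA'.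
  congr (D _); rewrite preimage_setI iE//; congr (_ `&` _).
  by apply/seteqP; split => r; rewrite /A' /preimage /= act_invK.
have gc := ae_invariant_const bg' grow gcol.
have mQD (f : matrices Z -> R) : bdm (f : Tr -> R) -> mean Q f = mean D f.
  by move=> bf; rewrite -[LHS](mean_mp DQ).
have mF : measurable (F : set Tr) by apply/mTr.
have mF' : measurable F by have [] := iF.
have DE : D E = (mean D g)%:E.
  have := gE _ measurableT; rewrite preimage_setT setIT => ->; congr (_%:E).
  rewrite mQD; last by apply: bdmM => //; exact: bdm_indic.
  by congr mean; apply/funext => r; rewrite indicT mulr1.
have := gE _ mF; rewrite preimage_id => ->.
rewrite mQD; last by apply: bdmM => //; exact: bdm_indic.
rewrite DE -[D F]fineK ?pr_fin// -EFinM; congr (_%:E).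
rewrite -mean_indic// -meanZ; last exact: bdm_indic.
apply: EFin_inj; rewrite -!meanE; last 2 first.
- by apply: bdmZ; exact: bdm_indic.
- by apply: bdmM => //; exact: bdm_indic.
apply: ae_eq_integral => //.
- by apply/measurable_EFinP; apply: measurable_funM => //; exact: measurable_indic.
- by apply/measurable_EFinP; apply: measurable_funM => //; exact: measurable_indic.
- by apply: filterS gc => r e _ /=; rewrite e.
Qed.

End action.

(** * Recoverable functions *)

(** [matrix_map], with its domain typed as a product of measurable spaces. *)
Definition sampled dZ (Z : measurableType dZ) dX (X : measurableType dX)
    dY (Y : measurableType dY) (f : X * Y -> Z) :
    power nat X * power nat Y -> matrices Z := matrix_map f.

Section matrix_map.
Context (R : realType) dZ (Z : measurableType dZ)
  dX (X : measurableType dX) dY (Y : measurableType dY).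
Variables (mu : probability X R) (nu : probability Y R).
Variables (P : probability (power nat X) R) (Q : probability (power nat Y) R).
Hypotheses (hP : is_power_measure mu P) (hQ : is_power_measure nu Q).

Lemma measurable_sampled (f : X * Y -> Z) : measurable_fun setT f ->
  measurable_fun setT (sampled f).
Proof.
move=> mf; apply: measurable_fun_power => -[i j]; rewrite /sampled /matrix_map /=.
apply: (measurableT_comp mf); apply: measurable_fun_pair.
- exact: (measurableT_comp (measurable_coord i) measurable_fst).
- exact: (measurableT_comp (measurable_coord j) measurable_snd).
Qed.

Lemma mp_entry i j : measure_preserving (P \x Q)%E (mu \x nu)%E
  (fun w : power nat X * power nat Y => (w.1 i, w.2 j)).
Proof. exact: (mp_prod (mp_coord i hP) (mp_coord j hQ)). Qed.

Lemma ae_entries (H : X * Y -> Prop) : {ae (mu \x nu)%E, forall p, H p} ->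
  {ae (P \x Q)%E, forall w : power nat X * power nat Y, forall i j, H (w.1 i, w.2 j)}.
Proof.
move=> hH; apply/ae_foralln => i; apply/ae_foralln => j.
exact: (mp_ae (mp_entry i j) hH).
Qed.

Lemma ae_matrix_map_eq (f g : X * Y -> Z) : {ae (mu \x nu)%E, forall p, f p = g p} ->
  {ae (P \x Q)%E, forall w : power nat X * power nat Y, sampled f w = sampled g w}.
Proof.
move=> /ae_entries; apply: filterS => w h; apply/funext => -[i j]; exact: h.
Qed.

Lemma mp_reindex2 (s t : nat -> nat) : injective s -> injective t ->
  measure_preserving (P \x Q)%E (P \x Q)%E
    (fun w : power nat X * power nat Y => ((w.1 \o s, w.2 \o t) : power nat X * power nat Y)).
Proof. by move=> si ti; exact: (mp_prod (mp_reindex hP si) (mp_reindex hQ ti)). Qed.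

End matrix_map.

Section inverse_of_factor.
Context (R : realType) dZ (Z : measurableType dZ)
  dX (X : measurableType dX) dY (Y : measurableType dY).
Variables (mu : probability X R) (nu : probability Y R).
Variables (P : probability (power nat X) R) (Q : probability (power nat Y) R).
Hypotheses (hP : is_power_measure mu P) (hQ : is_power_measure nu Q).
Variables (f : X * Y -> Z) (xi : matrices Z -> X).
Hypothesis mxi : measurable_fun setT xi.
Hypothesis hxi : {ae (P \x Q)%E, forall w : power nat X * power nat Y, xi (sampled f w) = w.1 0%N}.

(** Fixing all the sample points but [x_0] in [x_0 = xi (F_f (x, y))] exhibits
    [x_0] as a function of its image under any factor map. *)
Lemma factor_left_inverse dX' (X' : measurableType dX') dY' (Y' : measurableType dY')
    (f' : X' * Y' -> Z) (S : X -> X') (T : Y -> Y') :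
  measurable_fun setT f' -> intertwines mu nu f f' S T ->
  exists S' : X' -> X, measurable_fun setT S' /\ {ae mu, forall x, S' (S x) = x}.
Proof.
move=> mf' hST.
have h1 : {ae (P \x Q)%E, forall w : power nat X * power nat Y, xi (sampled f' (S \o w.1, T \o w.2)) = w.1 0%N}.
  apply: filterS2 hxi (ae_matrix_map_eq hP hQ hST) => w <- e; congr xi.
  by rewrite -e.
have h2 : {ae (Q \x P)%E, forall p : power nat Y * power nat X, xi (sampled f' (S \o p.2, T \o p.1)) = p.2 0%N}.
  exact: (mp_ae (mp_swap Q P) h1).
have [y hy] := ae_ex (ae_prodE h2).
have h3 := mp_ae (mp_cons hP) hy.
have h4 := ae_prodE (mp_ae (mp_swap P mu) h3).
have [x hx] := ae_ex h4.
exists (fun x' => xi (sampled f'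
  ((cons_point (x', S \o x), T \o y) : power nat X' * power nat Y'))); split.
  apply: (measurableT_comp mxi).
  apply: (measurableT_comp (measurable_sampled mf')).
  apply: measurable_fun_pair; last exact: measurable_cst.
  apply: (measurableT_comp (@measurable_cons_point _ X')).
  by apply: measurable_fun_pair; [exact: measurable_id | exact: measurable_cst].
apply: filterS hx => a /= ha; rewrite -[RHS]ha; congr xi.
apply/funext => -[[|i] j] //.
Qed.

(** [(x, y)] and [(S x, T y)] have the same matrix, hence the same recovered
    point. *)
Lemma congruence_trivial (S : X -> X) (T : Y -> Y) : coded X ->
  measure_preserving mu mu S -> measure_preserving nu nu T ->
  intertwines mu nu f f S T -> {ae mu, forall x, S x = x}.
Proof.
move=> cX mS mT hST.
apply: (mp_aeP _ (mp_comp (mp_fst P Q) (mp_coord 0 hP))).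
  by apply: (measurable_eq cX); [exact: mS.1 | exact: measurable_id].
have m1 := mp_prod (mp_postcomp hP hP mS) (mp_postcomp hQ hQ mT).
apply: filterS3 hxi (mp_ae m1 hxi) (ae_matrix_map_eq hP hQ hST) => w /= e1 e2 e3.
apply: (etrans (etrans (esym e2) _) e1); congr xi.
by rewrite -e3.
Qed.

End inverse_of_factor.

(** Since [S x] has law [mu'], the identity [S (S' (S x)) = S x] is one
    about almost all points of [T']. *)
Lemma isomorphism_of_left_inverse (R : realType) d (T : measurableType d)
    d' (T' : measurableType d') (mu : probability T R) (mu' : probability T' R)
    (S : T -> T') (S' : T' -> T) : coded T' ->
  measure_preserving mu mu' S -> measurable_fun setT S' ->
  {ae mu, forall x, S' (S x) = x} -> isomorphism_mod0 mu mu' S.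
Proof.
move=> cT' hS mS' hS'; split => //; exists S'.
have mpS' : measure_preserving mu' mu S'.
  split => // A mA; have [mS muS] := hS.
  rewrite -muS; last exact: preimT.
  apply: prob_ae_eq => //; first by apply: (preimT mS); exact: preimT.
  by apply: filterS hS' => x; rewrite /preimage /= => ->.
split => //; apply: (mp_aeP _ hS).
  by apply: (measurable_eq cT'); [exact: (measurableT_comp hS.1 mS') | exact: measurable_id].
by apply: filterS hS' => x ->.
Qed.

Section recovery.
Context (R : realType) dZ (Z : measurableType dZ)
  dX (X : measurableType dX) dY (Y : measurableType dY).
Variables (mu : probability X R) (nu : probability Y R).
Variables (P : probability (power nat X) R) (Q : probability (power nat Y) R).
Hypotheses (hP : is_power_measure mu P) (hQ : is_power_measure nu Q).
Variables (f : X * Y -> Z) (xi : matrices Z -> X) (eta : matrices Z -> Y).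
Hypotheses (mf : measurable_fun setT f).
Hypotheses (mxi : measurable_fun setT xi) (meta : measurable_fun setT eta).
Hypothesis hxi : {ae (P \x Q)%E, forall w : power nat X * power nat Y, xi (sampled f w) = w.1 0%N}.
Hypothesis heta : {ae (P \x Q)%E, forall w : power nat X * power nat Y, eta (sampled f w) = w.2 0%N}.
Hypotheses (cX : coded X) (cY : coded Y) (cZ : coded Z).

Definition transposed (r : matrices Z) : matrices Z := fun ij => r (ij.2, ij.1).

Let measurable_transposed : measurable_fun setT transposed.
Proof. exact: measurable_precomp. Qed.

Let heta' : {ae (Q \x P)%E, forall w : power nat Y * power nat X,
  (eta \o transposed) (sampled (transpose f) w) = w.1 0%N}.
Proof.
by apply: filterS (mp_ae (mp_swap Q P) heta) => w /= <-.
Qed.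

Let intertwines_transpose dX' (X' : measurableType dX') dY' (Y' : measurableType dY')
    (f' : X' * Y' -> Z) (S : X -> X') (T : Y -> Y') :
  intertwines mu nu f f' S T ->
  intertwines nu mu (transpose f) (transpose f') T S.
Proof. by move=> h; exact: (mp_ae (mp_swap nu mu) h). Qed.

Lemma recovery_pure : pure mu nu f.
Proof.
move=> dX' X' dY' Y' mu' nu' f' /standard_borel_coded cX' /standard_borel_coded cY' mf'
  [S [T [hS hT hST]]].
exists S, T; split => //.
  have [S' [mS' hS']] := factor_left_inverse hP hQ mxi hxi mf' hST.
  exact: isomorphism_of_left_inverse hS'.
have mft' := measurable_transpose mf'.
have [T' [mT' hT']] := factor_left_inverse hQ hP (measurableT_comp meta measurable_transposed)
  heta' mft' (intertwines_transpose hST).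
exact: isomorphism_of_left_inverse hT'.
Qed.

Lemma recovery_trivial_congruence : trivial_congruence_group mu nu f.
Proof.
move=> [S T] [[hS _] [hT _] hST] /=; split.
  exact: (congruence_trivial hP hQ hxi cX hS hT hST).
exact: (congruence_trivial hQ hP heta' cY hT hS (intertwines_transpose hST)).
Qed.

Variable D : probability (matrices Z) R.
Hypothesis FD : measure_preserving (P \x Q)%E D (sampled f).

Let act_map g (w : power nat X * power nat Y) :
  act g (sampled f w) = sampled f (w.1 \o fperm_inv g.1, w.2 \o fperm_inv g.2).
Proof. by []. Qed.

Let inv_inj (p : finperm) : injective (fperm_inv p).
Proof. exact: (can_inj (@fperm_invK p)). Qed.

Let mp_perm g : measure_preserving (P \x Q)%E (P \x Q)%E
  (fun w : power nat X * power nat Y =>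
    ((w.1 \o fperm_inv g.1, w.2 \o fperm_inv g.2) : power nat X * power nat Y)).
Proof. by apply: (mp_reindex2 hP hQ); exact: inv_inj. Qed.

Let row i (r : matrices Z) : X := xi (act (on_rows (finperm_swap 0 i)) r).
Let col j (r : matrices Z) : Y := eta (act (on_cols (finperm_swap 0 j)) r).

Let mrow i : measurable_fun setT (row i).
Proof. exact: (measurableT_comp mxi (measurable_act _)). Qed.

Let mcol i : measurable_fun setT (col i).
Proof. exact: (measurableT_comp meta (measurable_act _)). Qed.

Let rowE i : {ae (P \x Q)%E, forall w : power nat X * power nat Y, row i (sampled f w) = w.1 i}.
Proof.
by apply: filterS (mp_ae (mp_perm (on_rows (finperm_swap 0 i))) hxi) => w.
Qed.

Let colE i : {ae (P \x Q)%E, forall w : power nat X * power nat Y, col i (sampled f w) = w.2 i}.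
Proof.
by apply: filterS (mp_ae (mp_perm (on_cols (finperm_swap 0 i))) heta) => w.
Qed.

Let entryE i j : {ae D, forall r, r (i, j) = f (row i r, col j r)}.
Proof.
apply: (mp_aeP _ FD).
  apply: (measurable_eq cZ); first exact: measurable_coord.
  exact: (measurableT_comp mf (measurable_fun_pair (mrow i) (mcol j))).
by apply: filterS2 (rowE i) (colE j) => w -> ->.
Qed.

Let row_inv i g : col_perms g -> {ae D, forall r, row i (act g r) = row i r}.
Proof.
move=> hg; apply: (mp_aeP _ FD).
  by apply: (measurable_eq cX) => //; exact: (measurableT_comp (mrow i) (measurable_act g)).
apply: filterS2 (rowE i) (mp_ae (mp_perm g) (rowE i)) => w e1 e2.
by rewrite act_map e2 e1 /= -{1}(hg i : _ = i) fpermK.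
Qed.

Let col_inv i g : row_perms g -> {ae D, forall r, col i (act g r) = col i r}.
Proof.
move=> hg; apply: (mp_aeP _ FD).
  by apply: (measurable_eq cY) => //; exact: (measurableT_comp (mcol i) (measurable_act g)).
apply: filterS2 (colE i) (mp_ae (mp_perm g) (colE i)) => w e1 e2.
by rewrite act_map e2 e1 /= -{1}(hg i : _ = i) fpermK.
Qed.

Let Sigma := <<s @invariant_sets _ Z row_perms `|` invariant_sets col_perms >>.
Let almost := [set B : set (matrices Z) | measurable B /\
  exists2 C, Sigma C & {ae D, forall r, B r <-> C r}].

Let Sigma_measurable C : Sigma C -> measurable C.
Proof.
move: C; apply: smallest_sub; first exact: sigma_algebra_measurable.
by move=> C [[]|[]].
Qed.

Let almost_sigma : sigma_algebra setT almost.
Proof.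
split.
- by split => //; exists set0; [exact: sigma_algebra0 | apply: aeW].
- move=> A [mA [C SC AC]]; rewrite setTD; split; first exact: measurableC.
  exists (~` C); first by rewrite -setTD; exact: sigma_algebraCD.
  by apply: filterS AC => r [h1 h2]; split => h ?; apply: h; [exact: h2|exact: h1].
- move=> A hA; split; first by apply: bigcupT_measurable => i; have [] := hA i.
  have /choice[C hC] : forall i, exists C, Sigma C /\ {ae D, forall r, A i r <-> C r}.
    by move=> i; have [_ [C ? ?]] := hA i; exists C.
  exists (\bigcup_i C i).
    by apply: sigma_algebra_bigcup => i; have [] := hC i.
  have /ae_foralln : forall i, {ae D, forall r, A i r <-> C i r} by move=> i; have [] := hC i.
  by apply: filterS => r h; split => -[i _ /h ?]; exists i.
Qed.

Let almost_space := g_sigma_algebraType almost.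

Let almostP (A : set almost_space) : measurable A <-> almost A.
Proof.
have -> : almost A = <<s almost >> A by rewrite (sigma_algebra_id almost_sigma).
by [].
Qed.

(** The recovered points [row i] are almost invariant under column
    permutations, and [col j] under row permutations; [strictly_invariant]
    makes them measurable for the completion [almost] of the sigma-algebra
    generated by the invariant sets. So are then the entries [f (row i, col
    j)]. *)
Lemma recovery_simple : simple_measure D.
Proof.
have Srow i : measurable_fun setT (row i : almost_space -> X).
  move=> _ A mA; rewrite setTI; apply/almostP; split; first exact: (preimT (mrow i)).
  have [g hg|C iC hC] := @strictly_invariant _ _ _ D col_perms _ col_subgroup (preimT (mrow i) mA).
    by apply: filterS (row_inv i hg) => r; rewrite /preimage /= => ->.
  by exists C => //; apply: sub_sigma_algebra; right.
have Scol i : measurable_fun setT (col i : almost_space -> Y).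
  move=> _ A mA; rewrite setTI; apply/almostP; split; first exact: (preimT (mcol i)).
  have [g hg|C iC hC] := @strictly_invariant _ _ _ D row_perms _ row_subgroup (preimT (mcol i) mA).
    by apply: filterS (col_inv i hg) => r; rewrite /preimage /= => ->.
  by exists C => //; apply: sub_sigma_algebra; left.
have : measurable `<=` almost.
  apply: smallest_sub => // _ [[i j] [A mA ->]].
  split; first exact: (preimT (measurable_coord (i, j))).
  have mfij := measurableT_comp mf (measurable_fun_pair (Srow i) (Scol j)).
  have [_ [C SC hC]] := (almostP _).1 (preimT mfij mA).
  exists C => //; apply: filterS2 hC (entryE i j) => r h e.
  by rewrite /preimage /= e; exact: h.
move=> sub B mB; have [_ [C SC BC]] := sub B mB; exists C => //.
by apply/symdiff_ae => //; exact: Sigma_measurable.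
Qed.

End recovery.

(** * Exchangeable sequences *)

Section exchangeable_sequence.
Context (R : realType) d (T : measurableType d) (D : probability T R).
Context d' (X : measurableType d').
Variables (x : nat -> T -> X) (tau : finperm -> T -> T).
Hypothesis mx : forall i, measurable_fun setT (x i).
Hypothesis mtau : forall p, measure_preserving D D (tau p).
Hypothesis hx : forall p i, {ae D, forall r, x i (tau p r) = x (fperm_inv p i) r}.
(** A 0-1 law, restricted to the functions of the sequence, which in the
    application have invariance properties of their own. *)
Hypothesis const : forall f : T -> R, bdm f ->
  (forall p, {ae D, forall r, f (tau p r) = f r}) ->
  (forall s t : T, (forall i, x i s = x i t) -> f s = f t) ->
  {ae D, forall r, f r = mean D f}.

Let hx_all p : {ae D, forall r, forall i, x i (tau p r) = x (fperm_inv p i) r}.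
Proof. by apply/ae_foralln => i; exact: hx. Qed.

Let prob_perm p (H : (nat -> X) -> Prop) :
  measurable [set r | H (x ^~ r)] -> measurable [set r | H (fun i => x (fperm_inv p i) r)] ->
  D [set r | H (x ^~ r)] = D [set r | H (fun i => x (fperm_inv p i) r)].
Proof.
move=> mH mH'; have [mt Dt] := mtau p.
rewrite -Dt//; apply: prob_ae_eq => //; first exact: preimT.
apply: filterS (hx_all p) => r h; rewrite /preimage /=.
by rewrite (_ : x^~ (tau p r) = fun i => x (fperm_inv p i) r)//; apply/funext.
Qed.

Let mxA i A : measurable A -> measurable [set r | A (x i r)].
Proof. by move=> mA; exact: (preimT (mx i) mA). Qed.

Let prob1 i A : measurable A -> D [set r | A (x i r)] = D [set r | A (x 0%N r)].
Proof.
move=> mA; rewrite (@prob_perm (finperm_swap 0 i) (fun u => A (u i))).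
- by rewrite /= /swap_nat eqxx; case: eqP => // ->.
- exact: mxA.
- exact: mxA.
Qed.

Let prob2 i j A : i != j -> measurable A ->
  D [set r | A (x i r) /\ A (x j r)] = D [set r | A (x 0%N r) /\ A (x 1%N r)].
Proof.
move=> ij mA; have m2 a b : measurable [set r | A (x a r) /\ A (x b r)].
  by apply: measurableI; exact: mxA.
have step p a b : D [set r | A (x a r) /\ A (x b r)] =
    D [set r | A (x (fperm_inv p a) r) /\ A (x (fperm_inv p b) r)].
  by apply: (@prob_perm p (fun u => A (u a) /\ A (u b))); exact: m2.
rewrite (step (finperm_swap 0 i)) /=.
have -> : swap_nat 0 i i = 0%N by rewrite /swap_nat eqxx; case: eqP.
set j' := swap_nat 0 i j.
have j'0 : j' != 0%N.
  by rewrite /j' /swap_nat; move: ij; do ![case: eqP => //=]; move=> *; subst; apply/eqP; congruence.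
rewrite (step (finperm_swap 1 j')) /=.
have -> : swap_nat 1 j' 0 = 0%N by rewrite /swap_nat /= eq_sym (negbTE j'0).
by have -> : swap_nat 1 j' j' = 1%N by rewrite /swap_nat eqxx; case: eqP.
Qed.

(** A finite permutation does not change the partial sums beyond its
    support, hence does not change the limit of the averages. *)
Lemma sum_finperm (p : finperm) (h : nat -> R) : exists n, forall m, (n <= m)%N ->
  \sum_(0 <= i < m) h (fperm_inv p i) = \sum_(0 <= i < m) h i.
Proof.
have [n hn] := fperm_finite p.
have hn' i : (n <= i)%N -> fperm_inv p i = i by move=> /hn e; rewrite -{1}e fpermK.
exists n => m nm; rewrite -(big_map (fperm_inv p) xpredT h); apply: perm_big.
have pinj : injective p := can_inj (@fpermK p).
have piinj : injective (fperm_inv p) := can_inj (@fperm_invK p).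
have im i : (i < m)%N -> (fperm_inv p i < m)%N.
  move=> im; rewrite ltnNge; apply/negP => mi.
  have := hn' _ (leq_trans nm mi) => /piinj e.
  by move: im; rewrite -e ltnNge mi.
have im' i : (i < m)%N -> (p i < m)%N.
  move=> im_; rewrite ltnNge; apply/negP => mi.
  have := hn _ (leq_trans nm mi) => /pinj e.
  by move: im_; rewrite -e ltnNge mi.
apply: uniq_perm; [by rewrite map_inj_uniq ?iota_uniq | exact: iota_uniq |].
move=> i; rewrite mem_index_iota /=; apply/mapP/idP => [[j]|im_].
  by rewrite mem_index_iota /= => /im ? ->.
by exists (p i); rewrite ?fpermK// mem_index_iota /= im'.
Qed.

(** The limit of the averages of the indicators is invariant under
    permutations, hence constant, and [exchangeable_uncorrelated] applies. *)
Let uncorrelated A : measurable A ->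
  D [set r | A (x 0%N r) /\ A (x 1%N r)] =
    (fine (D [set r | A (x 0%N r)]) * fine (D [set r | A (x 0%N r)]))%:E.
Proof.
move=> mA; pose h i r : R := \1_A (x i r).
have bh i : bdm (h i) by exact: (bdm_comp (mx i) (bdm_indic _ mA)).
have h01 i r : 0 <= h i r <= 1 by exact: indic01.
have hI i : h i = \1_[set r | A (x i r)].
  by apply/funext => r; rewrite /h !indicE; congr (_%:R); apply/idP/idP; rewrite !inE.
set p := fine _.
have hp i : mean D (h i) = p.
  by rewrite hI mean_indic ?prob1//; exact: mxA.
have hh i j : mean D (fun r => h i r * h j r) = fine (D [set r | A (x i r) /\ A (x j r)]).
  rewrite -mean_indic; last by apply: measurableI; exact: mxA.
  congr mean; apply/funext => r; rewrite !hI.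
  by rewrite (_ : [set r | A (x i r) /\ _] = [set r | A (x i r)] `&` [set r | A (x j r)]) ?indicI.
set a := fine (D [set r | A (x 0%N r) /\ A (x 1%N r)]).
have ha k l : k != l -> mean D (fun r => h k r * h l r) = a by move=> kl; rewrite hh prob2.
have hb k : mean D (fun r => h k r * h k r) = p.
  by rewrite -[RHS](hp k); congr mean; apply/funext => r; rewrite /h indicE; case: (_ \in _) => /=; rewrite ?mulr1 ?mulr0.
(* Truncation keeps [L] bounded where the averages diverge. *)
pose L r := Order.max 0 (Order.min 1 (limn_sup (avg h ^~ r))).
have avgh k r : 0 <= avg h k r <= 1 by exact: avg01.
have cv := ae_cvg_avg bh ha hb.
have mL : measurable_fun setT L.
  apply: measurable_maxr; first exact: measurable_cst.
  apply: measurable_minr; first exact: measurable_cst.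
  by apply: measurable_limsup_avg => // i; exact: (bh i).1.
have cvL : {ae D, forall r, avg h ^~ r @ \oo --> L r}.
  apply: filterS cv => r c; rewrite /L cvg_limn_supE// min_r ?max_r//.
    by apply: limr_ge => //; apply: nearW => k; have /andP[] := avgh k r.
  by apply: limr_le => //; apply: nearW => k; have /andP[] := avgh k r.
have L01 r : 0 <= L r <= 1.
  by rewrite /L le_max lexx /= ge_max ler01 ge_min lexx.
have bL : bdm L by exact: bdm01.
have Lt q : {ae D, forall r, L (tau q r) = L r}.
  apply: filterS3 cvL (mp_ae (mtau q) cvL) (hx_all q) => r c1 c2 e.
  have [n hn] := sum_finperm q (h ^~ r).
  apply: (@cvg_unique _ _ (avg h ^~ r @ \oo)) => //.
  apply: cvg_trans c2; apply: near_eq_cvg.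
  exists n => // k /= nk; rewrite /avg; congr (_ * _).
  rewrite (eq_bigr (fun i => h (fperm_inv q i) r)); last by move=> i _; rewrite /h e.
  by rewrite hn//; apply: leq_trans nk _; apply: ltnW; exact: ltn_expl.
have Lc : {ae D, forall r, L r = mean D L}.
  apply: const => // s t st; rewrite /L; congr (Order.max _ (Order.min _ (limn_sup _))); apply/funext => k.
  by rewrite /avg; congr (_ * _); apply: eq_bigr => i _; rewrite /h st.
have hc : {ae D, forall r, avg h ^~ r @ \oo --> mean D L}.
  by apply: filterS2 cvL Lc => r c <-.
rewrite -(exchangeable_uncorrelated bh h01 hp ha hb hc) /a fineK// pr_fin//.
by apply: measurableI; exact: mxA.
Qed.

(** By induction on [n]: the events [x (n + k) \in A n] have the same
    correlation with the event about the first [n] terms, by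
    exchangeability, and are pairwise uncorrelated, so that
    [independent_of_constant_correlation] splits off a factor. *)
Lemma exchangeable_iid (mxx : measurable_fun setT (fun r => (x ^~ r) : power nat X)) :
  is_power_measure (law D (mx 0)) (law D mxx).
Proof.
move=> n A mA; rewrite -[LHS]/(D [set r | forall i, (i < n)%N -> A i (x i r)]).
elim: n => [|n IH].
  rewrite big_ord0 (_ : [set r | _] = setT) ?prT//; by apply/seteqP; split.
pose V := [set r | forall i, (i < n)%N -> A i (x i r)].
have mV : measurable V.
  exact: (preimT mxx (measurable_cylinder n mA)).
pose U k := [set r | A n (x (n + k)%N r)].
have mU k : measurable (U k) by exact: mxA.
set p := fine (D [set r | A n (x 0%N r)]).
have hp k : D (U k) = p%:E by rewrite /U prob1// fineK// pr_fin//; exact: mxA.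
have hpp k l : k != l -> D (U k `&` U l) = (p * p)%:E.
  move=> kl; rewrite -[LHS]/(D [set r | A n (x (n + k)%N r) /\ A n (x (n + l)%N r)]).
  by rewrite prob2 ?eqn_add2l// uncorrelated.
have hc k : D (U k `&` V) = (fine (D (U 0%N `&` V)))%:E.
  rewrite fineK; last by apply: pr_fin; exact: measurableI.
  pose H (u : nat -> X) := A n (u (n + k)%N) /\ forall i, (i < n)%N -> A i (u i).
  have HE q : fperm_inv q (n + k)%N = (n + 0)%N -> (forall i, (i < n)%N -> fperm_inv q i = i) ->
      [set r | H (fun i => x (fperm_inv q i) r)] = U 0%N `&` V.
    move=> qk qi; apply/seteqP; split => r; rewrite /H /= qk => -[? h]; split=> // i im;
      by have := h i im; rewrite qi.
  pose q := finperm_swap (n + 0) (n + k).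
  have e1 : fperm_inv q (n + k)%N = (n + 0)%N.
    by rewrite /= /swap_nat eqxx; case: eqP.
  have e2 i : (i < n)%N -> fperm_inv q i = i.
    by move=> im; rewrite /= /swap_nat !ltn_eqF// (leq_trans im)// leq_addr.
  rewrite -(HE q e1 e2) -[LHS]/(D [set r | H (x ^~ r)]); apply: prob_perm.
    exact: (measurableI _ _ (mU k) mV).
  by rewrite (HE q e1 e2); exact: measurableI.
have := independent_of_constant_correlation mU mV hp hpp hc.
rewrite big_ord_recr /= -IH -/V => e.
rewrite (_ : [set r | _] = U 0%N `&` V); last first.
  apply/seteqP; split => r.
    by move=> h; split; [rewrite /U /= addn0; exact: h | move=> i im; apply: h; exact: ltnW].
  move=> [Ur Vr] i; rewrite ltnS leq_eqVlt => /predU1P[->|]; last exact: Vr.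
  by move: Ur; rewrite /U /= addn0.
rewrite -[LHS]fineK; last by apply: pr_fin; exact: measurableI.
rewrite e muleC EFinM; congr (_ * _)%E; last by rewrite fineK// pr_fin.
by rewrite /p fineK// pr_fin//; exact: mxA.
Qed.

End exchangeable_sequence.

(** * Realization of simple measures *)

Lemma measurable_bitseqs1 (t : bitseqs) : measurable [set t].
Proof.
have := measurable_eq coded_bitseqs (@measurable_id _ bitseqs setT) (measurable_cst t).
by congr measurable; apply/seteqP; split.
Qed.

Lemma combine_bitseqs d (S : measurableType d) (a : nat -> S -> bitseqs) :
  (forall n, measurable_fun setT (a n)) ->
  exists (A : S -> bitseqs) (pr : nat -> bitseqs -> bitseqs),
    [/\ measurable_fun setT A, forall n, measurable_fun setT (pr n) &
        forall n s, pr n (A s) = a n s].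
Proof.
move=> ma; have [c [r [mc mr cr]]] := coded_power nat coded_bitseqs.
exists (c \o (fun s => a ^~ s)), (fun n b => r b n); split.
- by apply: measurableT_comp => //; exact: measurable_fun_power.
- by move=> n; exact: (measurableT_comp (measurable_coord n) mr).
- by move=> n s /=; rewrite cr.
Qed.

Section two_sigma_algebras.
Context (T : pointedType) (G1 G2 : set (set T)).
Let T1 := g_sigma_algebraType G1.
Let T2 := g_sigma_algebraType G2.

(** This describes the join of two sigma-algebras explicitly, see
    [g_sigma_pair_measurable]. *)
Definition pair_measurable (C : set T) :=
  exists (a : T1 -> bitseqs) (b : T2 -> bitseqs) (J : set (bitseqs * bitseqs)),
    [/\ measurable_fun setT a, measurable_fun setT b, measurable J &
        forall t, C t <-> J (a t, b t)].

Lemma pair_measurable_seq (C : nat -> set T) : (forall n, pair_measurable (C n)) ->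
  exists (a : T1 -> bitseqs) (b : T2 -> bitseqs) (J : nat -> set (bitseqs * bitseqs)),
    [/\ measurable_fun setT a, measurable_fun setT b, forall n, measurable (J n) &
        forall n t, C n t <-> J n (a t, b t)].
Proof.
move=> hC.
have /choice[abJ habJ] : forall n, exists abJ : (T1 -> bitseqs) * (T2 -> bitseqs) * set (bitseqs * bitseqs),
    [/\ measurable_fun setT abJ.1.1, measurable_fun setT abJ.1.2, measurable abJ.2 &
        forall t, C n t <-> abJ.2 (abJ.1.1 t, abJ.1.2 t)].
  by move=> n; have [a [b [J ?]]] := hC n; exists (a, b, J).
have [a [pa [ma mpa pae]]] : exists (A : T1 -> bitseqs) (pr : nat -> bitseqs -> bitseqs),
    [/\ measurable_fun setT A, forall n, measurable_fun setT (pr n) &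
        forall n s, pr n (A s) = (abJ n).1.1 s].
  by apply: combine_bitseqs => n; have [] := habJ n.
have [b [pb [mb mpb pbe]]] : exists (A : T2 -> bitseqs) (pr : nat -> bitseqs -> bitseqs),
    [/\ measurable_fun setT A, forall n, measurable_fun setT (pr n) &
        forall n s, pr n (A s) = (abJ n).1.2 s].
  by apply: combine_bitseqs => n; have [] := habJ n.
exists a, b, (fun n => [set p | (abJ n).2 (pa n p.1, pb n p.2)]); split => //.
  move=> n; have [_ _ mJ _] := habJ n.
  apply: (preimT _ mJ); apply: measurable_fun_pair.
    exact: (measurableT_comp (mpa n) measurable_fst).
  exact: (measurableT_comp (mpb n) measurable_snd).
by move=> n t; have [_ _ _ h] := habJ n; rewrite h /= pae pbe.
Qed.

Lemma g_sigma_pair_measurable C : <<s G1 `|` G2 >> C -> pair_measurable C.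
Proof.
move: C; apply: smallest_sub; last first.
  move=> A [GA|GA].
    exists (bits (fun=> A)), (fun=> point), [set p : bitseqs * bitseqs | p.1 0%N]; split => //.
    - by apply: measurable_bits => _; exact: sub_sigma_algebra.
    - exact: (preimT measurable_fst (measurable_bit 0)).
    - by move=> t; rewrite /bits /=; split => [?|/asboolP//]; exact/asboolP.
  exists (fun=> point), (bits (fun=> A)), [set p : bitseqs * bitseqs | p.2 0%N]; split => //.
  - by apply: measurable_bits => _; exact: sub_sigma_algebra.
  - exact: (preimT measurable_snd (measurable_bit 0)).
  - by move=> t; rewrite /bits /=; split => [?|/asboolP//]; exact/asboolP.
split.
- by exists (fun=> point), (fun=> point), set0; split.
- move=> A [a [b [J [ma mb mJ h]]]]; exists a, b, (~` J); split => //.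
    exact: measurableC.
  by move=> t; rewrite setTD /=; split => h1 h2; apply: h1; apply/h.
- move=> A /pair_measurable_seq[a [b [J [ma mb mJ h]]]].
  exists a, b, (\bigcup_n J n); split => //; first exact: bigcupT_measurable.
  by move=> t; split => -[n _ ?]; exists n => //; apply/h.
Qed.

End two_sigma_algebras.

Section simple_measures.
Context (R : realType) dZ (Z : measurableType dZ).
Variable D : probability (matrices Z) R.
Hypotheses (hinv : invariant_measure D) (herg : ergodic_measure D).
Hypothesis cZ : coded Z.

Let Tc := @invariant_space _ Z col_perms.
Let Tr := @invariant_space _ Z row_perms.

Lemma mp_independent d1 (S1 : measurableType d1) d2 (S2 : measurableType d2)
    (a : Tc -> S1) (b : Tr -> S2) (ma : measurable_fun setT (a : matrices Z -> S1))
    (mb : measurable_fun setT (b : matrices Z -> S2)) :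
  measurable_fun setT a -> measurable_fun setT b ->
  measure_preserving D (law D ma \x law D mb)%E (fun r => (a r, b r)).
Proof.
move=> mac mbr; apply: mp_pair => // A B mA mB.
apply: row_col_independent => //; apply/measurable_invariant_space; exact: preimT.
Qed.

(** A vote over [b] only sees [a] through the values of [Psi (a, b)]. *)
Lemma votes_invariant d1 (S1 : measurableType d1) d2 (S2 : measurableType d2)
    (a a' : matrices Z -> S1) (b : matrices Z -> S2) (nu : probability S2 R)
    (al : probability (S1 * S1)%type R) (Psi : S1 * S2 -> Z) C B :
  measurable_fun setT Psi -> measurable_fun setT a -> measurable_fun setT a' ->
  (forall i, measurable (C i)) -> (forall i, measurable (B i)) ->
  measure_preserving D (al \x nu)%E (fun r => ((a r, a' r), b r)) ->
  {ae D, forall r, Psi (a' r, b r) = Psi (a r, b r)} ->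
  {ae D, forall r, votes nu Psi C B (a' r) = votes nu Psi C B (a r)}.
Proof.
move=> mPsi ma ma' mC mB hab hPsi.
have h1 : {ae (al \x nu)%E, forall p : (S1 * S1) * S2, Psi (p.1.2, p.2) = Psi (p.1.1, p.2)}.
  have mp1 (h : S1 * S1 -> S1) : measurable_fun setT h ->
      measurable_fun setT (fun p : (S1 * S1) * S2 => Psi (h p.1, p.2)).
    move=> mh; apply: (measurableT_comp mPsi); apply: measurable_fun_pair.
      exact: (measurableT_comp mh measurable_fst).
    exact: measurable_snd.
  apply: (mp_aeP _ hab) => //; apply: (measurable_eq cZ).
    exact: (mp1 _ measurable_snd).
  exact: (mp1 _ measurable_fst).
have ma2 : measurable_fun setT (fun r => (a r, a' r)) by exact: measurable_fun_pair.
have h2 : measure_preserving D al (fun r => (a r, a' r)).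
  by have := mp_comp hab (mp_fst al nu); exact.
have := mp_ae h2 (ae_prodE h1); apply: filterS => r hr /=.
apply/funext => i; rewrite /votes /bits; congr (`[< (_ < _ * _)%E >]).
have mI s : measurable [set y | C i y /\ B i (Psi (s, y))].
  apply: measurableI => //; apply: (preimT _ (mB i)).
  exact: (measurableT_comp mPsi (measurable_fun_pair (measurable_cst s) (@measurable_id _ _ _))).
apply: prob_ae_eq => //; apply: filterS hr => y /= e.
by rewrite e.
Qed.

Hypothesis hsimple : simple_measure D.

Lemma act_col_row g p (r : matrices Z) : col_perms g ->
  act g (act (on_rows p) r) = act (on_rows p) (act g r).
Proof. by move=> hg; rewrite (act_col r hg) (act_col (act _ r) hg). Qed.

Lemma measurable_act_rows p : measurable_fun setT (act (on_rows p) : Tc -> Tc).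
Proof.
move=> _ A /measurable_invariant_space[mA iA]; rewrite setTI.
apply/measurable_invariant_space; split; first exact: (preimT (measurable_act _)).
move=> k rk; rewrite -[in RHS](iA k rk).
by apply/funext => r; rewrite /preimage /= (act_col_row p r rk).
Qed.

Lemma measurable_act_cols p : measurable_fun setT (act (on_cols p) : Tr -> Tr).
Proof.
move=> _ A /measurable_invariant_space[mA iA]; rewrite setTI.
apply/measurable_invariant_space; split; first exact: (preimT (measurable_act _)).
move=> k rk; rewrite -[in RHS](iA k rk).
by apply/funext => r; rewrite /preimage /= (act_row_col p r rk).
Qed.

(** Simplicity lets the bits of the entry be written, up to null sets, by
    means of the two invariant sigma-algebras. *)
Lemma simple_entry : exists (a : Tc -> bitseqs) (b : Tr -> bitseqs) (Psi : bitseqs * bitseqs -> Z),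
  [/\ measurable_fun setT a, measurable_fun setT b, measurable_fun setT Psi &
      {ae D, forall r : matrices Z, r (0%N, 0%N) = Psi (a r, b r)}].
Proof.
have [c [rz [mc mr cr]]] := cZ.
pose E m : set (matrices Z) := [set r | c (r (0%N, 0%N)) m].
have mE m : measurable (E m).
  exact: (preimT (measurableT_comp mc (measurable_coord (0%N, 0%N))) (measurable_bit m)).
have /choice[C hC] : forall m, exists C,
    <<s @invariant_sets _ Z col_perms `|` invariant_sets row_perms >> C /\
    {ae D, forall r, E m r <-> C r}.
  move=> m; have [C SC hC] := hsimple (mE m); exists C; split.
    by rewrite setUC.
  apply/symdiff_ae => //.
  move: SC; clear hC; move: C; apply: smallest_sub; first exact: sigma_algebra_measurable.
  by move=> C [[]|[]].
have [a [b [J [ma mb mJ h]]]] := pair_measurable_seq (fun m => g_sigma_pair_measurable (hC m).1).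
exists a, b, (rz \o bits J); split => //.
  by apply: measurableT_comp => //; exact: measurable_bits.
have /ae_foralln : forall m, {ae D, forall r, E m r <-> C m r} by move=> m; have [] := hC m.
apply: filterS => r hr; rewrite -[LHS]cr /=; congr rz; apply/funext => m.
rewrite /bits; apply/idP/asboolP.
  by move=> cm; apply/h; apply/hr.
by move=> Jm; apply/hr; apply/h.
Qed.

(** [xi] and [eta] are the two coordinates of [(a, b)] in the canonical
    factor of [Psi]. If a row permutation fixes [0], then it preserves [b]
    and the corner entry, so that [Psi (a', b) = Psi (a, b)] where [a'] is
    the value of [a] after the permutation; [(a, a')] being independent of
    [b], [votes_invariant] applies. *)
Lemma simple_representation : exists (xi eta : matrices Z -> bitseqs) (f : bitseqs * bitseqs -> Z),
  [/\ measurable_fun setT (xi : Tc -> bitseqs), measurable_fun setT (eta : Tr -> bitseqs),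
      measurable_fun setT f,
      (forall p, fperm_inv p 0%N = 0%N ->
        {ae D, forall r, xi (act (on_rows p) r) = xi r} /\
        {ae D, forall r, eta (act (on_cols p) r) = eta r}) &
      {ae D, forall r : matrices Z, r (0%N, 0%N) = f (xi r, eta r)}].
Proof.
have [a [b [Psi [mac mbr mPsi hPsi]]]] := simple_entry.
have ma := measurable_of_invariant mac; have mb := measurable_of_invariant mbr.
pose mu := law D ma; pose nu := law D mb.
have hab : measure_preserving D (mu \x nu)%E (fun r => (a r, b r)) by exact: mp_independent.
have [C [A [B [B' [f [mC mA [mB mB'] mf hf]]]]]] :=
  canonical_factor mu nu mPsi coded_bitseqs cZ.
have mPsit := measurable_transpose mPsi.
have mS := measurable_votes nu mPsi mC mB; have mT := measurable_votes mu mPsit mA mB'.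
exists (votes nu Psi C B \o a), (votes mu (transpose Psi) A B' \o b), f; split => //.
- exact: (measurableT_comp mS mac).
- exact: (measurableT_comp mT mbr).
- move=> p p0; split.
    have mag : measurable_fun setT (a \o act (on_rows p) : Tc -> bitseqs).
      exact: (measurableT_comp mac (measurable_act_rows p)).
    have mag' := measurable_of_invariant mag.
    have m2 : measurable_fun setT ((fun r => (a r, a (act (on_rows p) r))) : Tc -> (bitseqs * bitseqs)%type).
      exact: measurable_fun_pair.
    apply: (votes_invariant mPsi ma mag' mC mB (mp_independent (measurable_of_invariant m2) mb m2 mbr)).
    apply: filterS2 hPsi (mp_ae (mp_act hinv (on_rows p)) hPsi) => r e1 e2.
    rewrite -e1 [in RHS](_ : r (0%N, 0%N) = act (on_rows p) r (0%N, 0%N)); last first.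
      by rewrite /act /= p0.
    rewrite [in RHS]e2; congr (Psi (_, _)).
    by rewrite (invariant_fun r mbr measurable_bitseqs1).
  have mbg : measurable_fun setT (b \o act (on_cols p) : Tr -> bitseqs).
    exact: (measurableT_comp mbr (measurable_act_cols p)).
  have mbg' := measurable_of_invariant mbg.
  have m2 : measurable_fun setT ((fun r => (b r, b (act (on_cols p) r))) : Tr -> (bitseqs * bitseqs)%type).
    exact: measurable_fun_pair.
  apply: (votes_invariant mPsit mb mbg' mA mB' (al := law D (measurable_of_invariant m2))).
    by have := mp_comp (mp_independent ma (measurable_of_invariant m2) mac m2) (mp_swap _ _); exact.
  apply: filterS2 hPsi (mp_ae (mp_act hinv (on_cols p)) hPsi) => r e1 e2.
  rewrite /transpose /= -e1 [in RHS](_ : r (0%N, 0%N) = act (on_cols p) r (0%N, 0%N)); last first.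
    by rewrite /act /= p0.
  rewrite [in RHS]e2; congr (Psi (_, _)).
  by rewrite (invariant_fun r mac measurable_bitseqs1).
- by apply: filterS2 hPsi (mp_ae hab hf) => r -> /= ->.
Qed.

End simple_measures.

Section realization.
Context (R : realType) dZ (Z : measurableType dZ).
Variable D : probability (matrices Z) R.
Hypotheses (hinv : invariant_measure D) (herg : ergodic_measure D).
Hypothesis cZ : coded Z.
Hypothesis hsimple : simple_measure D.

Let Tc := @invariant_space _ Z col_perms.
Let Tr := @invariant_space _ Z row_perms.
Let X := measurableTypeR R.

Let swap0 (i : nat) : swap_nat 0 i 0 = i.
Proof. by rewrite /swap_nat eqxx. Qed.

Let swapi (i : nat) : swap_nat 0 i i = 0%N.
Proof. by rewrite /swap_nat eqxx; case: eqP. Qed.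

Let conj_swap (p : finperm) (i : nat) : finperm :=
  finperm_mul (finperm_mul (finperm_swap 0 i) p) (finperm_swap 0 (fperm_inv p i)).

Let conj_swap0 p i : fperm_inv (conj_swap p i) 0%N = 0%N.
Proof. by rewrite /= swap0 swapi. Qed.

Let conj_rows p i (r : matrices Z) : act (on_rows (finperm_swap 0 i)) (act (on_rows p) r) =
  act (on_rows (conj_swap p i)) (act (on_rows (finperm_swap 0 (fperm_inv p i))) r).
Proof. by apply/funext => -[k l]; rewrite /act /= swap_natK. Qed.

Let conj_cols p i (r : matrices Z) : act (on_cols (finperm_swap 0 i)) (act (on_cols p) r) =
  act (on_cols (conj_swap p i)) (act (on_cols (finperm_swap 0 (fperm_inv p i))) r).
Proof. by apply/funext => -[k l]; rewrite /act /= swap_natK. Qed.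

(** [x i] is [xi] after exchanging the rows [0] and [i]. A row permutation
    [p] acts on this sequence as expected because [xi] is insensitive to
    [conj_swap p i], which fixes [0]; column permutations leave it fixed, so
    that the ergodicity of [D] serves as a 0-1 law for the sequence. *)
Lemma simple_realized : exists (mu nu : probability X R)
    (P Q : probability (power nat X) R) (f : X * X -> Z) (xi eta : matrices Z -> X),
  [/\ is_power_measure mu P, is_power_measure nu Q,
      [/\ measurable_fun setT f, measurable_fun setT xi & measurable_fun setT eta],
      measure_preserving (P \x Q)%E D (sampled f) &
      {ae (P \x Q)%E, forall w : power nat X * power nat X, xi (sampled f w) = w.1 0%N} /\
      {ae (P \x Q)%E, forall w : power nat X * power nat X, eta (sampled f w) = w.2 0%N}].
Proof.
have [xi0 [eta0 [f0 [mxi0 meta0 mf0 hfix hf0]]]] := simple_representation hinv herg cZ hsimple.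
have menc := @measurable_encode R; have mdec := @measurable_decode R.
pose xi : matrices Z -> X := @ternary_encode R \o xi0.
pose eta : matrices Z -> X := @ternary_encode R \o eta0.
have mxic : measurable_fun setT (xi : Tc -> X) by exact: (measurableT_comp menc mxi0).
have metar : measurable_fun setT (eta : Tr -> X) by exact: (measurableT_comp menc meta0).
have mxi := measurable_of_invariant mxic; have meta := measurable_of_invariant metar.
pose f (p : X * X) : Z := f0 (ternary_decode p.1, ternary_decode p.2).
have mf : measurable_fun setT f.
  apply: (measurableT_comp mf0); apply: measurable_fun_pair.
    exact: (measurableT_comp mdec measurable_fst).
  exact: (measurableT_comp mdec measurable_snd).
have hf : {ae D, forall r : matrices Z, r (0%N, 0%N) = f (xi r, eta r)}.
  by apply: filterS hf0 => r ->; rewrite /f /xi /eta /= !encodeK.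
have xi_col q r : xi (act (on_cols q) r) = xi r.
  by rewrite /xi /= (invariant_fun r mxi0 measurable_bitseqs1).
have eta_row q r : eta (act (on_rows q) r) = eta r.
  by rewrite /eta /= (invariant_fun r meta0 measurable_bitseqs1).
pose x i (r : matrices Z) : X := xi (act (on_rows (finperm_swap 0 i)) r).
pose y j (r : matrices Z) : X := eta (act (on_cols (finperm_swap 0 j)) r).
have mxc i : measurable_fun setT (x i : Tc -> X).
  exact: (measurableT_comp mxic (measurable_act_rows _)).
have myr j : measurable_fun setT (y j : Tr -> X).
  exact: (measurableT_comp metar (measurable_act_cols _)).
have mx i := measurable_of_invariant (mxc i); have my j := measurable_of_invariant (myr j).
have mxxc : measurable_fun setT ((fun r => x ^~ r) : Tc -> power nat X).
  exact: measurable_fun_power.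
have myyr : measurable_fun setT ((fun r => y ^~ r) : Tr -> power nat X).
  exact: measurable_fun_power.
have mxx := measurable_of_invariant mxxc; have myy := measurable_of_invariant myyr.
have hx p i : {ae D, forall r, x i (act (on_rows p) r) = x (fperm_inv p i) r}.
  have h := (hfix (conj_swap p i) (conj_swap0 p i)).1.
  apply: filterS (mp_ae (mp_act hinv (on_rows (finperm_swap 0 (fperm_inv p i)))) h) => r e.
  by rewrite /x conj_rows /xi /= e.
have hy p i : {ae D, forall r, y i (act (on_cols p) r) = y (fperm_inv p i) r}.
  have h := (hfix (conj_swap p i) (conj_swap0 p i)).2.
  apply: filterS (mp_ae (mp_act hinv (on_cols (finperm_swap 0 (fperm_inv p i)))) h) => r e.
  by rewrite /y conj_cols /eta /= e.
have x_col q i r : x i (act (on_cols q) r) = x i r.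
  by rewrite /x act_row_col// xi_col.
have y_row q i r : y i (act (on_rows q) r) = y i r.
  by rewrite /y act_col_row// eta_row.
have hP : is_power_measure (law D (mx 0)) (law D mxx).
  apply: (@exchangeable_iid _ _ _ D _ _ x (fun p => act (on_rows p)) mx _ hx).
    by move=> p; exact: mp_act.
  move=> g bg gt gx; apply: ae_invariant_const => // q; apply: aeW => r.
  by apply: gx => i; exact: x_col.
have hQ : is_power_measure (law D (my 0)) (law D myy).
  apply: (@exchangeable_iid _ _ _ D _ _ y (fun p => act (on_cols p)) my _ hy).
    by move=> p; exact: mp_act.
  move=> g bg gt gy; apply: ae_invariant_const => // q; apply: aeW => r.
  by apply: gy => i; exact: y_row.
have hPQ : measure_preserving D (law D mxx \x law D myy)%E (fun r => (x ^~ r, y ^~ r)).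
  exact: (mp_independent hinv herg).
have hF : {ae D, forall r, sampled f (x ^~ r, y ^~ r) = r}.
  have : {ae D, forall r, forall i j, f (x i r, y j r) = r (i, j)}.
    apply/ae_foralln => i; apply/ae_foralln => j.
    pose g : perm2 := (finperm_swap 0 i, finperm_swap 0 j).
    apply: filterS (mp_ae (mp_act hinv g) hf) => r e.
    have -> : r (i, j) = act g r (0%N, 0%N) by rewrite /act /= !swap0.
    rewrite e; congr (f (_, _)); rewrite act_split; apply: esym.
      exact: x_col.
    exact: eta_row.
  by apply: filterS => r h; apply/funext => -[i j]; exact: h.
have x0 r : x 0%N r = xi r.
  by rewrite /x; congr xi; apply/funext => -[i j]; rewrite /act /= /swap_nat; case: eqP => // ->.
have y0 r : y 0%N r = eta r.
  by rewrite /y; congr eta; apply/funext => -[i j]; rewrite /act /= /swap_nat; case: eqP => // ->.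
have cX : coded X := standard_borel_coded (standard_borel_real R).
have msf := measurable_sampled mf.
exists (law D (mx 0)), (law D (my 0)), (law D mxx), (law D myy), f, xi, eta; split => //.
- split => // B mB; rewrite -[LHS](hPQ.2 _ (preimT msf mB)).
  apply: prob_ae_eq => //.
    by apply: (preimT hPQ.1); exact: preimT.
  by apply: filterS hF => r e; rewrite /preimage /= e.
- split.
    apply: (mp_aeP _ hPQ).
      apply: (measurable_eq cX); first exact: (measurableT_comp mxi msf).
      exact: (measurableT_comp (measurable_coord 0) measurable_fst).
    by apply: filterS hF => r e /=; rewrite e x0.
  apply: (mp_aeP _ hPQ).
    apply: (measurable_eq cX); first exact: (measurableT_comp meta msf).
    exact: (measurableT_comp (measurable_coord 0) measurable_snd).
  by apply: filterS hF => r e /=; rewrite e y0.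
Qed.

End realization.

(** * Recovering the points of a pure function *)

Section canonical_model.
Context (R : realType) d (X : measurableType d) d' (Y : measurableType d')
  dZ (Z : measurableType dZ).
Variables (mu : probability X R) (nu : probability Y R) (f : X * Y -> Z).
Hypothesis mf : measurable_fun setT f.
Variables (C : nat -> set Y) (B : nat -> set Z).
Hypotheses (mC : forall i, measurable (C i)) (mB : forall i, measurable (B i)).
Let S := votes nu f C B.
Hypothesis mS : measurable_fun setT S.
Variables (T : Y -> bitseqs) (mT : measurable_fun setT T) (f2 : bitseqs * bitseqs -> Z).
Hypothesis mf2 : measurable_fun setT f2.
Hypothesis hf2 : {ae (mu \x nu)%E, forall p, f2 (S p.1, T p.2) = f p}.
Variables (S1 : X -> bitseqs) (T1 : Y -> bitseqs) (S1' : bitseqs -> X).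
Hypothesis hS1 : measure_preserving mu (law mu mS) S1.
Hypothesis hT1 : measure_preserving nu (law nu mT) T1.
Hypothesis hS1' : {ae mu, forall x, S1' (S1 x) = x}.
Hypothesis hf1 : {ae (mu \x nu)%E, forall p, f2 (S1 p.1, T1 p.2) = f p}.

(** Conditioning the indicator of [C i] on [T] turns the votes that define the
    factor into integrals over the factor, which any other realization of the
    factor shares. *)
Lemma integrals_determine_point : exists (v : nat -> Y -> R) (k : nat -> R),
  [/\ forall i, measurable_fun setT (v i), forall i y, 0 <= v i y <= 1 &
      {ae mu, forall x, S1' (bits (fun i =>
        [set x | k i < mean nu (fun y => v i y * \1_(B i) (f (x, y)))]) x) = x}].
Proof.
pose mu' := law mu mS; pose nu' := law nu mT.
have /choice[v' hv'] : forall i, exists g : bitseqs -> R, [/\ measurable_fun setT g,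
    forall x, 0 <= g x <= 1 & forall A, measurable A ->
      nu (C i `&` T @^-1` A) = (mean nu' (fun x => g x * \1_A x))%:E].
  by move=> i; exact: (conditional_probability (mp_law nu mT) (mC i)).
pose k i : R := fine (nu (C i)) / 2.
pose U i (s : bitseqs) : R := mean nu' (fun t => v' i t * \1_(B i) (f2 (s, t))).
have mf2s s : measurable_fun setT (fun t => f2 (s, t)).
  exact: (measurableT_comp mf2 (measurable_fun_pair (measurable_cst s) (@measurable_id _ _ _))).
have mfx x : measurable_fun setT (fun y => f (x, y)).
  exact: (measurableT_comp mf (measurable_fun_pair (measurable_cst x) (@measurable_id _ _ _))).
have mv i : measurable_fun setT (v' i) by have [] := hv' i.
have v01 i t : 0 <= v' i t <= 1 by have [] := hv' i.
have UE i s : nu (C i `&` [set y | B i (f2 (s, T y))]) = (U i s)%:E.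
  have [_ _ h] := hv' i.
  rewrite -[LHS]/(nu (C i `&` T @^-1` [set t | B i (f2 (s, t))])) h; last exact: (preimT (mf2s s)).
  congr (_%:E); congr mean; apply/funext => t; congr (_ * _); rewrite !indicE.
have bU i s : bdm (fun t => v' i t * \1_(B i) (f2 (s, t))).
  apply: bdmM; first exact: bdm01.
  exact: (bdm_comp (mf2s s) (bdm_indic _ (mB i))).
have mU i : measurable_fun setT (U i).
  apply: (@measurable_mean_section _ _ bitseqs _ bitseqs nu'
    (fun p => v' i p.2 * \1_(B i) (f2 p))).
    apply: measurable_funM; first exact: (measurableT_comp (mv i) measurable_snd).
    by apply: (measurableT_comp _ mf2); exact: measurable_indic.
  by move=> p; rewrite mulr_ge0//; have /andP[] := v01 i p.2.
pose Th := bits (fun i => [set s | k i < U i s]).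
have mTh : measurable_fun setT Th.
  apply: measurable_bits => i; rewrite (_ : [set s | _] = U i @^-1` `]k i, +oo[).
    by apply: (preimT (mU i)).
  by apply/seteqP; split => x /=; rewrite in_itv/= andbT.
have hS : {ae mu, forall x, Th (S x) = S x}.
  apply: filterS (ae_prodE hf2) => x hx; apply/funext => i.
  rewrite /Th /S /votes /bits; congr (`[< _ >]); apply/propext => /=.
  rewrite (_ : nu [set y | C i y /\ B i (f (x, y))] = (U i (S x))%:E).
    by rewrite -[nu (C i)]fineK ?pr_fin// -EFinM lte_fin /k; split; lra.
  rewrite -UE; apply: prob_ae_eq.
  - by apply: measurableI => //; exact: (preimT (mfx x)).
  - by apply: measurableI => //; exact: (preimT (measurableT_comp (mf2s (S x)) mT)).
  - by apply: filterS hx => y /= e; rewrite /setI /= e.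
have hTh : {ae mu', forall s, Th s = s}.
  apply: (mp_aeP _ (mp_law mu mS) hS).
  by apply: (measurable_eq coded_bitseqs) => //; exact: measurable_id.
exists (fun i => v' i \o T1), k; split.
- by move=> i; exact: (measurableT_comp (mv i) hT1.1).
- by move=> i y; exact: v01.
apply: filterS3 (mp_ae hS1 hTh) hS1' (ae_prodE hf1) => x e1 e2 e3.
rewrite -[RHS]e2 -[in RHS]e1; congr S1'; apply/funext => i.
rewrite /Th /bits; congr (`[< _ < _ >]).
rewrite -[RHS](mean_mp hT1 (bU i (S1 x))); apply: mean_ae_eq.
- apply: bdmM; first by apply: (bdm_comp hT1.1); exact: bdm01.
  exact: (bdm_comp (mfx x) (bdm_indic _ (mB i))).
- exact: (bdm_comp hT1.1 (bU i (S1 x))).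
- by apply: filterS e3 => y /= ->.
Qed.

End canonical_model.

Section recover_point.
Context (R : realType) d (X : measurableType d) d' (Y : measurableType d')
  dZ (Z : measurableType dZ).
Variables (mu : probability X R) (nu : probability Y R) (f : X * Y -> Z).
Hypothesis mf : measurable_fun setT f.
Hypothesis cX : coded X.
Variables (Q : probability (power nat Y) R).
Hypothesis hQ : is_power_measure nu Q.

Lemma measurable_row : measurable_fun setT
  (fun w : X * power nat Y => (fun l => f (w.1, w.2 l)) : power nat Z).
Proof.
apply: measurable_fun_power => l; apply: (measurableT_comp mf).
apply: measurable_fun_pair; first exact: measurable_fst.
exact: (measurableT_comp (measurable_coord l) measurable_snd).
Qed.

(** The integrals are limits of the averages of [v i (y_l) * \1_(B i) (f (x,
    y_l))] over [l], which only involve the points [y_l] and the values [f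
    (x, y_l)]. *)
Lemma point_from_averages (v : nat -> Y -> R) (k : nat -> R) (B : nat -> set Z) (r : bitseqs -> X) :
  (forall i, measurable_fun setT (v i)) -> (forall i y, 0 <= v i y <= 1) ->
  (forall i, measurable (B i)) -> measurable_fun setT r ->
  {ae mu, forall x, r (bits (fun i =>
     [set x | k i < mean nu (fun y => v i y * \1_(B i) (f (x, y)))]) x) = x} ->
  exists zeta : power nat Y * power nat Z -> X, measurable_fun setT zeta /\
    {ae (mu \x Q)%E, forall w : X * power nat Y,
      zeta (w.2, fun l => f (w.1, w.2 l)) = w.1}.
Proof.
move=> mv v01 mB mr hr.
pose h i l (p : power nat Y * power nat Z) : R := v i (p.1 l) * \1_(B i) (p.2 l).
have h01 i l p : 0 <= h i l p <= 1.
  by apply: mul01; [exact: v01 | exact: indic01].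
have mh i l : measurable_fun setT (h i l).
  apply: measurable_funM.
    apply: (measurableT_comp (mv i)).
    exact: (measurableT_comp (measurable_coord l) measurable_fst).
  have m2 : measurable_fun setT (fun p : power nat Y * power nat Z => p.2 l).
    exact: (measurableT_comp (measurable_coord l) measurable_snd).
  by apply: (measurableT_comp _ m2); exact: measurable_indic.
have ml i := measurable_limsup_avg (mh i) (h01 i).
pose E i := [set p | k i < limn_sup (avg (h i) ^~ p)].
have mE i : measurable (E i).
  rewrite (_ : E i = (fun p => limn_sup (avg (h i) ^~ p)) @^-1` `]k i, +oo[).
    exact: (preimT (ml i)).
  by apply/seteqP; split => x /=; rewrite in_itv/= andbT.
pose zeta p := r (bits E p).
have mz : measurable_fun setT zeta by apply: (measurableT_comp mr); exact: measurable_bits.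
exists zeta; split => //; apply: ae_prodI.
  apply: (measurable_eq cX); last exact: measurable_fst.
  apply: (measurableT_comp mz).
  by apply: measurable_fun_pair; [exact: measurable_snd | exact: measurable_row].
apply: filterS hr => x hx /=.
have mfx : measurable_fun setT (fun y => f (x, y)).
  exact: (measurableT_comp mf (measurable_fun_pair (measurable_cst x) (@measurable_id _ _ _))).
have : {ae Q, forall y : power nat Y, forall i,
    limn_sup (avg (h i) ^~ (y, fun l => f (x, y l))) =
      mean nu (fun y => v i y * \1_(B i) (f (x, y)))}.
  apply/ae_foralln => i.
  have mg : measurable_fun setT (fun y => v i y * \1_(B i) (f (x, y))).
    by apply: measurable_funM => //; apply: (measurableT_comp _ mfx); exact: measurable_indic.
  have g01 y : 0 <= v i y * \1_(B i) (f (x, y)) <= 1.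
    by apply: mul01; [exact: v01 | exact: indic01].
  apply: filterS (law_of_large_numbers hQ mg g01) => y hy.
  have := (cvg_limn_inf_sup hy).2; apply: etrans; congr limn_sup.
apply: filterS => y hy; rewrite -[RHS]hx /zeta; congr r; apply/funext => i.
by rewrite /bits /E /= hy.
Qed.

End recover_point.

Section decoding.
Context (R : realType) d (X : measurableType d).
Let U := measurableTypeR R.

(** Purity speaks of factors on standard Borel spaces, here on the real
    line; this brings the isomorphism back to bit sequences. *)
Lemma decoded_isomorphism (mu : probability X R) (S : X -> bitseqs)
    (mS : measurable_fun setT S)
    (meS : measurable_fun setT (@ternary_encode R \o S : X -> U))
    (S1 : X -> U) (S1' : U -> X) :
  measure_preserving mu (law mu meS) S1 ->
  {ae mu, forall x, S1' (S1 x) = x} ->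
  measure_preserving mu (law mu mS) (@ternary_decode R \o S1) /\
  {ae mu, forall x, S1' (ternary_encode R (ternary_decode (S1 x))) = x}.
Proof.
move=> hS1 hS1'; have mdec := @measurable_decode R; have menc := @measurable_encode R.
split.
  apply: (mp_comp hS1); split => // A mA; rewrite -[LHS]/(mu _) -[RHS]/(mu _).
  by congr (mu _); apply/seteqP; split => x; rewrite /preimage /= encodeK.
have cU : coded U := standard_borel_coded (standard_borel_real R).
have h : {ae law mu meS, forall s : U, ternary_encode R (ternary_decode s) = s}.
  apply: (mp_aeP _ (mp_law mu meS)).
    apply: (measurable_eq cU); last exact: measurable_id.
    exact: (measurableT_comp menc mdec).
  by apply: aeW => x; rewrite /= encodeK.
by apply: filterS2 (mp_ae hS1 h) hS1' => x -> .
Qed.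

End decoding.

(** Purity makes [f] isomorphic to its canonical factor, and
    [integrals_determine_point] describes the points of the latter; the
    statement about [Y] is the one about [X] for the transpose of [f]. *)
Lemma pure_recover_point (R : realType) d (X : measurableType d) d' (Y : measurableType d')
    dZ (Z : measurableType dZ) (mu : probability X R) (nu : probability Y R) (f : X * Y -> Z)
    (P : probability (power nat X) R) (Q : probability (power nat Y) R) :
  coded X -> coded Y -> coded Z -> measurable_fun setT f ->
  is_power_measure mu P -> is_power_measure nu Q -> pure mu nu f ->
  (exists zeta : power nat Y * power nat Z -> X, measurable_fun setT zeta /\
    {ae (mu \x Q)%E, forall w : X * power nat Y,
      zeta (w.2, fun l => f (w.1, w.2 l)) = w.1}) /\
  (exists zeta : power nat X * power nat Z -> Y, measurable_fun setT zeta /\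
    {ae (nu \x P)%E, forall w : Y * power nat X,
      zeta (w.2, fun l => f (w.2 l, w.1)) = w.1}).
Proof.
move=> cX cY cZ mf hP hQ hpure.
have [C [A [B [B' [f2 [mC mA [mB mB'] mf2 hf2]]]]]] := canonical_factor mu nu mf cY cZ.
have mtf := measurable_transpose mf.
set S := votes nu f C B in hf2; set T := votes mu (transpose f) A B' in hf2.
have mS : measurable_fun setT S by exact: measurable_votes.
have mT : measurable_fun setT T by exact: measurable_votes.
have menc := @measurable_encode R; have mdec := @measurable_decode R.
pose U := measurableTypeR R.
have meS : measurable_fun setT (@ternary_encode R \o S : X -> U) by exact: (measurableT_comp menc mS).
have meT : measurable_fun setT (@ternary_encode R \o T : Y -> U) by exact: (measurableT_comp menc mT).
pose f' (p : U * U) : Z := f2 (ternary_decode p.1, ternary_decode p.2).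
have mf' : measurable_fun setT f'.
  apply: (measurableT_comp mf2); apply: measurable_fun_pair.
    exact: (measurableT_comp mdec measurable_fst).
  exact: (measurableT_comp mdec measurable_snd).
have : is_factor mu nu f (law mu meS) (law nu meT) f'.
  exists (@ternary_encode R \o S), (@ternary_encode R \o T); split; try exact: mp_law.
  by apply: filterS hf2 => p; rewrite /f' /= !encodeK.
move=> /(hpure _ U _ U _ _ _ (standard_borel_real R) (standard_borel_real R) mf').
move=> [S1 [T1 [[hS1 [S1' [hS1' S1'K _]]] [hT1 [T1' [hT1' T1'K _]]] hf1]]].
have [hS2 S2K] := decoded_isomorphism mS hS1 S1'K.
have [hT2 T2K] := decoded_isomorphism mT hT1 T1'K.
have mS2' : measurable_fun setT (S1' \o @ternary_encode R) by exact: (measurableT_comp hS1'.1 menc).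
have mT2' : measurable_fun setT (T1' \o @ternary_encode R) by exact: (measurableT_comp hT1'.1 menc).
split.
  have [v [k [mv v01 h]]] := integrals_determine_point mf mC mB mf2 hf2
    (S1' := S1' \o @ternary_encode R) hS2 hT2 S2K hf1.
  exact: (point_from_averages mf cX hQ mv v01 mB mS2' h).
have [v [k [mv v01 h]]] := integrals_determine_point mtf mA mB'
  (measurable_transpose mf2) (ae_swap hf2) (S1' := T1' \o @ternary_encode R) hT2 hS2 T2K (ae_swap hf1).
exact: (point_from_averages mtf cY hP mv v01 mB' mT2' h).
Qed.

(** * Noise outsourcing and relative couplings *)

Section noise.
Context (R : realType).
Let U := measurableTypeR R.

(** The union of finitely many sets of an almost nested family is almost
    equal to the largest of them; continuity from below does the rest. Only
    almost everywhere nesting is available where this is applied, to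
    conditional distribution functions. *)
Lemma nested_union d (T : measurableType d) d' (T' : measurableType d')
    (P : probability T R) (Q : probability T' R) (V : nat -> set T) (E : nat -> set T') :
  (forall i, measurable (V i)) -> (forall i, measurable (E i)) ->
  (forall i, P (V i) = Q (E i)) ->
  (forall i j, ({ae P, forall x, V i x -> V j x} /\ {ae Q, forall x, E i x -> E j x}) \/
               ({ae P, forall x, V j x -> V i x} /\ {ae Q, forall x, E j x -> E i x})) ->
  P (\bigcup_i V i) = Q (\bigcup_i E i).
Proof.
move=> mV mE VE tot.
have max n : exists j, {ae P, forall x, (exists2 i, (i <= n)%N & V i x) <-> V j x} /\
    {ae Q, forall x, (exists2 i, (i <= n)%N & E i x) <-> E j x}.
  elim: n => [|n [j [Pj Qj]]].
    exists 0%N; split; apply: aeW => x; split; try by exists 0%N.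
      by move=> [i]; rewrite leqn0 => /eqP ->.
    by move=> [i]; rewrite leqn0 => /eqP ->.
  have step (F : nat -> Prop) (m k : nat) : ((exists2 i, (i <= n)%N & F i) <-> F j) ->
      (k = n.+1 /\ (F j -> F n.+1) \/ k = j /\ (F n.+1 -> F j)) ->
      (exists2 i, (i <= n.+1)%N & F i) <-> F k.
    move=> Fj h; split.
      move=> [i]; rewrite leq_eqVlt => /predU1P[->|il] Fi.
        by case: h => [[-> _]|[-> h]] //; exact: h.
      have Fj' : F j by apply/Fj; exists i.
      by case: h => [[-> h]|[-> _]] //; exact: h.
    case: h => [[-> _]|[-> _]] Fk; first by exists n.+1.
    by have [i il Fi] := Fj.2 Fk; exists i => //; exact: ltnW.
  case: (tot j n.+1) => -[h1 h2].
    exists n.+1; split.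
      by apply: filterS2 Pj h1 => x a b; apply: (step (V ^~ x) n) => //; left.
    by apply: filterS2 Qj h2 => x a b; apply: (step (E ^~ x) n) => //; left.
  exists j; split.
    by apply: filterS2 Pj h1 => x a b; apply: (step (V ^~ x) n) => //; right.
  by apply: filterS2 Qj h2 => x a b; apply: (step (E ^~ x) n) => //; right.
have bound d0 (S : measurableType d0) (N : probability S R) (A : nat -> set S) :
    (forall i, measurable (A i)) ->
    (fun n => N [set x | exists2 i, (i <= n)%N & A i x]) @ \oo --> N (\bigcup_i A i).
  move=> mA.
  have -> : \bigcup_i A i = \bigcup_n [set x | exists2 i, (i <= n)%N & A i x].
    apply/seteqP; split => x; first by move=> [i _ Ai]; exists i => //; exists i.
    by move=> [n _ [i _ Ai]]; exists i.
  have mB n : measurable [set x | exists2 i, (i <= n)%N & A i x].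
    rewrite (_ : [set x | _] = \bigcup_(i in [set i | (i <= n)%N]) A i).
      by apply: bigcup_measurable.
    by apply/seteqP; split => x [i il Ai]; exists i.
  apply: nondecreasing_cvg_mu => //; first exact: bigcupT_measurable.
  move=> n m nm; apply/subsetPset => x [i il Ai]; exists i => //; exact: leq_trans nm.
have mB d0 (S : measurableType d0) (A : nat -> set S) n : (forall i, measurable (A i)) ->
    measurable [set x | exists2 i, (i <= n)%N & A i x].
  move=> mA; rewrite (_ : [set x | _] = \bigcup_(i in [set i | (i <= n)%N]) A i).
    by apply: bigcup_measurable.
  by apply/seteqP; split => x [i il Ai]; exists i.
have eqn : (fun n => P [set x | exists2 i, (i <= n)%N & V i x]) =
    (fun n => Q [set x | exists2 i, (i <= n)%N & E i x]).
  apply/funext => n; have [j [Pj Qj]] := max n.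
  rewrite (prob_ae_eq (mB _ _ V n mV) (mV j) Pj) (prob_ae_eq (mB _ _ E n mE) (mE j) Qj).
  exact: VE.
have c1 := bound _ _ P V mV; rewrite eqn in c1; have c2 := bound _ _ Q E mE.
exact: (cvg_unique _ c1 c2).
Qed.

Definition uniform_noise : probability U R := uniform_prob (@ltr01 R).

Lemma uniform_noise_le (a : R) : 0 <= a <= 1 ->
  uniform_noise [set u : U | u <= a] = a%:E.
Proof.
move=> /andP[a0 a1]; rewrite /uniform_noise /= /uniform_prob integral_uniform_pdf.
rewrite (_ : _ `&` _ = `[0, a]%classic); last first.
  apply/seteqP; split => x /=; rewrite !in_itv /=; first by move=> [xa /andP[-> _]].
  by move=> /andP[x0 xa]; rewrite x0 xa (le_trans xa a1).
rewrite (eq_integral (fun=> 1%E)); last first.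
  move=> x; rewrite inE /= in_itv /= /uniform_pdf => /andP[x0 xa].
  by rewrite x0 (le_trans xa a1) subr0 invr1.
rewrite integral_cst//= lebesgue_measure_itv/= mul1e lte_fin sube0.
by case: ltgtP a0 => // <-.
Qed.

Lemma law_real_pair d (M : measurableType d) (P Q : probability (M * U)%type R) :
  (forall A t, measurable A -> P [set p : M * U | A p.1 /\ p.2 < t] = Q [set p : M * U | A p.1 /\ p.2 < t]) ->
  forall H, measurable H -> P H = Q H.
Proof.
move=> PQ.
pose G := [set H : set (M * U) | exists A t, measurable A /\ H = [set p | A p.1 /\ p.2 < t]].
apply: (@probability_eq _ _ _ G).
- move=> _ _ [A [s [mA ->]]] [B [t [mB ->]]].
  exists (A `&` B), (Order.min s t); split; first exact: measurableI.
  apply/seteqP; split => p; rewrite /= lt_min.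
    by move=> [[Ap ps] [Bp pt]]; split=> //; apply/andP.
  by move=> [[Ap Bp] /andP[ps pt]].
- have mltt (t : R) : measurable [set u : U | u < t].
    rewrite (_ : [set u : U | u < t] = `]-oo, t[%classic); first exact: measurable_itv.
    by apply/seteqP; split => x /=; rewrite in_itv.
  apply/seteqP; split; last first.
    apply: smallest_sub; first exact: sigma_algebra_measurable.
    move=> _ [A [t [mA ->]]].
    exact: (measurableI _ _ (preimT (@measurable_fst _ _ M U) mA) (preimT (@measurable_snd _ _ M U) (mltt t))).
  pose T' := g_sigma_algebraType G.
  have m1 : measurable_fun setT (fst : T' -> M).
    move=> _ A mA; rewrite setTI.
    rewrite (_ : _ @^-1` _ = \bigcup_n [set p : T' | A p.1 /\ p.2 < n%:R]).
      apply: bigcupT_measurable => n; apply: sub_sigma_algebra.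
      by exists A, n%:R.
    apply/seteqP; split => -[m u] /=; last by move=> [n _ []].
    by move=> Am; exists (Num.truncn u).+1 => //=; split=> //; exact: truncnS_gt.
  have m2 : measurable_fun setT (snd : T' -> U).
    apply: (measurability _ (RGenInftyO.measurableE R)) => //.
    move=> _ [_ [t ->] <-]; apply: sub_sigma_algebra; exists setT, t; split; first exact: measurableT.
    by rewrite setTI; apply/funext => p; apply/propext; rewrite /= in_itv /=; split => [|[]].
  have m : measurable_fun setT (fun p : T' => (p.1, p.2) : M * U) by exact: measurable_fun_pair.
  move=> H mH; have := preimT m mH; congr measurable; apply/seteqP; split => -[] //.
- by move=> _ [A [t [mA ->]]]; exact: PQ.
Qed.

Lemma infs_lt (u : nat -> R) b t : (forall n, b <= u n) ->
  (infs u 0%N < t) <-> exists n, u n < t.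
Proof.
move=> hb; have lb : has_lbound (sdrop u 0%N) by exists b => _ [n _ <-].
split.
  move=> it; have hi : has_inf (sdrop u 0%N) by split => //; exists (u 0%N), 0%N.
  have e0 : 0 < t - infs u 0%N by rewrite subr_gt0.
  have [_ [n _ <-] hn] := inf_adherent e0 hi.
  by exists n; move: hn; rewrite addrC subrK.
by move=> [n unt]; apply: (le_lt_trans _ unt); apply: ge_inf => //; exists n.
Qed.

Lemma conditional_probability_le d (M : measurableType d) (D : probability M R) (f g : M -> R) :
  bdm f -> bdm g ->
  (forall A, measurable A -> mean D (fun x => f x * \1_A x) <= mean D (fun x => g x * \1_A x)) ->
  {ae D, forall x, f x <= g x}.
Proof.
move=> bf bg h; pose A := [set x | g x < f x].
have mA : measurable A.
  have := measurable_fun_ltr bg.1 bf.1 => /(_ measurableT [set true]).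
  by rewrite setTI; apply.
have b1 : bdm (fun x => f x * \1_A x) by apply: bdmM => //; exact: bdm_indic.
have b2 : bdm (fun x => g x * \1_A x) by apply: bdmM => //; exact: bdm_indic.
have b3 := bdmB b1 b2.
have n0 x : 0 <= f x * \1_A x - g x * \1_A x.
  rewrite -mulrBl indicE; case: (boolP (x \in A)) => xA; last by rewrite mulr0.
  by rewrite mulr1; move: xA; rewrite inE => /= ?; rewrite subr_ge0 ltW.
have m0 : mean D (fun x => f x * \1_A x - g x * \1_A x) = 0.
  apply/le_anti/andP; split; first by rewrite meanB// subr_le0 h.
  by rewrite -(mean_cst D 0); apply: mean_le => //; exact: bdm_cst.
apply: filterS (ae_eq0_mean b3 (aeW _ n0) m0) => x; rewrite -mulrBl indicE => e.
rewrite leNgt; apply/negP => gf; move: e.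
by rewrite (mem_set (gf : A x)) mulr1 => /eqP; rewrite subr_eq0 gt_eqF.
Qed.

Lemma prod_subgraph d (M : measurableType d) (D : probability M R) (g : M -> R) (A : set M) :
  measurable_fun setT g -> (forall m, 0 <= g m <= 1) -> measurable A ->
  measurable [set p : M * U | A p.1 /\ p.2 <= g p.1] /\
  (D \x uniform_noise)%E [set p : M * U | A p.1 /\ p.2 <= g p.1] =
    (mean D (fun m => g m * \1_A m))%:E.
Proof.
move=> mg g01 mA.
have mV : measurable [set p : M * U | A p.1 /\ p.2 <= g p.1].
  apply: measurableI; first exact: (preimT (@measurable_fst _ _ M U) mA).
  have m1 : measurable_fun setT (fun p : M * U => g p.1).
    exact: (measurableT_comp mg (@measurable_fst _ _ M U)).
  have m2 : measurable_fun setT (fun p : M * U => p.2 : R) by exact: measurable_snd.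
  have := measurable_fun_ler m2 m1 => /(_ measurableT [set true]).
  by rewrite setTI; apply.
split=> //; rewrite prod_fubini// -meanE; last first.
  by apply: bdmM; [exact: bdm01|exact: bdm_indic].
apply: eq_integral => m _; rewrite indicE /=.
have [Am|nAm] := pselect (A m).
  rewrite (mem_set Am) mulr1 -uniform_noise_le//.
  by congr (_ _); apply/seteqP; split => u /=; [case|split].
rewrite (memNset nAm) mulr0.
rewrite (_ : [set y | _] = set0) ?measure0//.
by apply/seteqP; split => u //= -[].
Qed.

(** The inverse of the conditional distribution function. In a real
    coordinate [e] of [W], let [G n] be the conditional probability given
    [F] that [e] is at most the rational [q n]; applied to an independent
    uniform [u], the infimum of the [q n] with [u <= G n] has the
    conditional law of [e]. The events that it is less than [t] are unions
    over the [q n < t] of sets [u <= G n], to which [nested_union] applies. *)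
Lemma noise_outsourcing d (W : measurableType d) d' (M : measurableType d')
    (pi : probability W R) (D : probability M R) (F : W -> M) :
  coded W -> measure_preserving pi D F ->
  exists theta : M * U -> W, measurable_fun setT theta /\
    forall H : set (M * W), measurable H ->
      (D \x uniform_noise)%E [set p | H (p.1, theta p)] = pi [set w | H (F w, w)].
Proof.
move=> [c [r [mc mr cr]]] hF; have [mF _] := hF.
have menc := @measurable_encode R; have mdec := @measurable_decode R.
pose e w : R := ternary_encode R (c w).
have me : measurable_fun setT e by exact: (measurableT_comp menc mc).
have e01 w : 0 <= e w <= 1 by exact: encode_bounds.
pose q n : R := Order.max 0 (if @unpickle rat n is Some q then ratr q else 0).
have q0 n : 0 <= q n by rewrite le_max lexx.
have qdense w t : e w < t -> exists n, e w <= q n /\ q n < t.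
  move=> /rat_in_itvoo[x]; rewrite in_itv /= => /andP[ex xt].
  exists (pickle x); rewrite /q pickleK max_r; first by split => //; exact: ltW.
  by apply: ltW; apply: le_lt_trans ex; have /andP[] := e01 w.
pose L n := [set w | e w <= q n].
have mL n : measurable (L n).
  rewrite (_ : L n = e @^-1` `]-oo, q n]); first by apply: (preimT me).
  by apply/seteqP; split => w; rewrite /= in_itv.
have /choice[G hG] n := conditional_probability hF (mL n).
have mG n : measurable_fun setT (G n) by have [] := hG n.
have G01 n m : 0 <= G n m <= 1 by have [] := hG n.
have GE n A : measurable A -> pi (L n `&` F @^-1` A) = (mean D (fun x => G n x * \1_A x))%:E.
  by have [_ _] := hG n; apply.
have Gle i j : q i <= q j -> {ae D, forall m, G i m <= G j m}.
  move=> qij; apply: conditional_probability_le; try exact: bdm01.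
  move=> A mA; rewrite -lee_fin -!GE//; apply: pr_le.
  - by apply: measurableI => //; exact: preimT.
  - by apply: measurableI => //; exact: preimT.
  - by move=> w [Lw Aw]; split => //; exact: le_trans qij.
pose V n := [set p : M * U | setT p.1 /\ p.2 <= G n p.1].
have mV n : measurable (V n) by have [] := prod_subgraph D (mG n) (G01 n) measurableT.
(* The coordinate [e] is at most [1]: the value [2] stands for no bound on [e]. *)
pose h n (p : M * U) : R := 2 + (q n - 2) * \1_(V n) p.
have mh n : measurable_fun setT (h n).
  apply: measurable_funD; first exact: measurable_cst.
  apply: measurable_funM; first exact: measurable_cst.
  exact: measurable_indic.
have hE n p : h n p = if p \in V n then q n else 2.
  by rewrite /h indicE; case: (p \in V n); rewrite /= ?mulr1 ?mulr0 ?addr0// addrC subrK.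
have h0 n p : 0 <= h n p by rewrite hE; case: ifP.
pose theta0 (p : M * U) : U := infs (h ^~ p) 0%N.
have mt0 : measurable_fun setT theta0.
  apply: (measurable_fun_infs (h := h)) => // p _.
  by exists 0 => _ [n _ <-].
have mpair1 : measurable_fun setT (fun p : M * U => (p.1, theta0 p)).
  by apply: measurable_fun_pair => //; exact: measurable_fst.
have mpair2 : measurable_fun setT (fun w => (F w, e w : U)) by exact: measurable_fun_pair.
have key A t : measurable A ->
    law (D \x uniform_noise)%E mpair1 [set p : M * U | A p.1 /\ p.2 < t] =
    law pi mpair2 [set p : M * U | A p.1 /\ p.2 < t].
  move=> mA; rewrite -[LHS]/((D \x uniform_noise)%E _) -[RHS]/(pi _).
  have [t2|t2] := ltP 2 t.
    transitivity (D A).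
      rewrite -(mp_fst D uniform_noise).2//; congr (_ _); apply/seteqP; split => p /=; first by case.
      move=> Ap; split => //; apply/(infs_lt _ (h0 ^~ p)); exists (pickle (0 : rat)).
      apply: le_lt_trans t2; rewrite hE; case: ifP => // _.
      by rewrite /q pickleK rmorph0 maxxx.
    rewrite -hF.2//; congr (_ _); apply/seteqP; split => w /=; last by case.
    by move=> Aw; split => //; apply: le_lt_trans t2; have /andP[_ e1] := e01 w; rewrite (le_trans e1)// ler1n.
  pose A' n := [set m | A m /\ q n < t].
  have mA' n : measurable (A' n).
    rewrite /A'; have [qt|qt] := pselect (q n < t).
      by rewrite (_ : [set m | _] = A)//; apply/seteqP; split => m; [case|split].
    by rewrite (_ : [set m | _] = set0)//; apply/seteqP; split => m //= -[_ /qt].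
  pose VV n := [set p : M * U | A' n p.1 /\ p.2 <= G n p.1].
  pose EE n := L n `&` F @^-1` A' n.
  have mVV n : measurable (VV n) by have [] := prod_subgraph D (mG n) (G01 n) (mA' n).
  have mEE n : measurable (EE n) by apply: measurableI => //; exact: preimT.
  have VE n : (D \x uniform_noise)%E (VV n) = pi (EE n).
    by rewrite GE//; have [_] := prod_subgraph D (mG n) (G01 n) (mA' n).
  have tot i j : q i <= q j -> ({ae (D \x uniform_noise)%E, forall x, VV i x -> q j < t -> VV j x} /\
      {ae pi, forall x, EE i x -> q j < t -> EE j x}).
    move=> qij; split; last first.
      by apply: aeW => w [Lw [Aw _]] qt; split => //; exact: le_trans qij.
    apply: filterS (mp_ae (mp_fst D uniform_noise) (Gle _ _ qij)) => p Gp [[Ap _] pG] qt.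
    by split => //; exact: le_trans Gp.
  transitivity ((D \x uniform_noise)%E (\bigcup_n VV n)).
    congr (_ _); apply/seteqP; split => p /=.
      move=> [Ap /(infs_lt _ (h0 ^~ p))[n]]; rewrite hE; case: ifP; last by rewrite ltNge t2.
      by rewrite inE => -[_ pG] qt; exists n.
    move=> [n _ [[Ap qt] pG]]; split => //; apply/(infs_lt _ (h0 ^~ p)); exists n.
    by rewrite hE mem_set.
  transitivity (pi (\bigcup_n EE n)).
    apply: nested_union => // i j.
    have case1 k l : q k <= q l -> q l < t -> ({ae (D \x uniform_noise)%E, forall x, VV k x -> VV l x} /\
      {ae pi, forall x, EE k x -> EE l x}).
      by move=> kl lt; have [h1 h2] := tot _ _ kl; split;
        [apply: filterS h1 => x hx /hx|apply: filterS h2 => x hx /hx]; apply.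
    have case2 k l : ~ q k < t -> ({ae (D \x uniform_noise)%E, forall x, VV k x -> VV l x} /\
      {ae pi, forall x, EE k x -> EE l x}).
      by move=> nk; split; apply: aeW => x; [move=> [[_ /nk]]|move=> [_ [_ /nk]]].
    have [qi|qi] := pselect (q i < t); last by left; exact: case2.
    have [qj|qj] := pselect (q j < t); last by right; exact: case2.
    by have [qij|/ltW qij] := leP (q i) (q j); [left|right]; exact: case1.
  congr (_ _); apply/seteqP; split => w /=.
    by move=> [n _ [Lw [Aw qt]]]; split => //; exact: le_lt_trans qt.
  by move=> [Aw /qdense[n [eq qt]]]; exists n.
exists (r \o @ternary_decode R \o theta0); split.
  exact: (measurableT_comp (measurableT_comp mr mdec) mt0).
move=> H mH; pose H' := [set p : M * U | H (p.1, r (ternary_decode p.2))].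
have mH' : measurable H'.
  have m : measurable_fun setT (fun p : M * U => (p.1, r (ternary_decode p.2))).
    apply: measurable_fun_pair; first exact: measurable_fst.
    apply: (measurableT_comp mr); apply: (measurableT_comp mdec).
    exact: (@measurable_snd _ _ M U).
  exact: (preimT m mH).
have := law_real_pair key mH'; rewrite -[LHS]/((D \x uniform_noise)%E _) => ->.
by rewrite /law /pushforward; congr (pi _); apply/seteqP; split => w; rewrite /H' /= /e encodeK cr.
Qed.

End noise.

Section relative_coupling.
Context (R : realType).
Let U := measurableTypeR R.

Context d (W : measurableType d) d' (M : measurableType d').
Variables (pi : probability W R) (D : probability M R) (F : W -> M).
Hypotheses (cW : coded W) (cM : coded M) (hF : measure_preserving pi D F).

(** The law of [(theta (m, u1), theta (m, u2))] for independent [m], [u1]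
    and [u2], where [theta] comes from [noise_outsourcing]: two points drawn
    from [pi], independently given their common image under [F]. Symmetries
    of [pi] that lift symmetries of [D] preserve it, since they permute the
    conditional laws. A function taking equal values at the two points is a
    function of [m], as one sees by freezing [u2]. *)
Lemma relative_coupling : exists rho : probability (W * W)%type R,
  [/\ measure_preserving rho pi fst, measure_preserving rho pi snd,
      {ae rho, forall p, F p.1 = F p.2},
      forall (g : W -> W) (g' h' : M -> M), measure_preserving pi pi g ->
        measure_preserving D D g' -> measurable_fun setT h' -> cancel g' h' ->
        (forall w, F (g w) = g' (F w)) ->
        measure_preserving rho rho (fun p => (g p.1, g p.2)) &
      forall d0 (V : measurableType d0) (h : W -> V), coded V -> measurable_fun setT h ->
        {ae rho, forall p, h p.1 = h p.2} ->
        exists xi : M -> V, measurable_fun setT xi /\ {ae pi, forall w, xi (F w) = h w}].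
Proof.
have [theta [mt Ht]] := noise_outsourcing cW hF; have [mF _] := hF.
pose lam : probability U R := uniform_noise R.
pose Pr := ((D \x lam) \x lam)%E : probability ((M * U) * U)%type R.
pose w1 (o : (M * U) * U) := theta o.1.
pose w2 (o : (M * U) * U) := theta (o.1.1, o.2).
have mpf : measure_preserving Pr (D \x lam)%E (fun o => (o.1.1, o.2)).
  exact: (mp_prod (mp_fst D lam) (mp_id lam)).
have mpt : measure_preserving (D \x lam)%E pi theta.
  split => // B mB; rewrite (_ : theta @^-1` B = [set p | (setT `*` B) (p.1, theta p)]); last first.
    by apply/seteqP; split => p //= -[].
  rewrite [LHS]Ht; last exact: measurableX.
  by congr (pi _); apply/seteqP; split => p //= -[].
have mp1 : measure_preserving Pr pi w1 := mp_comp (mp_fst _ _) mpt.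
have mp2 : measure_preserving Pr pi w2 := mp_comp mpf mpt.
have mw : measurable_fun setT (fun o => (w1 o, w2 o)).
  by apply: measurable_fun_pair; [exact: mp1.1|exact: mp2.1].
pose rho := law Pr mw.
have mFw : measurable_fun setT (fun w => (F w, w)) by exact: measurable_fun_pair.
have mpJ : measure_preserving (D \x lam)%E (law pi mFw) (fun p => (p.1, theta p)).
  by split; [apply: measurable_fun_pair => //; exact: measurable_fst | exact: Ht].
have hFt : {ae (D \x lam)%E, forall p, F (theta p) = p.1}.
  have mE : measurable [set q : M * W | F q.2 = q.1].
    apply: (measurable_eq cM); last exact: measurable_fst.
    exact: (measurableT_comp mF measurable_snd).
  by apply: (mp_ae mpJ (H := [set q : M * W | F q.2 = q.1])); apply: (mp_aeP mE (mp_law pi mFw)); exact: aeW.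
pose k B m := mean lam (fun u => \1_B (theta (m, u)) : R).
have mind B : measurable B -> measurable_fun setT (fun p => \1_B (theta p) : R).
  by move=> mB; apply: (measurableT_comp _ mt); exact: measurable_indic.
have mk B : measurable B -> measurable_fun setT (k B).
  move=> mB; apply: (measurable_mean_section lam (mind B mB)).
  by move=> p; have /andP[] := indic01 R B (theta p).
have bth B : measurable B -> bdm (fun p => \1_B (theta p) : R).
  by move=> mB; apply: bdm01; [exact: mind|move=> p; exact: indic01].
have k01 B m : measurable B -> 0 <= k B m <= 1.
  move=> mB; apply: mean01 => [|u]; last exact: indic01.
  exact: (bdm_comp (measurable_fun_pair (measurable_cst m) (@measurable_id _ _ _)) (bth B mB)).
have indE T0 (A B : set T0) (C : set T0) x : (C x <-> A x /\ B x) -> \1_C x = \1_A x * \1_B x :> R.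
  move=> CAB; rewrite !indicE -natrM mulnb; congr (_%:R); congr nat_of_bool.
  by apply/idP/andP; rewrite !inE => /CAB.
have prob_mean d0 (T0 : measurableType d0) (N : probability T0 R) (A : set T0) :
    measurable A -> N A = (mean N \1_A)%:E.
  by move=> mA; rewrite mean_indic// fineK// pr_fin.
have bk B : measurable B -> bdm (k B) by move=> mB; apply: bdm01; [exact: mk | move=> m; exact: k01].
have kZ B (a : M -> R) m : measurable B ->
    mean lam (fun u => \1_B (theta (m, u)) * a m) = k B m * a m.
  move=> mB; apply: meanZr.
  exact: (bdm_comp (measurable_fun_pair (measurable_cst m) (@measurable_id _ _ _)) (bth B mB)).
have K2 B A : measurable B -> measurable A ->
    pi (B `&` F @^-1` A) = (mean D (fun m => k B m * \1_A m))%:E.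
  move=> mB mA.
  have mH : measurable [set q : M * W | A q.1 /\ B q.2].
    by apply: measurableI; [exact: (preimT measurable_fst)|exact: (preimT measurable_snd)].
  transitivity ((D \x lam)%E [set p | A p.1 /\ B (theta p)]).
    by rewrite [RHS](Ht _ mH); congr (pi _); apply/seteqP; split => w [].
  have mfA : measurable_fun setT (fun p : M * U => \1_A p.1 : R).
    by apply: (measurableT_comp _ (@measurable_fst _ _ M U)); exact: measurable_indic.
  rewrite [LHS]prob_mean; last exact: (preimT mpJ.1 mH).
  congr (_%:E); transitivity (mean (D \x lam)%E (fun p => \1_B (theta p) * \1_A p.1)).
    congr mean; apply/funext => p.
    rewrite (indE _ (theta @^-1` B) (fst @^-1` A)); first by rewrite !indicE.
    by rewrite /preimage /=; tauto.
  rewrite mean_fubini.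
  - by congr mean; apply/funext => m; exact: kZ.
  - by apply: measurable_funM => //; exact: mind.
  - by move=> p; apply: mul01; exact: indic01.
have K1 B B' : measurable B -> measurable B' ->
    rho (B `*` B') = (mean D (fun m => k B m * k B' m))%:E.
  move=> mB mB'; rewrite -[LHS]/(Pr _).
  rewrite [LHS]prob_mean; last by apply: (preimT mw); exact: measurableX.
  have m1 : measurable_fun setT (fun o : (M * U) * U => \1_B (w1 o) : R).
    by apply: (measurableT_comp _ mp1.1); exact: measurable_indic.
  have m2 : measurable_fun setT (fun o : (M * U) * U => \1_B' (w2 o) : R).
    by apply: (measurableT_comp _ mp2.1); exact: measurable_indic.
  congr (_%:E); transitivity (mean Pr (fun o => \1_B (w1 o) * \1_B' (w2 o))).
    congr mean; apply/funext => p.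
    rewrite (indE _ (w1 @^-1` B) (w2 @^-1` B')); first by rewrite !indicE.
    by rewrite /preimage /=; tauto.
  rewrite mean_fubini; last 2 first.
  - exact: measurable_funM.
  - by move=> o; apply: mul01; exact: indic01.
  transitivity (mean (D \x lam)%E (fun p => \1_B (theta p) * k B' p.1)).
    congr mean; apply/funext => -[m u]; rewrite mulrC -[in RHS](kZ B' (fun=> \1_B (theta (m, u))))//.
    by congr mean; apply/funext => v; rewrite mulrC.
  rewrite mean_fubini.
  - by congr mean; apply/funext => m; exact: kZ.
  - apply: measurable_funM; first exact: mind.
    exact: (measurableT_comp (mk _ mB') measurable_fst).
  - by move=> p; apply: mul01; [exact: indic01|exact: k01].
exists rho; split.
- split; first exact: measurable_fst.
  exact: mp1.2.
- split; first exact: measurable_snd.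
  exact: mp2.2.
- apply: (mp_aeP _ (mp_law Pr mw)).
    apply: (measurable_eq cM); first exact: (measurableT_comp mF measurable_fst).
    exact: (measurableT_comp mF measurable_snd).
  by apply: filterS2 (mp_ae (mp_fst _ _) hFt) (mp_ae mpf hFt) => o /= -> ->.
- move=> g g' h' hg hg' mh' gK Fg.
  have mgg : measurable_fun setT (fun p : W * W => (g p.1, g p.2)).
    apply: measurable_fun_pair.
      exact: (measurableT_comp hg.1 measurable_fst).
    exact: (measurableT_comp hg.1 measurable_snd).
  have kg B : measurable B -> {ae D, forall m, k (g @^-1` B) m = k B (g' m)}.
    move=> mB; have mgB : measurable (g @^-1` B) := preimT hg.1 mB.
    apply: ae_eq_of_integrals.
    - by apply: bdm01; [exact: mk | move=> m; exact: k01].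
    - apply: (bdm_comp hg'.1); by apply: bdm01; [exact: mk | move=> m; exact: k01].
    move=> A mA; apply: EFin_inj; rewrite -K2//.
    have mhA := preimT mh' mA.
    transitivity (pi (B `&` F @^-1` (h' @^-1` A))).
      rewrite -(hg.2 (B `&` F @^-1` (h' @^-1` A))); last by apply: measurableI => //; exact: preimT.
      by congr (pi _); apply/seteqP; split => w; rewrite /preimage /setI /= Fg gK.
    rewrite K2//; congr (_%:E).
    have bb : bdm (fun m => k B m * \1_(h' @^-1` A) m).
      by apply: bdmM; [apply: bdm01; [exact: mk | move=> m; exact: k01]|exact: bdm_indic].
    rewrite -[LHS](mean_mp hg' bb); congr mean; apply/funext => m /=; congr (_ * _).
    rewrite !indicE; congr (_%:R); congr nat_of_bool.
    by apply/idP/idP; rewrite !inE /preimage /= gK.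
  have := @prod_probability_eq _ _ _ _ _ (law rho mgg) rho.
  move=> h; split => //; apply: h => B B' mB mB'; rewrite -[LHS]/(rho _).
  rewrite (_ : _ @^-1` _ = (g @^-1` B) `*` (g @^-1` B')); last by [].
  rewrite [LHS](K1 _ _ (preimT hg.1 mB) (preimT hg.1 mB')) [RHS](K1 _ _ mB mB').
  congr (_%:E); rewrite -[RHS](mean_mp hg' (bdmM (bk _ mB) (bk _ mB'))); apply: mean_ae_eq.
  + by apply: bdmM; apply: bk; exact: (preimT hg.1).
  + exact: (bdm_comp hg'.1 (bdmM (bk _ mB) (bk _ mB'))).
  + by apply: filterS2 (kg _ mB) (kg _ mB') => m -> ->.
- move=> d0 V h cV mh /(mp_ae (mp_law Pr mw)) hh.
  have /(ae_prodE (mu := lam)) := ae_swap hh.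
  move=> /ae_ex[u2 hu2]; pose xi m := h (theta (m, u2)).
  have mxi : measurable_fun setT xi.
    apply: (measurableT_comp mh); apply: (measurableT_comp mt).
    exact: (measurable_fun_pair (@measurable_id _ _ _) (measurable_cst u2)).
  exists xi; split => //.
  have mH : measurable [set q : M * W | xi q.1 = h q.2].
    apply: (measurable_eq cV); first exact: (measurableT_comp mxi measurable_fst).
    exact: (measurableT_comp mh measurable_snd).
  apply: (mp_ae (mp_law pi mFw) (H := [set q : M * W | xi q.1 = h q.2])).
  by apply: (mp_aeP mH mpJ); apply: filterS hu2 => p /= e; rewrite /xi -e.
Qed.

End relative_coupling.

(** * Pairs of samples with the same matrix *)

Section determining_sets.

Lemma bitseqs_determining (R : realType) (P Q : probability bitseqs R) :
  (forall t : seq nat, P [set b : bitseqs | all b t] = Q [set b : bitseqs | all b t]) ->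
  forall A, measurable A -> P A = Q A.
Proof.
move=> PQ; pose G := [set B : set bitseqs | exists t : seq nat, B = [set b : bitseqs | all b t]].
apply: (@probability_eq _ _ _ G).
- move=> _ _ [s ->] [t ->]; exists (s ++ t); apply/seteqP; split => b; rewrite /= all_cat.
    by move=> [-> ->].
  by move=> /andP.
- apply/seteqP; split; last first.
    apply: smallest_sub; first exact: sigma_algebra_measurable.
    move=> _ [t ->]; rewrite (_ : [set b | _] = \bigcap_(i in [set` t]) [set b : bitseqs | b i]).
      by apply: bigcap_measurableType => // i _; exact: measurable_bit.
    by apply/seteqP; split => b; [move=> /allP|move=> h; apply/allP].
  apply: smallest_sub; first exact: smallest_sigma_algebra.
  move=> _ [i [A mA ->]].
  pose T' := g_sigma_algebraType G.
  have mi : measurable_fun setT (fun b : T' => b i).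
    apply: (@measurable_fun_bool _ _ _ _ true); rewrite setTI.
    apply: sub_sigma_algebra; exists [:: i]; apply/seteqP; split => b /=; rewrite andbT //.
  exact: (preimT mi mA).
- by move=> _ [t ->].
Qed.

(** The finite intersections of the sets of codes having a given bit equal
    to [true] are a countable generating pi-system. *)
Lemma countably_determined d (X : measurableType d) : coded X ->
  exists E : nat -> set X, (forall n, measurable (E n)) /\
    forall (R : realType) (P Q : probability X R), (forall n, P (E n) = Q (E n)) ->
      forall A, measurable A -> P A = Q A.
Proof.
move=> [c [r [mc mr cr]]].
pose E n := [set x | all (c x) (if @unpickle (seq nat) n is Some t then t else [::])].
have mE n : measurable (E n).
  rewrite (_ : E n = \bigcap_(i in [set` if @unpickle (seq nat) n is Some t then t else [::]])
      [set x | c x i]).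
    by apply: bigcap_measurableType => // i _; exact: (preimT mc (measurable_bit i)).
  by apply/seteqP; split => b; [move=> /allP|move=> h; apply/allP].
exists E; split=> // R P Q PQ A mA.
have h : forall B, measurable B -> law P mc B = law Q mc B.
  apply: bitseqs_determining => t; have := PQ (pickle t).
  by rewrite /E pickleK.
have := h _ (preimT mr mA); rewrite /law /pushforward.
by rewrite (_ : c @^-1` (r @^-1` A) = A)//; apply/seteqP; split => x; rewrite /preimage /= cr.
Qed.

End determining_sets.

Section random_maps.
Context (R : realType) d0 (T : measurableType d0) d1 (V : measurableType d1)
  d (X : measurableType d).
Variables (rho : probability T R) (tau : probability V R) (mu : probability X R).
Hypothesis cX : coded X.
Variable v : T -> V.

(** [x'] has law [mu] given [v], and so has [S (v, x)] for almost every
    value of [v]. The exceptional null set is made independent of the test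
    set by [countably_determined]. *)
Lemma random_map_preserving (S : V * X -> X) (x x' : T -> X) :
  measure_preserving rho (tau \x mu)%E (fun o => (v o, x o)) ->
  measure_preserving rho (tau \x mu)%E (fun o => (v o, x' o)) ->
  measurable_fun setT S -> {ae rho, forall o, S (v o, x o) = x' o} ->
  {ae tau, forall u, measure_preserving mu mu (fun z => S (u, z))}.
Proof.
move=> hx hx' mS hS; have [E [mE detE]] := countably_determined cX.
have mSu u : measurable_fun setT (fun z => S (u, z)).
  exact: (measurableT_comp mS (measurable_fun_pair (measurable_cst u) (@measurable_id _ _ _))).
have mp2 : measure_preserving (tau \x mu)%E (tau \x mu)%E (fun p => (p.1, S p)).
  have mf : measurable_fun setT (fun p : V * X => (p.1, S p)).
    by apply: measurable_fun_pair => //; exact: measurable_fst.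
  split => // B mB; rewrite -(hx.2 _ (preimT mf mB)) -(hx'.2 _ mB).
  apply: prob_ae_eq.
  - by apply: (preimT hx.1); exact: preimT.
  - exact: (preimT hx'.1).
  - by apply: filterS hS => o e; rewrite /preimage /= e.
have : {ae tau, forall u, forall n, mu [set z | E n (S (u, z))] = mu (E n)}.
  apply/ae_foralln => n.
  have mi : measurable_fun setT (\1_(E n) : X -> R) by exact: measurable_indic.
  have miS : measurable_fun setT (fun p => \1_(E n) (S p) : R) by exact: (measurableT_comp mi mS).
  have biu u : bdm (fun z => \1_(E n) (S (u, z)) : R).
    by apply: bdm01; [exact: (measurableT_comp mi (mSu u)) | move=> z; exact: indic01].
  have b1 : bdm (fun u => mean mu (fun z => \1_(E n) (S (u, z)))).
    apply: bdm01; first by apply: (measurable_mean_section mu miS) => p; have /andP[] := indic01 R (E n) (S p).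
    by move=> u; apply: mean01 => // z; exact: indic01.
  have h : {ae tau, forall u, mean mu (fun z => \1_(E n) (S (u, z))) = mean mu (\1_(E n))}.
    apply: ae_eq_of_integrals => //; first exact: bdm_cst.
    move=> A mA; pose g (p : V * X) : R := \1_(E n) p.2 * \1_A p.1.
    have mg : measurable_fun setT g.
      apply: measurable_funM; first exact: (measurableT_comp mi measurable_snd).
      by apply: (measurableT_comp _ measurable_fst); exact: measurable_indic.
    have g01 p : 0 <= g p <= 1 by apply: mul01; exact: indic01.
    have bg := bdm01 mg g01.
    transitivity (mean (tau \x mu)%E (g \o (fun p => (p.1, S p)))).
      rewrite mean_fubini; last 2 first.
      - exact: (measurableT_comp mg mp2.1).
      - by move=> p; exact: g01.
      by congr mean; apply/funext => u; rewrite -meanZr.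
    rewrite [LHS](mean_mp mp2 bg) -[LHS]/(mean _ _) mean_fubini//.
    by congr mean; apply/funext => u; rewrite -meanZr//; exact: bdm_indic.
  apply: filterS h => u e; have mEu := preimT (mSu u) (mE n).
  have h1 := mean_indic mu mEu; have h2 := mean_indic mu (mE n).
  rewrite -[LHS]fineK ?pr_fin// -[RHS]fineK ?pr_fin//; congr (_%:E).
  by rewrite -h1 -h2 -e; congr mean; apply/funext => z; rewrite !indicE.
apply: filterS => u hu; split => // A mA; rewrite -[LHS]/(law mu (mSu u) A).
by apply: detE => // n; exact: hu.
Qed.

Lemma random_map_isomorphism (S S' : V * X -> X) (x x' : T -> X) :
  measure_preserving rho (tau \x mu)%E (fun o => (v o, x o)) ->
  measure_preserving rho (tau \x mu)%E (fun o => (v o, x' o)) ->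
  measurable_fun setT S -> measurable_fun setT S' ->
  {ae rho, forall o, S (v o, x o) = x' o} -> {ae rho, forall o, S' (v o, x' o) = x o} ->
  {ae tau, forall u, isomorphism_mod0 mu mu (fun z => S (u, z))}.
Proof.
move=> hx hx' mS mS' hS hS'.
have cancel_ae (G G' : V * X -> X) (a a' : T -> X) :
    measure_preserving rho (tau \x mu)%E (fun o => (v o, a o)) ->
    measurable_fun setT G -> measurable_fun setT G' ->
    {ae rho, forall o, G (v o, a o) = a' o} -> {ae rho, forall o, G' (v o, a' o) = a o} ->
    {ae tau, forall u, {ae mu, forall z, G' (u, G (u, z)) = z}}.
  move=> ha mG mG' hG hG'.
  apply: (ae_prodE (H := fun p => G' (p.1, G p) = p.2)).
  apply: (mp_aeP _ ha (H := [set p | G' (p.1, G p) = p.2])).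
    apply: (measurable_eq cX); last exact: measurable_snd.
    by apply: (measurableT_comp mG'); apply: measurable_fun_pair => //; exact: measurable_fst.
  by apply: filterS2 hG hG' => o /= -> ->.
have h1 := random_map_preserving hx hx' mS hS.
have h2 := random_map_preserving hx' hx mS' hS'.
have h3 := cancel_ae _ _ _ _ hx mS mS' hS hS'.
have h4 := cancel_ae _ _ _ _ hx' mS' mS hS' hS.
have h12 : {ae tau, forall u, measure_preserving mu mu (fun z => S (u, z)) /\
  measure_preserving mu mu (fun z => S' (u, z))} by apply: filterS2 h1 h2.
apply: filterS3 h12 h3 h4 => u [a b] c e; split => //.
by exists (fun z => S' (u, z)).
Qed.

Lemma random_map_trivial (S : V * X -> X) (x x' : T -> X) :
  measure_preserving rho (tau \x mu)%E (fun o => (v o, x o)) ->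
  measurable_fun setT S -> {ae rho, forall o, S (v o, x o) = x' o} ->
  {ae tau, forall u, {ae mu, forall z, S (u, z) = z}} ->
  {ae rho, forall o, x o = x' o}.
Proof.
move=> hx mS hS h.
have : {ae (tau \x mu)%E, forall p, S p = p.2}.
  apply: (ae_prodI (H := [set p | S p = p.2])); last exact: h.
  by apply: (measurable_eq cX) => //; exact: measurable_snd.
by move=> /(mp_ae hx); apply: filterS2 hS => o e1 e2; rewrite -e1 [RHS]e2.
Qed.

End random_maps.

Section coupled_samples.
Context (R : realType) d (X : measurableType d) d' (Y : measurableType d')
  dZ (Z : measurableType dZ).
Variables (mu : probability X R) (nu : probability Y R) (f : X * Y -> Z).
Hypothesis mf : measurable_fun setT f.
Hypotheses (cX : coded X) (cY : coded Y) (cZ : coded Z).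
Variables (P : probability (power nat X) R) (Q : probability (power nat Y) R).
Hypotheses (hP : is_power_measure mu P) (hQ : is_power_measure nu Q).
Variable D : probability (matrices Z) R.
Hypothesis hD : measure_preserving (P \x Q)%E D (sampled f).
Hypothesis hinv : invariant_measure D.

Let W := (power nat X * power nat Y)%type.
Let pi : probability W R := (P \x Q)%E.

Let odds (w : W) : W := (w.1 \o (fun i => i.*2.+1), w.2 \o (fun i => i.*2.+1)).
Let evens k (w : W) : X * Y := (w.1 k.*2, w.2 k.*2).
Let swaps k (w : W) : W := (w.1 \o swap_nat 0 k.*2, w.2 \o swap_nat 0 k.*2).

Let odds_inj : injective (fun i => i.*2.+1).
Proof. by move=> i j [] /double_inj. Qed.

Let odds_swaps k w : odds (swaps k w) = odds w.
Proof.
have e i : swap_nat 0 k.*2 i.*2.+1 = i.*2.+1.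
  by rewrite /swap_nat /=; case: eqP => // /(congr1 odd); rewrite /= !odd_double.
by rewrite /odds /swaps; congr (_, _); apply/funext => i /=; rewrite e.
Qed.

Let evens_swaps k w : evens 0 (swaps k w) = evens k w.
Proof. by rewrite /evens /swaps /= /swap_nat eqxx. Qed.

Let mp_odds : measure_preserving pi pi odds.
Proof. exact: (mp_reindex2 hP hQ odds_inj odds_inj). Qed.

Let mp_evens k : measure_preserving pi (mu \x nu)%E (evens k).
Proof. exact: (mp_entry hP hQ). Qed.

Let mp_evens2 k l : k != l ->
  measure_preserving pi ((mu \x nu) \x (mu \x nu))%E (fun w => (evens k w, evens l w)).
Proof.
move=> kl; have kl2 : k.*2 != l.*2 by rewrite (inj_eq double_inj).
exact: (mp_comp (mp_prod (mp_coord2 hP kl2) (mp_coord2 hQ kl2)) (mp_interchange _ _ _ _)).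
Qed.

Variable rho : probability (W * W)%type R.
Hypothesis rho_swaps : forall k, measure_preserving rho rho (fun p => (swaps k p.1, swaps k p.2)).

Let both_odds (p : W * W) : W * W := (odds p.1, odds p.2).
Let mboth : measurable_fun setT both_odds.
Proof.
apply: measurable_fun_pair.
  exact: (measurableT_comp mp_odds.1 measurable_fst).
exact: (measurableT_comp mp_odds.1 measurable_snd).
Qed.
Let tau := law rho mboth.

(** Exchanging the indices [0] and [k.*2] in both samples preserves [rho]
    and the points of odd index, and moves the pair of points of index [0]
    to that of index [k.*2]. These pairs are pairwise independent, and they
    all have the same correlation with the points of odd index:
    [independent_of_constant_correlation] applies. *)
Lemma independent_of_odds (pr : W * W -> W) : measure_preserving rho pi pr ->
  (forall k p, pr (swaps k p.1, swaps k p.2) = swaps k (pr p)) ->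
  measure_preserving rho (tau \x (mu \x nu))%E (fun p => (both_odds p, evens 0 (pr p))).
Proof.
move=> hpr prs; have mpe k := mp_comp hpr (mp_evens k).
apply: mp_pair => //; first exact: (mpe 0%N).1.
move=> A B mA mB; pose U k := (fun p => evens k (pr p)) @^-1` B.
have mU k : measurable (U k) := preimT (mpe k).1 mB.
have mV : measurable (both_odds @^-1` A) := preimT mboth mA.
pose p := fine ((mu \x nu)%E B); pose c := fine (rho (both_odds @^-1` A `&` U 0%N)).
have pE : (mu \x nu)%E B = p%:E by rewrite fineK// pr_fin.
have mUV k : measurable (both_odds @^-1` A `&` U k) by exact: measurableI.
have := @independent_of_constant_correlation _ _ _ rho U (both_odds @^-1` A) p c mU mV.
have h1 k : rho (U k) = p%:E by rewrite -pE; exact: (mpe k).2.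
have h2 k l : k != l -> rho (U k `&` U l) = (p * p)%:E.
  move=> kl; rewrite EFinM -!pE -prodE//.
  rewrite -((mp_comp hpr (mp_evens2 kl)).2 (B `*` B))//; exact: measurableX.
have h3 k : rho (U k `&` both_odds @^-1` A) = c%:E.
  rewrite setIC /c fineK ?pr_fin// -((rho_swaps k).2 _ (mUV 0%N)); congr (rho _).
  apply/seteqP; split => q; rewrite /preimage /U /both_odds /setI /= prs evens_swaps !odds_swaps //.
move=> /(_ h1 h2 h3) e; rewrite -[LHS]/(rho (both_odds @^-1` A `&` U 0%N)) -[LHS]fineK ?pr_fin//.
rewrite -[fine _]/c e EFinM muleC; congr (_ * _)%E; last exact: esym pE.
by rewrite fineK ?pr_fin.
Qed.

Hypotheses (rho1 : measure_preserving rho pi fst) (rho2 : measure_preserving rho pi snd).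
Hypothesis rhoF : {ae rho, forall p, sampled f p.1 = sampled f p.2}.
Variables (zetaX : power nat Y * power nat Z -> X) (zetaY : power nat X * power nat Z -> Y).
Hypotheses (mzX : measurable_fun setT zetaX) (mzY : measurable_fun setT zetaY).
Hypothesis hzX : {ae (mu \x Q)%E, forall w : X * power nat Y,
  zetaX (w.2, fun l => f (w.1, w.2 l)) = w.1}.
Hypothesis hzY : {ae (nu \x P)%E, forall w : Y * power nat X,
  zetaY (w.2, fun l => f (w.2 l, w.1)) = w.1}.
Hypothesis htriv : trivial_congruence_group mu nu f.

(** The point of [X] whose values at the points of [y'] are those of a given
    point at the points of [y]. *)
Let moveX (y y' : (W * W) -> power nat Y) (q : (W * W) * X) : X :=
  zetaX (y' q.1, fun l => f (q.2, y q.1 l)).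
Let moveY (x x' : (W * W) -> power nat X) (q : (W * W) * Y) : Y :=
  zetaY (x' q.1, fun l => f (x q.1 l, q.2)).

Let measurable_moveX y y' : measurable_fun setT y -> measurable_fun setT y' ->
  measurable_fun setT (moveX y y').
Proof.
move=> my my'; apply: (measurableT_comp mzX); apply: measurable_fun_pair.
  exact: (measurableT_comp my' measurable_fst).
apply: measurable_fun_power => l; apply: (measurableT_comp mf); apply: measurable_fun_pair.
  exact: measurable_snd.
exact: (measurableT_comp (measurable_coord l) (measurableT_comp my measurable_fst)).
Qed.

Let measurable_moveY x x' : measurable_fun setT x -> measurable_fun setT x' ->
  measurable_fun setT (moveY x x').
Proof.
move=> mx mx'; apply: (measurableT_comp mzY); apply: measurable_fun_pair.
  exact: (measurableT_comp mx' measurable_fst).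
apply: measurable_fun_power => l; apply: (measurableT_comp mf); apply: measurable_fun_pair.
  exact: (measurableT_comp (measurable_coord l) (measurableT_comp mx measurable_fst)).
exact: measurable_snd.
Qed.

(** [S] and [S'] express the points of index [0] of each sample in terms of
    those of the other, so they are mutually inverse; both points being
    independent of the odd indices, almost all maps of the two families
    preserve [mu]. With [T] and [T'] they form elements of the congruence
    group. *)
Lemma coupled_samples_agree :
  {ae rho, forall p, p.1.1 0%N = p.2.1 0%N} /\ {ae rho, forall p, p.1.2 0%N = p.2.2 0%N}.
Proof.
have hz1 := independent_of_odds rho1 (fun k p => erefl).
have hz2 := independent_of_odds rho2 (fun k p => erefl).
have hx1 : measure_preserving rho (tau \x mu)%E (fun p => (both_odds p, p.1.1 0%N)).
  exact: (mp_comp hz1 (mp_prod (mp_id tau) (mp_fst mu nu))).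
have hx2 : measure_preserving rho (tau \x mu)%E (fun p => (both_odds p, p.2.1 0%N)).
  exact: (mp_comp hz2 (mp_prod (mp_id tau) (mp_fst mu nu))).
have hy1 : measure_preserving rho (tau \x nu)%E (fun p => (both_odds p, p.1.2 0%N)).
  exact: (mp_comp hz1 (mp_prod (mp_id tau) (mp_snd mu nu))).
have hy2 : measure_preserving rho (tau \x nu)%E (fun p => (both_odds p, p.2.2 0%N)).
  exact: (mp_comp hz2 (mp_prod (mp_id tau) (mp_snd mu nu))).
have m1 := @measurable_fst _ _ W W; have m2 := @measurable_snd _ _ W W.
have mX := @measurable_fst _ _ (power nat X) (power nat Y).
have mY := @measurable_snd _ _ (power nat X) (power nat Y).
have mx1 := measurableT_comp mX m1; have mx2 := measurableT_comp mX m2.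
have my1 := measurableT_comp mY m1; have my2 := measurableT_comp mY m2.
pose S := moveX (fun v => v.1.2) (fun v => v.2.2).
pose S' := moveX (fun v => v.2.2) (fun v => v.1.2).
pose T := moveY (fun v => v.1.1) (fun v => v.2.1).
pose T' := moveY (fun v => v.2.1) (fun v => v.1.1).
have mS : measurable_fun setT S by exact: measurable_moveX.
have mS' : measurable_fun setT S' by exact: measurable_moveX.
have mT : measurable_fun setT T by exact: measurable_moveY.
have mT' : measurable_fun setT T' by exact: measurable_moveY.
have pointX : {ae pi, forall w : W, zetaX (w.2 \o (fun i => i.*2.+1),
    fun l => f (w.1 0%N, w.2 l.*2.+1)) = w.1 0%N}.
  exact: (mp_ae (mp_prod (mp_coord 0 hP) (mp_reindex hQ odds_inj)) hzX).
have pointY : {ae pi, forall w : W, zetaY (w.1 \o (fun i => i.*2.+1),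
    fun l => f (w.1 l.*2.+1, w.2 0%N)) = w.2 0%N}.
  have := ae_swap (mp_ae (mp_prod (mp_coord 0 hQ) (mp_reindex hP odds_inj)) hzY).
  by [].
have same : {ae rho, forall p, forall i j, f (p.1.1 i, p.1.2 j) = f (p.2.1 i, p.2.2 j)}.
  by apply: filterS rhoF => p e i j; exact: (congr1 (fun r : matrices Z => r (i, j)) e).
have hS : {ae rho, forall p, S (both_odds p, p.1.1 0%N) = p.2.1 0%N}.
  apply: filterS2 (mp_ae rho2 pointX) same => p <- e; congr (zetaX (_, _)).
  by apply/funext => l; exact: e.
have hS' : {ae rho, forall p, S' (both_odds p, p.2.1 0%N) = p.1.1 0%N}.
  apply: filterS2 (mp_ae rho1 pointX) same => p <- e; congr (zetaX (_, _)).
  by apply/funext => l; exact: esym (e _ _).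
have hT : {ae rho, forall p, T (both_odds p, p.1.2 0%N) = p.2.2 0%N}.
  apply: filterS2 (mp_ae rho2 pointY) same => p <- e; congr (zetaY (_, _)).
  by apply/funext => l; exact: e.
have hT' : {ae rho, forall p, T' (both_odds p, p.2.2 0%N) = p.1.2 0%N}.
  apply: filterS2 (mp_ae rho1 pointY) same => p <- e; congr (zetaY (_, _)).
  by apply/funext => l; exact: esym (e _ _).
have isoS := random_map_isomorphism cX hx1 hx2 mS mS' hS hS'.
have isoT := random_map_isomorphism cY hy1 hy2 mT mT' hT hT'.
have hint : {ae tau, forall u, intertwines mu nu f f (fun x => S (u, x)) (fun y => T (u, y))}.
  apply: (ae_prodE (H := fun q => f (S (q.1, q.2.1), T (q.1, q.2.2)) = f q.2)).
  apply: (mp_aeP (H := [set q | f (S (q.1, q.2.1), T (q.1, q.2.2)) = f q.2]) _ hz1).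
    have n1 := @measurable_fst _ _ (W * W)%type (X * Y)%type.
    have n2 := @measurable_snd _ _ (W * W)%type (X * Y)%type.
    apply: (measurable_eq cZ); last exact: (measurableT_comp mf n2).
    apply: (measurableT_comp mf); apply: measurable_fun_pair.
      apply: (measurableT_comp mS); apply: measurable_fun_pair => //.
      exact: (measurableT_comp measurable_fst n2).
    apply: (measurableT_comp mT); apply: measurable_fun_pair => //.
    exact: (measurableT_comp measurable_snd n2).
  by apply: filterS3 hS hT same => p /= -> -> e; exact: esym (e 0%N 0%N).
have htr : {ae tau, forall u, {ae mu, forall z, S (u, z) = z} /\ {ae nu, forall z, T (u, z) = z}}.
  apply: filterS3 isoS isoT hint => u a b c.
  exact: (htriv (g := (fun x => S (u, x), fun y => T (u, y))) (And3 a b c)).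
split.
- by apply: (random_map_trivial cX hx1 mS hS); apply: filterS htr => u [].
- by apply: (random_map_trivial cY hy1 mT hT); apply: filterS htr => u [].
Qed.

End coupled_samples.

(** In a relatively independent pair of samples with the same matrix, the
    points of index [0] agree, so they are functions of the matrix. *)
Lemma pure_rigid_recovery (R : realType) d (X : measurableType d) d' (Y : measurableType d')
    dZ (Z : measurableType dZ) (mu : probability X R) (nu : probability Y R) (f : X * Y -> Z)
    (P : probability (power nat X) R) (Q : probability (power nat Y) R)
    (D : probability (matrices Z) R) :
  coded X -> coded Y -> coded Z -> measurable_fun setT f ->
  is_power_measure mu P -> is_power_measure nu Q ->
  measure_preserving (P \x Q)%E D (sampled f) -> invariant_measure D ->
  pure mu nu f -> trivial_congruence_group mu nu f ->
  exists (xi : matrices Z -> X) (eta : matrices Z -> Y),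
    [/\ measurable_fun setT xi, measurable_fun setT eta,
        {ae (P \x Q)%E, forall w : power nat X * power nat Y, xi (sampled f w) = w.1 0%N} &
        {ae (P \x Q)%E, forall w : power nat X * power nat Y, eta (sampled f w) = w.2 0%N}].
Proof.
move=> cX cY cZ mf hP hQ hD hinv hpure htriv.
have [[zetaX [mzX hzX]] [zetaY [mzY hzY]]] := pure_recover_point cX cY cZ mf hP hQ hpure.
have cW : coded (power nat X * power nat Y)%type by apply: coded_pair; exact: coded_power.
have cM : coded (matrices Z) by exact: coded_power.
have [rho [rho1 rho2 rhoF rhog rhoh]] := relative_coupling cW cM hD.
have rho_swaps k : measure_preserving rho rho (fun p =>
    ((p.1.1 \o swap_nat 0 k.*2, p.1.2 \o swap_nat 0 k.*2),
     (p.2.1 \o swap_nat 0 k.*2, p.2.2 \o swap_nat 0 k.*2))).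
  pose g : perm2 := (finperm_swap 0 k.*2, finperm_swap 0 k.*2).
  apply: (rhog (fun w : power nat X * power nat Y =>
    (w.1 \o swap_nat 0 k.*2, w.2 \o swap_nat 0 k.*2)) (act g) (act g)) => //.
  - by apply: (mp_reindex2 hP hQ); apply: inv_inj; exact: swap_natK.
  - exact: mp_act.
  - exact: measurable_act.
  - by move=> r; apply/funext => -[i j]; rewrite /act /= !swap_natK.
have [hx hy] := coupled_samples_agree mf cX cY cZ hP hQ rho_swaps rho1 rho2 rhoF
  mzX mzY hzX hzY htriv.
have [|xi [mxi hxi]] := rhoh _ X (fun w => w.1 0%N) cX _ hx.
  exact: (measurableT_comp (measurable_coord 0%N) measurable_fst).
have [|eta [meta heta]] := rhoh _ Y (fun w => w.2 0%N) cY _ hy.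
  exact: (measurableT_comp (measurable_coord 0%N) measurable_snd).
by exists xi, eta.
Qed.

Theorem theorem5p4 (R : realType) (dZ : measure_display)
    (Z : measurableType dZ) (hZ : standard_borel R Z)
    (D : probability (matrices Z) R)
    (hinv : invariant_measure D) (herg : ergodic_measure D) :
  (exists (dX : measure_display) (X : measurableType dX)
          (dY : measure_display) (Y : measurableType dY)
          (mu : probability X R) (nu : probability Y R) (f : X * Y -> Z),
      standard_borel R X /\ standard_borel R Y /\
      measurable_fun [set: X * Y] f /\
      pure mu nu f /\
      trivial_congruence_group mu nu f /\
      is_matrix_distribution mu nu f D)
  <-> simple_measure D.
Proof.
have cZ := standard_borel_coded hZ; split.
  move=> [dX [X [dY [Y [mu [nu [f [sX [sY [mf [hpure [htriv [P [Q [hP hQ hPQ]]]]]]]]]]]]]]].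
  have cX := standard_borel_coded sX; have cY := standard_borel_coded sY.
  have hD : measure_preserving (P \x Q)%E D (sampled f).
    by split; [exact: measurable_sampled | move=> B mB; rewrite [RHS]hPQ].
  have [xi [eta [mxi meta hxi heta]]] :=
    pure_rigid_recovery cX cY cZ mf hP hQ hD hinv hpure htriv.
  exact: (recovery_simple hP hQ mf mxi meta hxi heta cX cY cZ hD).
move=> hs.
have [mu [nu [P [Q [f [xi [eta [hP hQ [mf mxi meta] hD [hxi heta]]]]]]]]] :=
  simple_realized hinv herg cZ hs.
have sR := standard_borel_real R; have cR := standard_borel_coded sR.
exists _, (measurableTypeR R), _, (measurableTypeR R), mu, nu, f.
split=> //; split=> //; split=> //; split.
  exact: (recovery_pure hP hQ mxi meta hxi heta).
split; first exact: (recovery_trivial_congruence hP hQ hxi heta cR cR).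
by exists P, Q; split => // B mB; rewrite -[LHS]hD.2.
Qed.
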